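(* The set $\mathrm{HI}=\{X\in\mathrm{SB}: X\text{ is hereditarily indecomposable}\}$ is complete coanalytic.
   Context: $\mathrm{SB}$ is the standard Borel space of closed linear subspaces of $C(\Delta)$ with the Effros–Borel structure. Hereditarily indecomposable: infinite dimensional and no closed subspace is the direct sum of two infinite dimensional closed subspaces. A coanalytic set $A$ in a standard Borel space $X$ is complete coanalytic if for every standard Borel $Y$ and coanalytic $B\subset Y$ there is Borel $f:Y\to X$ with $f^{-1}(A)=B$. *)

(* Defs.v *)
From Stdlib Require Rdefinitions.
From HB Require Import structures.
From mathcomp Require Import all_boot all_order all_algebra.
From mathcomp Require Import all_classical all_reals all_analysis.
From mathcomp Require Import Rstruct Rstruct_topology.
Set Implicit Arguments. Unset Strict Implicit. Unset Printing Implicit Defensive.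
Import Order.TTheory GRing.Theory Num.Theory.
Local Open Scope classical_set_scope.
Local Open Scope ring_scope.
Local Notation R := Rdefinitions.R.

Definition is_metric (T : Type) (d : T -> T -> R) : Prop :=
  (forall x y, 0 <= d x y) /\ (forall x y, d x y = 0 <-> x = y) /\
  (forall x y, d x y = d y x) /\ (forall x y z, d x z <= d x y + d y z).

Definition metric_open (T : Type) (d : T -> T -> R) : set (set T) :=
  [set U | forall x, U x -> exists2 e : R, 0 < e & forall y, d x y < e -> U y].

Definition polish_topology (T : Type) (O : set (set T)) : Prop :=
  exists d : T -> T -> R,
    [/\ is_metric d, O = metric_open d,
        (forall u : nat -> T,
           (forall e : R, 0 < e -> exists N, forall m n, (N <= m)%N -> (N <= n)%N ->
              d (u m) (u n) < e) ->
           exists x, forall e : R, 0 < e -> exists N, forall n, (N <= n)%N -> d (u n) x < e) &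
        exists D : set T, countable D /\
          forall x (e : R), 0 < e -> exists2 y, D y & d x y < e].

Definition standard_borel (T : Type) (Sigma : set (set T)) : Prop :=
  exists O : set (set T), polish_topology O /\ Sigma = <<s O >>.

Definition borel_map (Y X : Type) (SY : set (set Y)) (SX : set (set X))
  (f : Y -> X) : Prop :=
  forall A, SX A -> SY (f @^-1` A).

Definition baire_open : set (set (nat -> nat)) :=
  [set U | forall x, U x -> exists n : nat,
     forall y, (forall i, (i < n)%N -> y i = x i) -> U y].
Definition baire_borel : set (set (nat -> nat)) := <<s baire_open >>.

Definition analytic (X : Type) (SX : set (set X)) (A : set X) : Prop :=
  A = set0 \/ exists f : (nat -> nat) -> X, borel_map baire_borel SX f /\ range f = A.

Definition coanalytic (X : Type) (SX : set (set X)) (A : set X) : Prop :=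
  analytic SX (~` A).

Definition complete_coanalytic (X : Type) (SX : set (set X)) (A : set X) : Prop :=
  coanalytic SX A /\
  forall (Y : Type) (SY : set (set Y)), standard_borel SY ->
    forall B : set Y, coanalytic SY B ->
      exists f : Y -> X, borel_map SY SX f /\ f @^-1` A = B.

Definition CDelta : Type := cantor_space -> R.

Definition in_CDelta (f : CDelta) : Prop := continuous f.

Definition CDelta_open (U : set CDelta) : Prop :=
  U `<=` in_CDelta /\
  forall f, U f -> exists2 e : R, 0 < e &
    forall g, in_CDelta g -> (forall t, `|f t - g t| <= e) -> U g.

Definition closed_subspace (X : set CDelta) : Prop :=
  [/\ X `<=` in_CDelta,
      X (fun _ => 0),
      (forall f g, X f -> X g -> X (fun t => f t + g t)),
      (forall (a : R) f, X f -> X (fun t => a * f t)) &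
      (forall f, in_CDelta f ->
         (forall e : R, 0 < e -> exists2 g, X g & forall t, `|f t - g t| <= e) ->
         X f)].

Definition finite_dim (X : set CDelta) : Prop :=
  exists (n : nat) (v : 'I_n -> CDelta), (forall i, X (v i)) /\
    forall f, X f -> exists c : 'I_n -> R, f = (fun t => \sum_(i < n) c i * v i t).

Definition infinite_dim (X : set CDelta) : Prop := ~ finite_dim X.

(* Y is the (algebraic, hence by closedness topological) direct sum of Z and W *)
Definition direct_sum (Y Z W : set CDelta) : Prop :=
  Z `<=` Y /\ W `<=` Y /\ (Z `&` W = [set fun _ => 0]) /\
  forall y, Y y -> exists z w, Z z /\ W w /\ y = (fun t => z t + w t).

Definition hereditarily_indecomposable (X : set CDelta) : Prop :=
  infinite_dim X /\
  ~ exists Y Z W : set CDelta,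
      [/\ closed_subspace Y, Y `<=` X, closed_subspace Z, closed_subspace W &
          [/\ infinite_dim Z, infinite_dim W & direct_sum Y Z W]].

Definition SB : Type := {X : set CDelta | closed_subspace X}.

Definition effros_borel : set (set SB) :=
  <<s [set [set X : SB | exists2 f, proj1_sig X f & U f] | U in CDelta_open] >>.

Definition HI : set SB := [set X : SB | hereditarily_indecomposable (proj1_sig X)].

(* Main.v *)
(** A closed subspace is not hereditarily indecomposable iff it has finite dimension or
contains two sequences [z], [w] of separated vectors such that the norm of [u + v] dominates
that of [u] up to a constant for [u], [v] in their spans (Baire category). When
functions are coded by fast converging sequences from a countable dense set, this is a Borel
condition on codes, so the complement of [HI] is analytic.

For completeness, a coanalytic set is reduced to the well-founded trees: a Suslin
representation of its complement yields trees [T y], measurable in [y], with a branch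
iff [y] is outside the set. Vectors indexed by the finite sequences of integers are normed by
a Gowers-Maurey type set of functionals, whose ground functionals are the signs supported on
chains. It is closed under the averages of even weight, and under those of odd weight along
special sequences. Along a branch the ground functionals give the norm of l^1, so
if [T] has a branch then the span of its nodes is not hereditarily indecomposable. If [T] is well
founded, then a gliding hump argument along the tree finds, in every block subspace, vectors
which are small on all ground functionals, and the Gowers-Maurey argument with dependent
sequences applies to them. Evaluating at the norming functionals, which are coded by a retract
of the Cantor space, embeds everything in C(Delta). *)

Require Import Defs.
From mathcomp Require Import all_boot all_order all_algebra.
From mathcomp Require Import all_classical all_reals all_analysis.
From mathcomp Require Import Rstruct Rstruct_topology ring lra zify.

Set Implicit Arguments. Unset Strict Implicit. Unset Printing Implicit Defensive.
Import Order.TTheory GRing.Theory Num.Theory.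
Local Open Scope ring_scope.

(** Indecomposability comes from a conflict between two kinds of weights. Even weights are
    unrestricted: they bound the norm of long block sums from below, so every suitable block
    subspace contains averages that behave like $\ell^1$-averages against functionals of smaller
    index. Odd weights are rigid: the terms of a special functional have weights dictated by its
    past, so it cannot change signs at will, and once it deviates from a dependent sequence its
    later weights no longer match. Hence the sum of such a sequence is much larger than its
    alternating sum. Chains are the obstacle: they bring arbitrary signs back, so the vectors used
    must be almost invisible to them, and this is where well-foundedness is spent.

    Subspaces of the function space are compared with block subspaces up to an error chosen after
    the projection constant of the supposed decomposition, which an open mapping argument supplies.
    A standard Borel space enters the reduction only through countably many measurable sets that
    separate its points. *)

Section Pairing.
Variable R : realType.
Implicit Types (f g : nat -> R) (x y : {poly R}).

(** Polynomials stand for finitely supported vectors: linear structure and a last coordinate come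
    for free. *)
Definition ap f x : R := \sum_(i < size x) f i * x`_i.

Definition supp x (a b : nat) := forall n, x`_n != 0 -> (a <= n < b)%N.

Lemma ap_widen f x M : (size x <= M)%N -> ap f x = \sum_(i < M) f i * x`_i.
Proof.
move=> xM; rewrite /ap (big_ord_widen M (fun i => f i * x`_i) xM) big_mkcond /=.
apply: eq_bigr => i _; case: ifPn => //; rewrite -leqNgt => h.
by rewrite nth_default ?mulr0.
Qed.

Lemma apD f x y : ap f (x + y) = ap f x + ap f y.
Proof.
pose M := maxn (size x) (size y).
rewrite (@ap_widen f (x + y) M) ?size_polyD // (@ap_widen f x M) ?leq_maxl //.
rewrite (@ap_widen f y M) ?leq_maxr // -big_split; apply: eq_bigr => i _.
by rewrite coefD mulrDr.
Qed.

Lemma apZ f a x : ap f (a *: x) = a * ap f x.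
Proof.
rewrite (@ap_widen f (a *: x) (size x)) ?size_scale_leq // /ap mulr_sumr.
by apply: eq_bigr => i _; rewrite coefZ mulrCA.
Qed.

Lemma ap0 f : ap f 0 = 0. Proof. by rewrite /ap size_poly0 big_ord0. Qed.

Lemma apN f x : ap f (- x) = - ap f x.
Proof. by rewrite -scaleN1r apZ mulN1r. Qed.

Lemma apB f x y : ap f (x - y) = ap f x - ap f y.
Proof. by rewrite apD apN. Qed.

Lemma ap_sum f I (r : seq I) (P : pred I) (X : I -> {poly R}) :
  ap f (\sum_(i <- r | P i) X i) = \sum_(i <- r | P i) ap f (X i).
Proof. exact: (big_morph (ap f) (apD f) (ap0 f)). Qed.

Lemma eq_ap f g x : (forall n, x`_n != 0 -> f n = g n) -> ap f x = ap g x.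
Proof.
move=> fg; apply: eq_bigr => i _.
by case: (eqVneq x`_i 0) => [->|/fg ->//]; rewrite !mulr0.
Qed.

Lemma ap_eq0 f x : (forall n, x`_n != 0 -> f n = 0) -> ap f x = 0.
Proof.
move=> h; rewrite (@eq_ap f (fun=> 0)) //.
by rewrite /ap big1 // => i _; rewrite mul0r.
Qed.

Lemma ap_suml d (F : nat -> nat -> R) x :
  ap (fun n => \sum_(l < d) F l n) x = \sum_(l < d) ap (F l) x.
Proof.
rewrite /ap exchange_big /=; apply: eq_bigr => i _.
by rewrite mulr_suml.
Qed.

Lemma ap_scalel a f x : ap (fun n => a * f n) x = a * ap f x.
Proof. by rewrite /ap mulr_sumr; apply: eq_bigr => i _; rewrite mulrA. Qed.

Lemma ap_le_sum f x C a : (forall n, `|f n| <= a) -> (forall n, `|x`_n| <= C) ->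
  `|ap f x| <= a * (C * (size x)%:R).
Proof.
move=> fa xC; rewrite /ap; apply: (le_trans (ler_norm_sum _ _ _)).
have -> : a * (C * (size x)%:R) = \sum_(i < size x) a * C.
  by rewrite sumr_const card_ord mulrA mulr_natr.
by apply: ler_sum => i _; rewrite normrM ler_pM.
Qed.

Lemma suppW x a b a' b' : (a' <= a)%N -> (b <= b')%N -> supp x a b -> supp x a' b'.
Proof. by move=> aa bb h n /h; lia. Qed.

Lemma supp_size x a : (forall n, (n < a)%N -> x`_n = 0) -> supp x a (size x).
Proof.
move=> h n xn; rewrite leqNgt (ltnNge n (size x)) -negb_or; apply: contraNN xn.
by case/orP => [/h ->|/(nth_default 0) ->].
Qed.

Lemma suppD x y a b : supp x a b -> supp y a b -> supp (x + y) a b.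
Proof.
move=> hx hy n; rewrite coefD; case: (eqVneq x`_n 0) => [->|/hx //].
by rewrite add0r => /hy.
Qed.

Lemma suppZ c x a b : supp x a b -> supp (c *: x) a b.
Proof.
by move=> hx n; rewrite coefZ => h; apply: hx; apply: contraNN h => /eqP ->; rewrite mulr0.
Qed.

Lemma supp_sum (I : eqType) (r : seq I) (X : I -> {poly R}) a b :
  (forall i, i \in r -> supp (X i) a b) -> supp (\sum_(i <- r) X i) a b.
Proof.
move=> h; rewrite big_seq_cond; apply: (big_ind (fun z => supp z a b)).
- by move=> n; rewrite coef0 eqxx.
- by move=> x y; exact: suppD.
- by move=> i /andP[+ _]; exact: h.
Qed.

Definition restr (a b : nat) f : nat -> R := fun n => if (a <= n < b)%N then f n else 0.

Lemma restr_restr a b a' b' f :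
  restr a b (restr a' b' f) = restr (maxn a a') (minn b b') f.
Proof.
apply: funext => n; rewrite /restr.
have -> : (maxn a a' <= n < minn b b')%N = (a <= n < b)%N && (a' <= n < b')%N by lia.
by case: (a <= n < b)%N.
Qed.

Lemma ap_restr a b f x : supp x a b -> ap (restr a b f) x = ap f x.
Proof. by move=> h; apply: eq_ap => n /h; rewrite /restr => ->. Qed.

(** The cut points are kept apart from the actual supports, so that zero terms and interval
    restrictions remain admissible. *)
Definition blocks (d : nat) (c : nat -> nat) (F : nat -> nat -> R) :=
  forall l, (l < d)%N -> (c l <= c l.+1)%N /\
    forall n, F l n != 0 -> (c l <= n < c l.+1)%N.

Lemma blocks_le d c F l l' : blocks d c F -> (l <= l')%N -> (l' <= d)%N -> (c l <= c l')%N.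
Proof.
move=> bl; elim: l' => [|l' IH]; first by rewrite leqn0 => /eqP ->.
rewrite leq_eqVlt => /orP[/eqP ->//|ll ld].
exact: leq_trans (IH ll (ltnW ld)) (bl l' ld).1.
Qed.

Lemma blocks_lt0 d c F l n : blocks d c F -> (l < d)%N -> (n < c l)%N -> F l n = 0.
Proof.
move=> bl ld nl; apply: contraTeq nl => /(bl l ld).2 /andP[h _]; by rewrite -leqNgt.
Qed.

Lemma blocks_ge0 d c F l n : blocks d c F -> (l < d)%N -> (c l.+1 <= n)%N -> F l n = 0.
Proof.
move=> bl ld nl; apply: contraTeq nl => /(bl l ld).2 /andP[_ h]; by rewrite -ltnNge.
Qed.

Lemma blocksW d d' c F : (d' <= d)%N -> blocks d c F -> blocks d' c F.
Proof. by move=> dd bl l ld; apply: bl; exact: leq_trans dd. Qed.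

Lemma blocks_eq0 d c F l n : blocks d c F -> (l <= d)%N -> (c l <= n)%N ->
  \sum_(i < l) F i n = 0.
Proof.
move=> bl ld cn; rewrite big1 // => i _.
apply: (blocks_ge0 bl); first exact: leq_trans ld.
exact: leq_trans (blocks_le bl _ ld) cn.
Qed.

(** Applied with [s] the ends of successive supports and [c] a cut point: only the vector with index
    [r] can lie on both sides of the cut. *)
Lemma cut_index (s : nat -> nat) (c p q : nat) : {homo s : m n / (m <= n)%N} -> (p <= q)%N ->
  exists r, [/\ (p <= r <= q)%N, forall k, (p <= k < r)%N -> (s k.+1 <= c)%N &
     forall k, (r < k < q)%N -> (c <= s k)%N].
Proof.
move=> sm pq; pose P k := (k >= p)%N && ((s k.+1 > c)%N || (k >= q)%N).
have ex : exists k, P k by exists q; rewrite /P pq leqnn orbT.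
case: (ex_minnP ex) => r /andP[pr Pr] rmin; exists r; split.
- by rewrite pr rmin // /P pq leqnn orbT.
- move=> k /andP[pk kr]; rewrite leqNgt; apply/negP => ck.
  by have := rmin k; rewrite /P pk ck /= => /(_ isT); lia.
- move=> k /andP[rk kq]; case/orP: Pr => [h|]; last by lia.
  by apply: leq_trans (ltnW h) (sm _ _ rk).
Qed.

(* The cut points of the functionals split the interval of vectors; at each cut at
   most one vector is met by functionals on both sides. *)
Lemma split_sum d c (F : nat -> nat -> R) (s : nat -> nat) (x : nat -> {poly R}) al be D p q :
  blocks d c F -> {homo s : m n / (m <= n)%N} -> (forall k, supp (x k) (s k) (s k.+1)) ->
  0 <= al ->
  (forall l, (l < d)%N -> forall p q, (p <= q)%N ->
     `|ap (F l) (\sum_(p <= k < q) x k)| <= al * (q - p)%:R + be) ->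
  (forall d', (d' <= d)%N -> forall k, `|ap (fun n => \sum_(l < d') F l n) (x k)| <= D) ->
  (p <= q)%N ->
  `|ap (fun n => \sum_(l < d) F l n) (\sum_(p <= k < q) x k)|
     <= al * (q - p)%:R + d%:R * (be + D).
Proof.
(* Peeling off the last functional at its cut point leaves the first [d] on the left vectors, the
   last one on the right vectors (error [be]) and one straddling vector (error [D]). *)
move=> bl sm sx al0; elim: d p q bl => [|d IH] p q bl hF hD pq.
  rewrite (@ap_eq0 (fun n => \sum_(l < 0) F l n)); last by move=> n _; rewrite big_ord0.
  by rewrite normr0 mul0r addr0 mulr_ge0 // ler0n.
have [r [/andP[pr rq] hl hr]] := cut_index (c d) sm pq.
have D0 : 0 <= D by apply: le_trans (hD 0%N isT 0%N).
have IHd := IH p r (blocksW (leqnSn d) bl)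
  (fun l ld => hF l (leqW ld)) (fun d' dd => hD d' (leqW dd)) pr.
have left : ap (fun n => \sum_(l < d.+1) F l n) (\sum_(p <= k < r) x k) =
            ap (fun n => \sum_(l < d) F l n) (\sum_(p <= k < r) x k).
  rewrite !ap_sum; apply: eq_big_nat => k kpr.
  apply: eq_ap => n /sx nk; rewrite big_ord_recr /= (blocks_lt0 bl) ?addr0 //.
  by have := hl k kpr; lia.
have right r' : (r < r')%N -> (r' <= q)%N ->
    ap (fun n => \sum_(l < d.+1) F l n) (\sum_(r' <= k < q) x k) =
    ap (F d) (\sum_(r' <= k < q) x k).
  move=> rr rq'; rewrite !ap_sum; apply: eq_big_nat => k kpr.
  apply: eq_ap => n /sx nk; rewrite big_ord_recr /= (blocks_eq0 bl) ?add0r //.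
  by have := hr k; lia.
have be0 : 0 <= be.
  have := hF d (ltnSn d) q q (leqnn q).
  by rewrite subnn mulr0 add0r; exact: le_trans.
have be_D : d.+1%:R * (be + D) = d%:R * (be + D) + be + D by rewrite -natr1; ring.
have [rq0|rltq] := eqVneq r q.
  rewrite -rq0 left; apply: (le_trans IHd); rewrite be_D; lra.
have {rq}rltq : (r < q)%N by rewrite ltn_neqAle rltq rq.
rewrite (big_cat_nat pr (ltnW rltq)) /= (big_ltn rltq) !apD left (right r.+1) //.
have h1 := hD d.+1 (leqnn _) r; have h2 := hF d (ltnSn d) r.+1 q rltq.
have e1 : (r - p)%:R + (q - r.+1)%:R <= (q - p)%:R :> R by rewrite -natrD ler_nat; lia.
have e2 := ler_wpM2l al0 e1.
rewrite be_D; apply: (le_trans (ler_normD _ _)).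
apply: (le_trans (lerD IHd (le_trans (ler_normD _ _) (lerD h1 h2)))).
by rewrite mulrDr in e2; lra.
Qed.
End Pairing.

(** * The norming set *)

Section Norming.
Variable R : realType.
Variables (cmp : rel nat) (e nn : nat -> nat) (sigma : nat -> seq (nat -> R) -> nat).
Implicit Types (f g : nat -> R) (F : nat -> nat -> R) (x y u : {poly R}).

(** Powers of 1/2 keep all coefficients of norming functionals in a countable set that can be
    coded. *)
Definition mu j : R := 2^-1 ^+ e j.

Lemma mu_gt0 j : 0 < mu j. Proof. by rewrite exprn_gt0 // invr_gt0 ltr0n. Qed.

Lemma mu_le1 j : mu j <= 1.
Proof. by rewrite exprn_ile1 // ?invr_ge0 ?ler0n // invf_le1 ?ler1n ?ltr0n. Qed.

Definition ground f :=
  [/\ forall n, [\/ f n = 0, f n = 1 | f n = -1],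
      exists M, forall n, (M <= n)%N -> f n = 0 &
      forall n m, f n != 0 -> f m != 0 -> cmp n m].

(** The interval restriction is part of the construction, so that the norming set is closed under
    restrictions and a single block can be tested by a restricted functional. *)
Definition node j d F a b : nat -> R := restr a b (fun n => mu j * \sum_(l < d) F l n).

(* Functionals of odd weight are only formed along special sequences: the weight of
   each term codes the preceding terms. *)
Definition node_of (P : option nat -> (nat -> R) -> Prop) j f :=
  exists d c F a b, [/\ (d <= nn j)%N, blocks d c F,
    forall l, (l < d)%N -> exists w, P w (F l),
    odd j -> forall l, (l < d)%N -> P (Some (sigma j (mkseq F l))) (F l) &
    f = node j d F a b].

(* The index [w] is the weight of the functional, [None] for the ground functionals. *)
Fixpoint K h (w : option nat) f : Prop :=
  if h is h'.+1 then K h' w f \/ exists2 j, w = Some j & node_of (K h') j f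
  else w = None /\ ground f.

Definition KK w f := exists h, K h w f.
Definition inK f := exists w, KK w f.

Lemma K_mono h h' w f : (h <= h')%N -> K h w f -> K h' w f.
Proof.
elim: h' => [|h' IH]; first by rewrite leqn0 => /eqP ->.
by rewrite leq_eqVlt => /orP[/eqP -> //|hh /(IH hh)]; left.
Qed.

Lemma KK_None f : KK None f -> ground f.
Proof. by case; elim=> [[//]|h IH /= [/IH|[]]]. Qed.

Lemma ground_KK f : ground f -> KK None f.
Proof. by exists 0%N. Qed.

Lemma node_ofW (P Q : option nat -> (nat -> R) -> Prop) j f :
  (forall w f, P w f -> Q w f) -> node_of P j f -> node_of Q j f.
Proof.
move=> PQ [d] [c] [F] [a] [b] [? ? h1 h2 ?]; exists d, c, F, a, b; split => //.
- by move=> l /h1[w /PQ ?]; exists w.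
- by move=> oj l /(h2 oj)/PQ.
Qed.

Lemma KK_inv j f : KK (Some j) f -> node_of KK j f.
Proof.
case; elim=> [[//]|h IH /= [/IH//|[i [<-]]]].
by apply: node_ofW => w g ?; exists h.
Qed.

Lemma node_of_KK j f : node_of KK j f -> KK (Some j) f.
Proof.
case=> d [c] [F] [a] [b] [dj bl h1 h2 fE].
have /choice[H hH] : forall l, exists h, (l < d)%N ->
    (exists w, K h w (F l)) /\ (odd j -> K h (Some (sigma j (mkseq F l))) (F l)).
  move=> l; case: (ltnP l d) => [ld|]; last by exists 0%N.
  have [w [h hw]] := h1 l ld; case: (boolP (odd j)) => oj; last first.
    by exists h => _; split => //; exists w.
  have [h' hw'] := h2 oj l ld; exists h' => _; split => //; by eexists; exact: hw'.
pose h := \max_(l < d) H l; exists h.+1; right; exists j => //.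
exists d, c, F, a, b; split => //.
- move=> l ld; have [[w hw] _] := hH l ld; exists w; apply: K_mono hw.
  exact: (leq_bigmax (Ordinal ld)).
- move=> oj l ld; have [_ /(_ oj)] := hH l ld; apply: K_mono.
  exact: (leq_bigmax (Ordinal ld)).
Qed.

(** The premise on initial segments says that partial sums of a node are again norming; a vector cut
    by the node then costs no more than its own norm. *)
Lemma inK_ind (P : (nat -> R) -> Prop) : (forall f, ground f -> P f) ->
  (forall j d c F a b, (d <= nn j)%N -> blocks d c F ->
    (forall l, (l < d)%N -> inK (F l)) -> (forall l, (l < d)%N -> P (F l)) ->
    (forall d', (d' <= d)%N -> KK (Some j) (node j d' F a b)) ->
    P (node j d F a b)) -> forall f, inK f -> P f.
Proof.
move=> Pg Pn f [w [h]]; elim: h w f => [w f [_ /Pg//]|h IH w f /= [/IH//|[j _]]].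
case=> d [c] [F] [a] [b] [dj bl h1 h2 ->]; apply: (Pn j d c) => //.
- by move=> l ld; have [w' h'] := h1 l ld; exists w', h.
- by move=> l ld; have [w' /IH] := h1 l ld.
- move=> d' dd; apply: node_of_KK; exists d', c, F, a, b; split => //.
  + exact: leq_trans dj.
  + exact: blocksW bl.
  + by move=> l ld; have [w' ?] := h1 l (leq_trans ld dd); exists w', h.
  + by move=> oj l ld; exists h; exact: h2 (leq_trans ld dd).
Qed.

Lemma KK_inK w f : KK w f -> inK f. Proof. by exists w. Qed.
Hint Resolve KK_inK : core.

Lemma ground_restr a b f : ground f -> ground (restr a b f).
Proof.
move=> [h1 [M h2] h3]; split.
- by move=> n; rewrite /restr; case: ifP => _; [exact: h1 | exact: Or31].
- by exists M => n /h2; rewrite /restr => ->; rewrite if_same.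
- by move=> n m; rewrite /restr; case: ifP; rewrite ?eqxx // => _; case: ifP; rewrite ?eqxx // => _; exact: h3.
Qed.

Lemma restr_node a' b' j d F a b :
  restr a' b' (node j d F a b) = node j d F (maxn a' a) (minn b' b).
Proof. exact: restr_restr. Qed.

Lemma KK_restr a b w f : KK w f -> KK w (restr a b f).
Proof.
case: w => [j|/KK_None/(@ground_restr a b)/ground_KK //].
case/KK_inv => d [c] [F] [a'] [b'] [? ? ? ? ->].
by apply: node_of_KK; rewrite restr_node; exists d, c, F; do 2!eexists; split.
Qed.

Lemma inK_restr a b f : inK f -> inK (restr a b f).
Proof. by case=> w /KK_restr h; exists w. Qed.

Lemma blocks_sum_eq d c F n : blocks d c F ->
  \sum_(l < d) F l n = 0 \/ exists2 l, (l < d)%N & \sum_(l < d) F l n = F l n.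
Proof.
elim: d => [_|d IH bl]; first by left; rewrite big_ord0.
rewrite big_ord_recr /=; have [h|h] := ltnP n (c d).
  rewrite (blocks_lt0 bl) // addr0; have [->|[l ld ->]] := IH (blocksW (leqnSn d) bl); first by left.
  by right; exists l => //; exact: leqW.
by right; exists d => //; rewrite (blocks_eq0 bl) ?add0r.
Qed.

Lemma inK_le1 f n : inK f -> `|f n| <= 1.
Proof.
move=> fK; elim/inK_ind: f / fK => [f [/(_ n) + _ _]|j d c F a b _ bl _ IH _].
  by case=> ->; rewrite ?normrN ?normr0 ?normr1.
rewrite /node /restr; case: ifP; rewrite ?normr0 // => _.
rewrite normrM (gtr0_norm (mu_gt0 j)) mulr_ile1 ?normr_ge0 ?mu_le1 ?(ltW (mu_gt0 j)) //.
by have [->|[l /IH ? ->]] := blocks_sum_eq n bl; rewrite ?normr0.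
Qed.

Lemma KK_le j f n : KK (Some j) f -> `|f n| <= mu j.
Proof.
case/KK_inv => d [c] [F] [a'] [b'] [_ bl h _ ->]; rewrite /node /restr.
case: ifP; rewrite ?normr0 ?(ltW (mu_gt0 j)) // => _.
rewrite normrM (gtr0_norm (mu_gt0 j)) ler_piMr ?(ltW (mu_gt0 j)) //.
have [->|[l /h[w hw] ->]] := blocks_sum_eq n bl; rewrite ?normr0 //.
by apply: inK_le1; exists w.
Qed.

Lemma inK_fin f : inK f -> exists M, forall n, (M <= n)%N -> f n = 0.
Proof.
move=> fK; elim/inK_ind: f / fK => [f [_ + _] //|j d c F a b _ bl _ _ _].
by exists b => n bn; rewrite /node /restr ltnNge bn andbF.
Qed.

(* Each cut vector [x k] is estimated as a whole, each child only on intervals. *)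
Lemma node_est j d c F a b (s : nat -> nat) (x : nat -> {poly R}) C al be p q :
  blocks d c F -> {homo s : m n / (m <= n)%N} -> (forall k, supp (x k) (s k) (s k.+1)) ->
  (forall d', (d' <= d)%N -> KK (Some j) (node j d' F a b)) ->
  (forall f, inK f -> forall k, `|ap f (x k)| <= C) -> 0 <= al ->
  (forall l, (l < d)%N -> forall p q, (p <= q)%N ->
     `|ap (restr a b (F l)) (\sum_(p <= k < q) x k)| <= al * (q - p)%:R + be) ->
  (p <= q)%N ->
  `|ap (node j d F a b) (\sum_(p <= k < q) x k)|
     <= mu j * (al * (q - p)%:R + d%:R * be) + d%:R * C.
Proof.
move=> bl sm sx hK xC al0 hF pq.
have nodeE d' z : ap (node j d' F a b) z =
    mu j * ap (fun n => \sum_(l < d') (restr a b (F l)) n) z.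
  rewrite -ap_scalel; apply: eq_ap => n _; rewrite /node /restr.
  by case: ifP => // _; rewrite big1 ?mulr0.
have bl' : blocks d c (fun l => restr a b (F l)).
  move=> l /bl[h1 h2]; split => // n; rewrite /restr; case: ifP; rewrite ?eqxx // => _.
  exact: h2.
rewrite nodeE normrM (gtr0_norm (mu_gt0 j)).
(* Partial sums of the terms are [1 / mu j] times norming functionals, hence the bound [C / mu j]
   for a straddling vector; the outer factor [mu j] cancels it. *)
have := @split_sum _ d c _ s x al be (C / mu j) p q bl' sm sx al0 hF _ pq.
have m0 := mu_gt0 j; move/(_ _)/(ler_wpM2l (ltW m0)).
have -> : mu j * (al * (q - p)%:R + d%:R * (be + C / mu j)) =
          mu j * (al * (q - p)%:R + d%:R * be) + d%:R * C.
  by field; rewrite gt_eqF.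
apply=> d' dd k; rewrite ler_pdivlMr // mulrC -{1}(gtr0_norm m0) -normrM -nodeE.
by apply: xC; exists (Some j); exact: hK.
Qed.

Definition half : R := 2^-1.

(** Descend through the functional as a tree. Each level of index below [j0] halves the main term
    and multiplies the error by at most [N], the number of terms. After [r] levels the trivial bound
    takes over; indices from [j0] on are left to the hypothesis. *)
Lemma main_est (j0 RR N : nat) C (s : nat -> nat) (x : nat -> {poly R}) :
  {homo s : m n / (m <= n)%N} -> (forall k, supp (x k) (s k) (s k.+1)) ->
  0 <= C -> (0 < N)%N -> (forall j, (j < j0)%N -> (0 < e j)%N && (nn j <= N)%N) ->
  (forall f, inK f -> forall k, `|ap f (x k)| <= C) ->
  (forall f, ground f -> forall k, `|ap f (x k)| <= C * half ^+ RR) ->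
  (forall i f, (j0 <= i)%N -> KK (Some i) f -> forall p q, (p <= q)%N ->
     `|ap f (\sum_(p <= k < q) x k)| <= C * (half ^+ RR * (q - p)%:R + 2)) ->
  forall f, inK f -> forall r p q, (r <= RR)%N -> (p <= q)%N ->
    `|ap f (\sum_(p <= k < q) x k)| <= C * (half ^+ r * (q - p)%:R + 2 * N%:R ^+ r).
Proof.
move=> sm sx C0 N0 Nj xC gC bigC f fK.
have N1 r : 1 <= N%:R ^+ r :> R by rewrite exprn_ege1 // ler1n.
have half_le r : (r <= RR)%N -> half ^+ RR <= half ^+ r.
  by move=> h; rewrite /half; apply: ler_wiXn2l => //; lra.
suff H : forall a b r p q, (r <= RR)%N -> (p <= q)%N ->
    `|ap (restr a b f) (\sum_(p <= k < q) x k)| <= C * (half ^+ r * (q - p)%:R + 2 * N%:R ^+ r).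
  move=> r p q rR pq; have := H 0%N (size (\sum_(p <= k < q) x k)) r p q rR pq.
  by rewrite ap_restr //; apply: supp_size.
have sumC g D p q : (p <= q)%N -> (forall k, `|ap g (x k)| <= D) ->
    `|ap g (\sum_(p <= k < q) x k)| <= D * (q - p)%:R.
  move=> pq gD; rewrite ap_sum; apply: (le_trans (ler_norm_sum _ _ _)).
  apply: (le_trans (ler_sum _ (fun k _ => gD k))).
  by rewrite sumr_const_nat mulr_natr.
elim/inK_ind: f / fK => [f fg|j d c F a' b' dj bl FK IH nK] a b r p q rR pq.
  apply: (le_trans (sumC _ (C * half ^+ RR) _ _ pq _)).
    by move=> k; apply: gC; exact: ground_restr.
  rewrite -mulrA ler_wpM2l //.
  have := ler_wpM2r (ler0n R (q - p)) (half_le r rR); have := N1 r; lra.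
rewrite restr_node; set A := maxn a a'; set B := minn b b'.
have nK' d' : (d' <= d)%N -> KK (Some j) (node j d' F A B).
  by move=> dd; rewrite -restr_node; apply: KK_restr; exact: nK.
have [jj0|j0j] := ltnP j j0; last first.
  apply: (le_trans (bigC j _ j0j (nK' _ (leqnn d)) _ _ pq)); rewrite ler_wpM2l //.
  have := ler_wpM2r (ler0n R (q - p)) (half_le r rR); have := N1 r; lra.
case: r rR => [|r] rR.
  apply: (le_trans (sumC _ C _ _ pq _)).
    by move=> k; apply: xC; exists (Some j); exact: nK'.
  by rewrite ler_wpM2l // !expr0; lra.
have h := @node_est j d c F A B s x C (C * half ^+ r) (C * (2 * N%:R ^+ r)) p q bl sm sx nK' xC.
apply: (le_trans (h _ _ pq)).
- by rewrite mulr_ge0 // exprn_ge0 // /half invr_ge0 ler0n.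
- by move=> l ld p' q' pq'; have := IH l ld A B r p' q' (ltnW rR) pq'; lra.
have /andP[ej nj] := Nj j jj0.
have dN : d%:R <= N%:R :> R by rewrite ler_nat (leq_trans dj).
have m2 : mu j <= half.
  rewrite /mu -[leRHS]expr1; apply: ler_wiXn2l => //; rewrite /half; lra.
set u := (q - p)%:R; have u0 : 0 <= u by rewrite ler0n.
have t0 : 0 <= half ^+ r by rewrite exprn_ge0 // /half invr_ge0 ler0n.
set t := half ^+ r in t0 *; set v := N%:R ^+ r; have v1 : 1 <= v := N1 r.
have -> : half ^+ r.+1 = half * t by rewrite exprS.
have -> : N%:R ^+ r.+1 = N%:R * v :> R by rewrite exprS.
have -> : mu j * (C * t * u + d%:R * (C * (2 * v))) + d%:R * C
   = C * (mu j * (t * u) + d%:R * (mu j * (2 * v) + 1)) by ring.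
rewrite ler_wpM2l //.
have h1 : mu j * (t * u) <= half * (t * u) by rewrite ler_wpM2r // mulr_ge0.
(* The factor 2 in the error term pays for the straddling vectors: [mu j <= 1/2] turns [2 * v] into
   at most [v], and [1 <= v]. *)
have h2 : mu j * (2 * v) + 1 <= 2 * v.
  have : mu j * (2 * v) <= half * (2 * v) by rewrite ler_wpM2r //; lra.
  by rewrite /half; lra.
have h3 : d%:R * (mu j * (2 * v) + 1) <= N%:R * (2 * v).
  apply: ler_pM => //.
  by apply: addr_ge0 => //; rewrite mulr_ge0 ?(ltW (mu_gt0 j)) //; lra.
by lra.
Qed.

(** * Growth of the parameters and long averages in block subspaces *)

Hypothesis e_gt : forall j, (j < e j)%N.
Hypothesis e_mono : {homo e : i j / (i <= j)%N}.
Hypothesis nn_gt : forall j, (j < nn j)%N.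
Hypothesis nn_mono : {homo nn : i j / (i <= j)%N}.
Hypothesis mu_nn : forall j, mu j.+1 * (nn j)%:R <= mu j ^+ 2.
(** The exponent covers every power of [nn j] met in the estimates; the predecessor leaves one of
    the [nn j.+1] terms free for a coordinate functional. *)
Hypothesis nn_big : forall j,
  (nn j)%:R ^+ (2 * e j.+1 + 2) <= (nn j.+1).-1%:R * mu j.+1 ^+ 2 :> R.

Lemma mu_anti i j : (i <= j)%N -> mu j <= mu i.
Proof. by move=> ij; apply: ler_wiXn2l; rewrite ?e_mono //; lra. Qed.

Definition low x M := forall n, (n < M)%N -> x`_n = 0.
(** The norm is handled through its upper bounds, and lower bounds exhibit a functional; a supremum
    is formed only when vectors have to be normalized. *)
Definition nb x C := forall f, inK f -> `|ap f x| <= C.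
Definition subsp (Z : {poly R} -> Prop) :=
  [/\ Z 0, forall x y, Z x -> Z y -> Z (x + y) & forall a x, Z x -> Z (a *: x)].

Lemma low_supp x M : low x M -> supp x M (size x). Proof. exact: supp_size. Qed.

Lemma supp_low x a b : supp x a b -> low x a.
Proof. by move=> sx n na; apply: contraTeq na => /sx /andP[+ _]; rewrite -leqNgt. Qed.

Lemma lowW x a b : (a <= b)%N -> low x b -> low x a.
Proof. by move=> ab h n na; apply: h; exact: leq_trans ab. Qed.

Lemma nbW x C D : C <= D -> nb x C -> nb x D.
Proof. by move=> CD h f /h fC; exact: le_trans CD. Qed.

Lemma nbZ a x C : nb x C -> nb (a *: x) (`|a| * C).
Proof. by move=> h f /h fC; rewrite apZ normrM ler_wpM2l. Qed.

Lemma nb_ge0 x C : nb x C -> 0 <= C.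
Proof.
move=> h; have g0 : ground (fun=> 0).
  by split=> [n|/=|n m]; [constructor | exists 0%N | rewrite eqxx].
by apply: le_trans (h _ (KK_inK (ground_KK g0))).
Qed.

Lemma ap_sum_le f (x : nat -> {poly R}) D p q : (p <= q)%N ->
  (forall k, (p <= k < q)%N -> `|ap f (x k)| <= D) ->
  `|ap f (\sum_(p <= k < q) x k)| <= D * (q - p)%:R.
Proof.
move=> pq fD; rewrite ap_sum; apply: (le_trans (ler_norm_sum _ _ _)).
by rewrite mulr_natr -sumr_const_nat; apply: ler_sum_nat.
Qed.

Lemma subsp_sum Z (x : nat -> {poly R}) p q (P : pred nat) : subsp Z ->
  (forall k, P k -> Z (x k)) -> Z (\sum_(p <= k < q | P k) x k).
Proof. by case=> Z0 ZD _ h; apply: big_ind. Qed.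

(** Together with linearity this is all that the indecomposability argument asks of a subspace;
    well-foundedness of the tree is used only to obtain it. *)
Definition small_vec (Z : {poly R} -> Prop) := forall M (eps : R), 0 < eps ->
  exists u, [/\ Z u, low u M, nb u 1, exists2 f, inK f & half <= ap f u &
    forall g, ground g -> `|ap g u| <= eps].

Lemma pick_seq (P : nat -> nat -> {poly R} -> Prop) M0 :
  (forall M, exists b u, [/\ (M <= b)%N, supp u M b & P M b u]) ->
  exists S (u : nat -> {poly R}), [/\ S 0%N = M0, {homo S : m n / (m <= n)%N},
    forall k, supp (u k) (S k) (S k.+1) & forall k, P (S k) (S k.+1) (u k)].
Proof.
move=> /choice[B /choice[U hU]].
exists (fun k => iter k B M0), (fun k => U (iter k B M0)); split => //.
- by apply: homo_leq => //; [exact: leq_trans | move=> k /=; case: (hU (iter k B M0))].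
- by move=> k /=; case: (hU (iter k B M0)).
- by move=> k /=; case: (hU (iter k B M0)).
Qed.

Definition fsupp f (a b : nat) := forall n, f n != 0 -> (a <= n < b)%N.

Lemma diag_ap (h : nat -> nat -> R) (u : nat -> {poly R}) (S : nat -> nat) N :
  {homo S : m n / (m <= n)%N} -> (forall k, supp (u k) (S k) (S k.+1)) ->
  (forall k, fsupp (h k) (S k) (S k.+1)) ->
  forall k, (k < N)%N -> ap (fun n => \sum_(l < N) h l n) (u k) = ap (h k) (u k).
Proof.
move=> Sm su sh k kN; apply: eq_ap => n /su nk.
rewrite (bigD1 (Ordinal kN)) //= big1 ?addr0 // => l /eqP lk.
apply: contrapT => /eqP/sh nl; apply: lk; apply: val_inj => /=.
have [h1|h1|//] := ltngtP l k.
  by have := Sm _ _ h1; lia.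
by have := Sm _ _ h1; lia.
Qed.

Definition succ d a b f := exists c F, [/\ blocks d c F, forall l, (l < d)%N -> inK (F l),
  (a <= c 0)%N /\ (c d <= b)%N & f = fun n => \sum_(l < d) F l n].

Lemma succ_fsupp d a b f : succ d a b f -> fsupp f a b.
Proof.
case=> c [F] [bl _ [ac cb] ->] n hn.
have [h|[l ld h]] := blocks_sum_eq n bl; first by rewrite h eqxx in hn.
rewrite h in hn; have := (bl l ld).2 n hn.
have := blocks_le bl (leq0n l) (ltnW ld); have := blocks_le bl ld (leqnn d); lia.
Qed.

Lemma succ1 a b f : inK f -> fsupp f a b -> (a <= b)%N -> succ 1 a b f.
Proof.
move=> fK sf ab; exists (fun l => if l is 0 then a else b), (fun=> f); split => //.
- by case.
- by apply: funext => n; rewrite big_ord_recl big_ord0 addr0.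
Qed.

Lemma succD d d' a b b' f f' : (a <= b)%N -> (b <= b')%N -> succ d a b f -> succ d' b b' f' ->
  succ (d + d') a b' (fun n => f n + f' n).
Proof.
move=> ab bb' [c [F [bl FK [ac cb] ->]]] [c' [F' [bl' FK' [bc cb'] ->]]].
exists (fun l => if (l < d)%N then c l else c' (l - d)%N), (fun l => if (l < d)%N then F l else F' (l - d)%N).
split.
- move=> l ld; case: ltnP => h; last first.
    have := bl' (l - d)%N; rewrite ltn_subLR // ld => /(_ isT).
    by rewrite ltnNge (leqW h) /= subSn.
  have [h1 h2] := bl l h; case: ltnP => h'; first by split.
  have ldE : l.+1 = d by lia.
  rewrite -ldE subnn; rewrite -ldE in cb; split; first by lia.
  by move=> n /h2; lia.
- by move=> l ld; case: ltnP => h; [exact: FK | apply: FK'; lia].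
- have -> : (d + d' < d)%N = false by lia.
  rewrite addKn; split => //; case: ltnP => //; rewrite leqn0 => /eqP d0.
  by rewrite d0 in cb ac; rewrite sub0n; lia.
- apply: funext => n; rewrite big_split_ord /=; congr (_ + _); apply: eq_bigr => i _.
    by rewrite ltn_ord.
  by rewrite ltnNge leq_addr /= addKn.
Qed.

Lemma succ_sum N D (S : nat -> nat) (h : nat -> nat -> R) : {homo S : m n / (m <= n)%N} ->
  (forall k, succ D (S k) (S k.+1) (h k)) -> (0 < N)%N ->
  succ (N * D) (S 0%N) (S N) (fun n => \sum_(l < N) h l n).
Proof.
move=> Sm hs; case: N => // N _; elim: N => [|N IH].
  rewrite mul1n; move: (hs 0%N); congr (succ _ _ _ _); apply: funext => n.
  by rewrite big_ord_recl big_ord0 addr0.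
have -> : (fun n => \sum_(l < N.+2) h l n) = (fun n => \sum_(l < N.+1) h l n + h N.+1 n).
  by apply: funext => n; rewrite big_ord_recr.
by rewrite mulSnr; apply: succD IH (hs N.+1); apply: Sm.
Qed.

Lemma succ_KK j d a b f : ~~ odd j -> (d <= nn j)%N -> succ d a b f ->
  KK (Some j) (fun n => mu j * f n).
Proof.
move=> oj dj sf; have fs := succ_fsupp sf; case: sf => c [F] [bl FK _ fE].
apply: node_of_KK; exists d, c, F, a, b; split => //.
  by rewrite (negPf oj).
have fn n : f n = \sum_(l < d) F l n by rewrite fE.
apply: funext => n; rewrite /node /restr -fn; case: ifPn => // nab.
by have [->|/fs] := eqVneq (f n) 0; rewrite ?mulr0 // (negPf nab).
Qed.

Lemma half_gt0 : 0 < half. Proof. by rewrite /half; lra. Qed.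

Lemma halfX_gt0 t : 0 < half ^+ t. Proof. exact: exprn_gt0 half_gt0. Qed.

(* If no average of [N] vectors of size at most 2 had norm above 1, then iterated
   averages of [N ^ t] vectors would have norm at most [2 ^ -t]; the even weights forbid this. *)
Lemma average Z N (eps : R) : subsp Z -> small_vec Z -> (0 < N)%N -> 0 < eps ->
  exists x, [/\ Z x, nb x 2, exists2 f, inK f & ap f x = 1,
    forall g, ground g -> `|ap g x| <= eps &
    exists S (u : nat -> {poly R}), [/\ {homo S : m n / (m <= n)%N},
      forall k, supp (u k) (S k) (S k.+1), forall k, nb (u k) 2 &
      x = N%:R^-1 *: \sum_(0 <= k < N) u k]].
Proof.
move=> Zs Zv N0 eps0; apply: contrapT => nogood.
(* The index is even, so every successive sum of at most [nn j] terms is allowed. [T] makes [2 ^ -T]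
   a quarter of [mu j], below the value [mu j / 2] that [N ^ T] functionals attain together. *)
pose j := (2 * N)%N; pose T := (e j + 2)%N.
have Nr : 0 < N%:R :> R by rewrite ltr0n.
pose L t := forall M, exists b u, [/\ (M <= b)%N, supp u M b & [/\ Z u, nb u (half ^+ t),
  forall g, ground g -> `|ap g u| <= eps * half ^+ T &
  exists f, succ (N ^ t) M b f /\ half <= ap f u]].
have L0 : L 0%N.
  move=> M; have [|u [Zu lu nu [f fK hf] gu]] := Zv M (eps * half ^+ T).
    by rewrite mulr_gt0 // halfX_gt0.
  pose b := maxn M (size u); have su : supp u M b by apply: suppW (low_supp lu) => //; exact: leq_maxr.
  exists b, u; rewrite leq_maxl; split => //; split => //; exists (restr M b f); rewrite ap_restr //.
  split => //; rewrite expn0; apply: succ1; [exact: inK_restr| |exact: leq_maxl].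
  by move=> n; rewrite /restr; case: ifP; rewrite ?eqxx.
have LS t : (t < T)%N -> L t -> L t.+1.
  move=> tT Lt M; have [S [u [S0 Sm su hu]]] := pick_seq M Lt.
  pose y := N%:R^-1 *: \sum_(0 <= k < N) u k.
  have Zy : Z y.
    have [_ _ ZZ] := Zs; apply: ZZ; apply: subsp_sum => // k _; by case: (hu k).
  have suN k : (k < N)%N -> supp (u k) (S 0%N) (S N).
    by move=> kN; apply: suppW (su k); apply: Sm.
  have sy : supp y (S 0%N) (S N).
    apply: suppZ; apply: supp_sum => k; rewrite mem_index_iota => /andP[_]; exact: suN.
  have gy g : ground g -> `|ap g y| <= eps * half ^+ T.
    move=> gg; rewrite apZ normrM gtr0_norm ?invr_gt0 // mulrC ler_pdivrMr //.
    rewrite -{2}(subn0 N); apply: ap_sum_le => // k _; by case: (hu k) => _ _ /(_ g gg).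
  have [hy|/existsNP[f /not_implyP[fK /negP]]] := pselect (nb y (half ^+ t.+1)).
    exists (S N), y; rewrite -S0; split => //; first exact: Sm.
    split => //.
    have /choice[h hh] : forall k, exists f, succ (N ^ t) (S k) (S k.+1) f /\ half <= ap f (u k).
      by move=> k; case: (hu k).
    exists (fun n => \sum_(l < N) h l n); split.
      by rewrite expnS; apply: succ_sum => // k; case: (hh k).
    rewrite apZ ap_sum mulrC ler_pdivlMr // big_mkord.
    under eq_bigr => k _ do rewrite (diag_ap Sm su (fun k => succ_fsupp (hh k).1) (ltn_ord k)).
    rewrite -{1}(card_ord N) mulr_natr -sumr_const.
    by apply: ler_sum => k _; case: (hh k).
  (* An average of norm above [2 ^ -(t + 1)] of vectors of norm at most [2 ^ -t] is the vector
     sought: scaling its value to 1 leaves the averaged blocks of norm at most 2. *)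
  rewrite -ltNge => hf; case: nogood.
  pose a := (ap f y)^-1.
  have ht := halfX_gt0 t; have ht1 := halfX_gt0 t.+1.
  have af : `|a| <= (half ^+ t.+1)^-1.
    by rewrite /a normfV lef_pV2 ?posrE // ?(ltW hf) //; apply: lt_trans hf.
  have a2 : `|a| * half ^+ t <= 2.
    apply: (le_trans (ler_wpM2r (ltW ht) af)).
    by rewrite exprS invfM -mulrA mulVf ?gt_eqF // /half; lra.
  have fy0 : ap f y != 0 by rewrite -normr_gt0; exact: lt_trans hf.
  have u2 k : nb (a *: u k) 2.
    by have [_ h _ _] := hu k; exact: nbW a2 (nbZ _ h).
  exists (a *: y); split.
  - by case: Zs => _ _; apply.
  - move=> g gK; rewrite /y scalerA mulrC -scalerA scaler_sumr apZ normrM gtr0_norm ?invr_gt0 //.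
    rewrite mulrC ler_pdivrMr // -{2}(subn0 N).
    by apply: ap_sum_le => // k _; exact: u2.
  - by exists f => //; rewrite apZ mulVf.
  - move=> g gg; rewrite apZ normrM; apply: (le_trans (ler_pM _ _ af (gy g gg))) => //.
    rewrite mulrCA ler_piMr ?(ltW eps0) // mulrC ler_pdivrMr // mul1r.
    by apply: ler_wiXn2l => //; rewrite /half; lra.
  - exists S, (fun k => a *: u k); split => //.
      by move=> k; exact: suppZ.
    by rewrite /y scalerA mulrC -scalerA scaler_sumr.
have LT : L T by have : (T <= T)%N := leqnn T; elim: {1 3}T => // t IH tT; apply: LS (IH (ltnW tT)).
have [b [u [_ su [_ hu _ [f [sf hf]]]]]] := LT 0%N.
have NT : (N ^ T <= nn j)%N.
  pose i := (2 * N).-1; have ij : j = i.+1 by rewrite /i /j; lia.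
  have Ni : (N <= nn i)%N by apply: leq_trans (ltnW (nn_gt i)); rewrite /i; lia.
  rewrite -(ler_nat R); apply: le_trans (_ : (nn i)%:R ^+ (2 * e i.+1 + 2) <= _).
    rewrite -natrX ler_nat; apply: leq_trans (_ : nn i ^ T <= _)%N.
      by rewrite leq_exp2r // /T; lia.
    by apply: leq_pexp2l; [lia | rewrite /T ij; lia].
  apply: (le_trans (nn_big i)); rewrite -ij; apply: le_trans (_ : (nn j).-1%:R <= _).
    by rewrite ler_piMr // exprn_ile1 ?mu_le1 ?(ltW (mu_gt0 _)).
  by rewrite ler_nat leq_pred.
have := hu _ (KK_inK (succ_KK _ NT sf)); rewrite /j oddM /= => /(_ isT).
rewrite ap_scalel normrM gtr0_norm ?mu_gt0 // -/j.
have -> : half ^+ T = mu j * (half * half) by rewrite /T exprD expr2.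
rewrite ler_pM2l ?mu_gt0 //; have := ler_norm (ap f u); have := half_gt0.
move: hf; rewrite /half; lra.
Qed.

(** * Rapidly increasing sequences and exact pairs *)

Hypothesis cmp_refl : reflexive cmp.

Lemma nn1 j : 1 <= (nn j)%:R :> R.
Proof. by rewrite ler1n; apply: leq_trans (nn_gt j). Qed.

Lemma nn_exp a b j : (a <= b)%N -> (nn j)%:R ^+ a <= (nn j)%:R ^+ b :> R.
Proof. by move=> ab; apply: ler_weXn2l => //; exact: nn1. Qed.

Definition dual n : nat -> R := fun m => (m == n)%:R.

Lemma dual_ground n : ground (dual n).
Proof.
rewrite /dual; split.
- by move=> m; case: (m == n); [exact: Or32 | exact: Or31].
- by exists n.+1 => m nm; rewrite gtn_eqF.
- by move=> a b; case: (eqVneq a n) => [->|_]; rewrite ?eqxx //; case: (eqVneq b n) => [->|_]; rewrite ?eqxx.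
Qed.

Lemma ap_dual n x : ap (dual n) x = x`_n.
Proof.
have [nx|xn] := ltnP n (size x); last first.
  rewrite nth_default // ap_eq0 // => m; rewrite /dual; case: (eqVneq m n) => [->|//].
  by rewrite nth_default ?eqxx.
rewrite /ap (bigD1 (Ordinal nx)) //= /dual eqxx mul1r big1 ?addr0 // => i /eqP ni.
by case: eqP => [h|]; rewrite ?mul0r //; case: ni; apply: val_inj.
Qed.

Lemma nb_coef x C n : nb x C -> `|x`_n| <= C.
Proof. by rewrite -ap_dual; apply; exact: KK_inK (ground_KK (dual_ground n)). Qed.

Lemma supp_size_le x a b : supp x a b -> (size x <= b)%N.
Proof.
move=> sx; case: (eqVneq x 0) => [->|x0]; first by rewrite size_poly0.
have : x`_(size x).-1 != 0 by rewrite -/(lead_coef x) lead_coef_eq0.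
have : (0 < size x)%N by rewrite size_poly_gt0.
by move=> ? /sx; lia.
Qed.

(** The coefficients of [f] are at most [mu C], and [C] exceeds the length of [x] by so much that
    [mu_nn] beats the sum over its coordinates. *)
Lemma ap_tail j f x C M : (M + j + 2 <= C)%N -> KK (Some C) f -> forall D, nb x D ->
  (size x <= M)%N -> `|ap f x| <= D * mu j.+1.
Proof.
move=> MC fC D xD sx; have D0 := nb_ge0 xD.
have h := ap_le_sum (fun n => KK_le n fC) (fun n => nb_coef n xD); apply: (le_trans h).
rewrite mulrCA ler_wpM2l //.
have m1 : mu C <= mu (M + j).+2 by apply: mu_anti; lia.
apply: (le_trans (ler_wpM2r (ler0n _ _) m1)).
apply: le_trans (_ : mu (M + j).+2 * (nn (M + j).+1)%:R <= _).
  rewrite ler_wpM2l ?(ltW (mu_gt0 _)) // ler_nat (leq_trans sx) // ltnW //.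
  by apply: leq_trans (nn_gt _); lia.
apply: (le_trans (mu_nn _)); apply: le_trans (_ : mu (M + j).+1 <= _).
  by rewrite expr2 ler_piMr ?mu_le1 ?(ltW (mu_gt0 _)).
by apply: mu_anti; lia.
Qed.

Lemma one_exception f (x : nat -> {poly R}) C D k0 p q :
  0 <= C -> 0 <= D -> `|ap f (x k0)| <= C ->
  (forall k, k != k0 -> `|ap f (x k)| <= D) ->
  (p <= q)%N -> `|ap f (\sum_(p <= k < q) x k)| <= D * (q - p)%:R + C.
Proof.
move=> C0 D0 xC hk0 pq.
have bound a b : (a <= b)%N -> (forall k, (a <= k < b)%N -> k != k0) ->
    `|ap f (\sum_(a <= k < b) x k)| <= D * (b - a)%:R.
  by move=> ab h; apply: ap_sum_le => // k /h; exact: hk0.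
have [/andP[pk kq]|h] := boolP (p <= k0 < q)%N; last first.
  apply: (le_trans (bound p q pq _)); last by rewrite lerDl.
  by move=> k kpq; apply: contraNneq h => <-.
rewrite (big_cat_nat pk (ltnW kq)) /= (big_ltn kq) !apD.
apply: (le_trans (ler_normD _ _)); apply: (le_trans (lerD (lexx _) (ler_normD _ _))).
have b1 := bound p k0 pk; have b2 := bound k0.+1 q kq.
have {}b1 : `|ap f (\sum_(p <= k < k0) x k)| <= D * (k0 - p)%:R.
  by apply: b1 => k /andP[_ kk]; rewrite ltn_eqF.
have {}b2 : `|ap f (\sum_(k0.+1 <= k < q) x k)| <= D * (q - k0.+1)%:R.
  by apply: b2 => k /andP[kk _]; rewrite gtn_eqF.
have -> : (q - p)%N = ((k0 - p) + (q - k0.+1) + 1)%N by clear - pk kq; lia.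
by rewrite !natrD !mulrDr; lra.
Qed.

(** At most one [k] satisfies [tau k <= i < tau k.+1]; every other vector is controlled either as an
    average with threshold above [i] or as a vector too short for the index [i]. *)
Lemma ris_sum (i : nat) f (tau : nat -> nat) (x : nat -> {poly R}) C D p q :
  {homo tau : m n / (m <= n)%N} -> (forall k, k <= tau k)%N ->
  (forall k, `|ap f (x k)| <= C) ->
  (forall k, (i < tau k)%N -> `|ap f (x k)| <= D) ->
  (forall k, (tau k.+1 <= i)%N -> `|ap f (x k)| <= D) ->
  (p <= q)%N -> `|ap f (\sum_(p <= k < q) x k)| <= D * (q - p)%:R + C.
Proof.
move=> tm tk xC hi lo pq.
have C0 : 0 <= C by apply: le_trans (xC 0%N).
have D0 : 0 <= D by apply: le_trans (hi i.+1 (tk _)).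
have [k0 hk0] : exists k0, forall k, k != k0 -> `|ap f (x k)| <= D.
  have [h0|h0] := ltnP i (tau 0%N).
    by exists 0%N => k _; apply: hi; apply: leq_trans h0 (tm _ _ _).
  have ex : exists k, (tau k <= i)%N by exists 0%N.
  have bd k : (tau k <= i)%N -> (k <= i)%N by exact: leq_trans (tk k).
  case: (ex_maxnP ex bd) => k0 h1 h2; exists k0 => k kk0.
  have [kl|kg|kE] := ltngtP k k0; last by rewrite kE eqxx in kk0.
    by apply: lo; apply: leq_trans (tm _ _ kl) h1.
  by apply: hi; rewrite ltnNge; apply/negP => /h2; rewrite leqNgt kg.
by have [h|h] := leqP p q; apply: (one_exception C0 D0 (xC k0) hk0).
Qed.

(** The cuts of [f] touch at most [nn i] of the [N] vectors, which costs [2 * nn i <= 2 * N * mu i];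
    the main term contributes another [2 * N * mu i]. *)
Lemma avg_weight x N S (u : nat -> {poly R}) i f : (0 < N)%N -> (nn i)%:R <= N%:R * mu i ->
  {homo S : m n / (m <= n)%N} -> (forall k, supp (u k) (S k) (S k.+1)) ->
  (forall k, nb (u k) 2) -> x = N%:R^-1 *: \sum_(0 <= k < N) u k ->
  KK (Some i) f -> `|ap f x| <= 4 * mu i.
Proof.
move=> N0 Ni Sm su u2 -> fi.
have Nr : 0 < N%:R :> R by rewrite ltr0n.
rewrite apZ normrM gtr0_norm ?invr_gt0 // mulrC ler_pdivrMr //.
have [d [c [F [a [b [dj bl FK Fs fE]]]]]] := KK_inv fi.
have uK g : inK g -> forall k, `|ap g (u k)| <= 2 by move=> gK k; exact: u2.
have := @node_est i d c F a b S u 2 2 0 0%N N bl Sm su _ uK.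
rewrite -fE subn0 mulr0 addr0; move=> h; apply: (le_trans (h _ _ _ _)) => //.
- move=> d' dd; apply: node_of_KK; exists d', c, F, a, b; split => //.
  + exact: leq_trans dj.
  + exact: blocksW bl.
  + by move=> l ld; apply: FK; exact: leq_trans dd.
  + by move=> oj l ld; apply: Fs => //; exact: leq_trans dd.
- move=> l ld p q pq; rewrite addr0; apply: ap_sum_le => // k _; apply: uK.
  by apply: inK_restr; have [w ?] := FK l ld; exists w.
- have : d%:R <= (nn i)%:R :> R by rewrite ler_nat.
  by lra.
Qed.

Lemma nn_pred_big j : (0 < j)%N ->
  (nn j.-1)%:R ^+ (2 * e j + 2) <= (nn j).-1%:R * mu j ^+ 2 :> R.
Proof. by case: j => // j _; exact: nn_big. Qed.

Lemma avg_exists Z J (eps : R) : subsp Z -> small_vec Z -> 0 < eps ->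
  exists x, [/\ Z x, nb x 2, exists2 f, inK f & ap f x = 1,
    forall g, ground g -> `|ap g x| <= eps &
    forall i f, (i < J)%N -> KK (Some i) f -> `|ap f x| <= 4 * mu i].
Proof.
move=> Zs Zv eps0; have nJ : (0 < nn J)%N by apply: leq_trans (nn_gt J).
have [x [Zx x2 fx gx [S [u [Sm su u2 xE]]]]] := average Zs Zv nJ eps0.
exists x; split => // i f iJ; apply: (avg_weight _ _ Sm su u2 xE) => //.
have J0 : (0 < J)%N by lia.
apply: le_trans (_ : (nn J.-1)%:R <= _); first by rewrite ler_nat nn_mono //; lia.
have h1 : (1 <= 2 * e J + 2)%N by lia.
have {}h1 := nn_exp J.-1 h1; rewrite expr1 in h1; apply: (le_trans h1).
apply: (le_trans (nn_pred_big J0)); apply: ler_pM => //.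
- by rewrite exprn_ge0 // (ltW (mu_gt0 _)).
- by rewrite ler_nat leq_pred.
- apply: le_trans (_ : mu J <= _); last by apply: mu_anti; lia.
  by rewrite expr2 ler_piMr ?mu_le1 ?(ltW (mu_gt0 _)).
Qed.

Lemma mu_sq j : mu j.+1 <= mu j ^+ 2.
Proof.
by apply: le_trans (mu_nn j); rewrite ler_peMr ?nn1 // (ltW (mu_gt0 _)).
Qed.

(* The free index [p] leaves infinitely many functionals to choose from, so that the
   weight coded by the sequence extended by [phi p] can be made large. *)
Lemma exact_pair Z j M (eps : R) : subsp Z -> small_vec Z -> 0 < eps -> ~~ odd j -> (0 < j)%N ->
  exists b y (phi : nat -> nat -> R), [/\ (M <= b)%N, supp y M b, Z y & [/\ nb y 16,
    (forall p, [/\ KK (Some j) (phi p), fsupp (phi p) M (b + p).+1 & ap (phi p) y = 1]),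
    injective phi, forall g, ground g -> `|ap g y| <= eps &
    forall i f, i != j -> KK (Some i) f -> `|ap f y| <= 16 * mu (minn i j)]].
Proof.
move=> Zs Zv eps0 oj j0.
(* The final scaling by [(mu j * n)^-1] loses a factor [mu j], paid here in advance. The minimum
   with 1 gives the bound on ground functionals that [main_est] needs at depth [e j], where
   [half ^+ e j] is [mu j]. *)
pose eps' := Num.min eps 1 * mu j.
have eps'0 : 0 < eps' by rewrite mulr_gt0 ?mu_gt0 // lt_min eps0 ltr01.
(* The threshold has the form required by [ap_tail], with [M] the end of the preceding block; it
   also exceeds [j], so that index [j] itself is covered by the averages. *)
pose tau a := (a + j + 2)%N.
have [|S [x [S0 Sm sx hx]]] := @pick_seq (fun a b x => [/\ Z x, nb x 2,
    exists2 f, inK f & ap f x = 1, forall g, ground g -> `|ap g x| <= eps' &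
    forall i f, (i < tau a)%N -> KK (Some i) f -> `|ap f x| <= 4 * mu i]) M.
  move=> a.
  pose Za x := Z x /\ low x a.
  have Zas : subsp Za.
    case: Zs => Z1 Z2 Z3; split.
    - by split => // n _; rewrite coef0.
    - by move=> x y [? h1] [? h2]; split; [exact: Z2 | move=> n na; rewrite coefD h1 ?h2 ?addr0].
    - by move=> c x [? h1]; split; [exact: Z3 | move=> n na; rewrite coefZ h1 ?mulr0].
  have Zav : small_vec Za.
    move=> M' eps1 e1; have [u [Zu lu nu fu gu]] := Zv (maxn M' a) eps1 e1.
    by exists u; split => //; [split => //|]; apply: lowW lu; rewrite ?leq_maxr ?leq_maxl.
  have [x [[Zx lx] x2 fx gx wx]] := avg_exists (tau a) Zas Zav eps'0.
  exists (maxn a (size x)), x; rewrite leq_maxl; split => //.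
  by apply: suppW (low_supp lx) => //; exact: leq_maxr.
have Slt k : (S k < S k.+1)%N.
  rewrite ltn_neqAle Sm // andbT; apply/eqP => SE; have [_ _ [f _ fx] _ _] := hx k.
  suff x0 : x k = 0 by rewrite x0 ap0 in fx; lra.
  apply/polyP => n; rewrite coef0; apply: contrapT => /eqP /sx; lia.
have Sk k : (k <= S k)%N by elim: k => // k IH; apply: leq_ltn_trans (Slt k).
have taum : {homo (fun k => tau (S k)) : m n / (m <= n)%N}.
  by move=> m n /Sm; rewrite /tau; lia.
have tauk k : (k <= tau (S k))%N by have := Sk k; rewrite /tau; lia.
have sizx k : (size (x k) <= S k.+1)%N by exact: supp_size_le (sx k).
have x2 k : nb (x k) 2 by case: (hx k).
have mj := mu_gt0 j; have mj1 := mu_gt0 j.+1.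
have m2j : mu j.+1 <= mu j by apply: mu_anti.
(* Taking [n] vectors leaves one of the [nn j] terms for the coordinate functional at [b + p]; [N]
   bounds the number of terms for every index below [j]. *)
pose n := (nn j).-1; pose N := nn j.-1.
have Nbig : N%:R ^+ (2 * e j + 2) <= n%:R * mu j ^+ 2 := nn_pred_big j0.
have N1 : 1 <= N%:R :> R := nn1 _.
have NX a : (a <= 2 * e j + 2)%N -> N%:R ^+ a <= n%:R * mu j ^+ 2.
  by move=> h; apply: le_trans Nbig; exact: nn_exp.
have n0 : 0 < n%:R * mu j ^+ 2 by apply: lt_le_trans (NX 0%N isT); rewrite expr0.
have nr : 0 < n%:R :> R.
  by move: n0; rewrite (pmulr_lgt0 _ (exprn_gt0 2 mj)).
have nltN : (n.+1 <= nn j)%N by rewrite /n prednK //; apply: leq_trans (nn_gt j).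
have big i f : (j < i)%N -> KK (Some i) f -> forall p q, (p <= q)%N ->
    `|ap f (\sum_(p <= k < q) x k)| <= 4 * mu j.+1 * (q - p)%:R + 2.
  move=> ij fi p q pq; apply: (@ris_sum i f (fun k => tau (S k))) => //.
  - by move=> k; apply: x2; exact: KK_inK fi.
  - move=> k ik; have [_ _ _ _ h] := hx k; apply: (le_trans (h i f ik fi)).
    by rewrite ler_wpM2l //; exact: mu_anti.
  - move=> k ik; apply: (le_trans (ap_tail ik fi (x2 k) (sizx k))).
    by rewrite ler_wpM2r //; [exact: ltW | lra].
pose X := \sum_(0 <= k < n) x k.
have est f p q : inK f -> (p <= q)%N ->
    `|ap f (\sum_(p <= k < q) x k)| <= 4 * (mu j * (q - p)%:R + 2 * N%:R ^+ e j).
  move=> fK pq; have := @main_est j (e j) N 4 S x Sm sx.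
  move/(_ _ _ _ _ _ _ f fK (e j) p q (leqnn _) pq); apply => //.
  - by apply: leq_trans (nn_gt _).
  - by move=> i ij; rewrite (leq_ltn_trans _ (e_gt i)) //= nn_mono //; clear - ij; lia.
  - by move=> g gK k; apply: (le_trans (x2 k g gK)); lra.
  - move=> g gg k; have [_ _ _ h _] := hx k; apply: (le_trans (h g gg)).
    apply: ler_pM => //; rewrite ?le_min ?(ltW eps0) ?ler01 //.
      by rewrite (ltW mj).
    by rewrite ge_min; apply/orP; right; lra.
  - move=> i g ji gi p' q' pq'; have [ij|ij] := ltnP j i.
      have := big i g ij gi p' q' pq'.
      by have := ler_wpM2r (ler0n R (q' - p')) m2j; rewrite -/(mu j); lra.
    have {ij ji} ij : i = j by apply/eqP; rewrite eqn_leq ij ji.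
    have := @ap_sum_le g x (4 * mu j) p' q' pq'; rewrite -/(mu j).
    move/(_ _)/le_trans; apply; last by lra.
    move=> k _; have [_ _ _ _ h] := hx k; apply: h; last by rewrite -ij.
    by rewrite /tau; clear; lia.
have /choice[h hh] : forall k, exists h : nat -> R,
    [/\ inK h, fsupp h (S k) (S k.+1) & ap h (x k) = 1].
  move=> k; have [_ _ [f fK fx] _ _] := hx k.
  exists (restr (S k) (S k.+1) f); split; first exact: inK_restr.
    by move=> m; rewrite /restr; case: ifP; rewrite ?eqxx.
  by rewrite ap_restr //; exact: sx.
pose c := (mu j * n%:R)^-1; have c0 : 0 < c by rewrite invr_gt0 mulr_gt0.
pose b := S n.
have sX : supp X M b.
  apply: supp_sum => k; rewrite mem_index_iota => /andP[_ kn].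
  by apply: suppW (sx k); [rewrite -S0 Sm | rewrite /b Sm].
pose H m := \sum_(l < n) h l m.
(* The extra coordinate lies beyond the support of the vector: the value 1 is unchanged, yet
   different [p] give different functionals. *)
pose phi p m := mu j * (H m + dual (b + p)%N m).
have Hs : succ (n * 1) (S 0%N) b H.
  apply: succ_sum => //; last by rewrite -(ltr0n R).
  by move=> k; have [? ? _] := hh k; apply: succ1 => //; exact: Sm.
have phis p : succ (n * 1 + 1) (S 0%N) (b + p).+1 (fun m => H m + dual (b + p)%N m).
  apply: (succD _ _ Hs); [exact: Sm | by rewrite leqW // leq_addr |].
  apply: succ1; first exact: KK_inK (ground_KK (dual_ground _)).
    by move=> m; rewrite /dual; case: (eqVneq m (b + p)%N) => [->|]; rewrite ?eqxx //; clear; lia.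
  by rewrite leqW // leq_addr.
have phiK p : KK (Some j) (phi p).
  by apply: (succ_KK oj _ (phis p)); rewrite muln1 addn1.
have HX : ap H X = n%:R.
  rewrite /H /X ap_sum big_mkord.
  under eq_bigr => k _ do rewrite (diag_ap Sm sx (fun k => let: And3 _ h _ := hh k in h) (ltn_ord k)).
  rewrite (eq_bigr (fun=> 1)); last by move=> k _; case: (hh k).
  by rewrite sumr_const card_ord.
have Hb m : (b <= m)%N -> H m = 0.
  by move=> bm; apply: contrapT => /eqP /(succ_fsupp Hs) /andP[_]; rewrite ltnNge bm.
exists b, (c *: X), phi; split.
- by rewrite -S0; exact: Sm.
- exact: suppZ.
- by case: (Zs) => _ _; apply; apply: subsp_sum => // k _; case: (hx k).
have cest f D : `|ap f X| <= D * (mu j * n%:R) -> `|ap f (c *: X)| <= D.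
  by move=> h1; rewrite apZ normrM gtr0_norm // mulrC ler_pdivrMr // mulr_gt0.
split.
- move=> f fK; apply: cest; apply: (le_trans (est f 0%N n fK (leq0n _))); rewrite subn0.
  have h1 := NX (e j) (leq_trans (leq_pmull _ (isT : 0 < 2)%N) (leq_addr _ _)); rewrite expr2 in h1.
  have h2 : n%:R * (mu j * mu j) <= n%:R * mu j * 1.
    by rewrite -mulrA ler_wpM2l ?ler0n // ler_wpM2l ?mu_le1 // ltW.
  lra.
- move=> p; split => //.
    move=> m hm; rewrite -S0; apply: (succ_fsupp (phis p)).
    by apply: contraNneq hm; rewrite /phi => ->; rewrite mulr0.
  rewrite apZ /phi ap_scalel.
  have -> : ap (fun m => H m + dual (b + p)%N m) X = ap H X.
    by apply: eq_ap => m /sX mb; rewrite /dual; case: (eqVneq m (b + p)%N) => [mE|_]; [move: mb; rewrite mE /b; clear; lia | rewrite addr0].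
  by rewrite HX /c mulVf // gt_eqF // mulr_gt0.
- move=> p p' pE; have := congr1 (fun f => f (b + p)%N) pE; rewrite /phi !Hb ?leq_addr // !add0r.
  rewrite /dual eqxx mulr1; case: (eqVneq (b + p)%N (b + p')%N) => [/addnI //|_] /eqP.
  by rewrite mulr0 gt_eqF.
- move=> g gg; apply: cest.
  have := @ap_sum_le g x eps' 0 n (leq0n _) _; rewrite subn0 => h1.
  apply: (le_trans (h1 _)); first by move=> k _; case: (hx k) => _ _ _ /(_ g gg).
  by rewrite /eps' -mulrA ler_wpM2r ?mulr_ge0 ?ler0n ?(ltW mj) // ge_min lexx.
move=> i f ij fi; apply: cest; have mi := mu_gt0 i.
have [ltij|ltji|/eqP] := ltngtP i j; last by rewrite (negPf ij).
  have [d [cc [F [a' [b' [dj bl FK Fs fE]]]]]] := KK_inv fi.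
  have xK g : inK g -> forall k, `|ap g (x k)| <= 4.
    by move=> gK k; apply: (le_trans (x2 k g gK)); lra.
  (* The constant 16 is 4 from the main term of the children, 8 from their error term and 4 from the
     straddling vectors. *)
  have := @node_est i d cc F a' b' S x 4 (4 * mu j) (8 * N%:R ^+ e j) 0%N n bl Sm sx _ xK.
  rewrite -fE subn0 -/X; move=> hh1; apply: (le_trans (hh1 _ _ _ _)) => //.
  - move=> d' dd; apply: node_of_KK; exists d', cc, F, a', b'; split => //.
    + exact: leq_trans dj.
    + exact: blocksW bl.
    + by move=> l ld; apply: FK; exact: leq_trans dd.
    + by move=> od l ld; apply: Fs => //; exact: leq_trans dd.
  - lra.
  - move=> l ld p q pq; apply: (le_trans (est _ _ _ _ pq)); last by lra.
    by apply: inK_restr; have [w ?] := FK l ld; exists w.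
  - have dN : d%:R <= N%:R :> R.
      by rewrite ler_nat (leq_trans dj) // nn_mono // -ltnS prednK.
    have h1 : d%:R * N%:R ^+ e j <= n%:R * mu j ^+ 2.
      apply: le_trans (NX (e j).+1 _); last by clear; lia.
      by rewrite exprS ler_wpM2r // exprn_ge0 // ler0n.
    have h2 : d%:R <= n%:R * mu j ^+ 2 by apply: (le_trans dN); rewrite -[leLHS]expr1; apply: NX; clear; lia.
    have mji : mu j <= mu i by apply: mu_anti; exact: ltnW.
    have h3 : n%:R * mu j ^+ 2 <= n%:R * mu j * mu i.
      by rewrite expr2 mulrA ler_wpM2l // mulr_ge0 ?ler0n // ltW.
    have h4 := ler_wpM2l (ltW mi) h1.
    have h5 : mu i * (n%:R * mu j ^+ 2) <= mu i * (n%:R * mu j).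
      by rewrite ler_wpM2l ?(ltW mi) // ler_wpM2l ?ler0n // expr2 ler_piMr ?mu_le1 // ltW.
    lra.
have := big i f ltji fi 0%N n (leq0n _); rewrite subn0 => /le_trans; apply.
have h1 := NX 0%N isT; rewrite expr0 in h1.
have h2 : mu j.+1 * n%:R <= mu j ^+ 2 * n%:R by rewrite ler_wpM2r ?ler0n //; exact: mu_sq.
rewrite expr2 in h1 h2; lra.
Qed.

(** * Dependent sequences and the distance between two block subspaces *)

Hypothesis sigma_even : forall j s, ~~ odd (sigma j s).
Hypothesis sigma_gt : forall j s, (j < sigma j s)%N.
(** Asked only for sequences from the norming set: arbitrary real sequences are too many to be coded
    by integers. *)
Hypothesis sigma_inj : forall j (F G : nat -> nat -> R) k l,
  (forall i, (i < k)%N -> inK (F i)) -> (forall i, (i < l)%N -> inK (G i)) ->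
  sigma j (mkseq F k) = sigma j (mkseq G l) -> mkseq F k = mkseq G l.

Lemma inj_unbounded (t : nat -> nat) B : injective t -> exists p, (B <= t p)%N.
Proof.
move=> ti; apply: contrapT => /forallNP h.
have tB (i : 'I_B.+1) : (t i < B)%N by rewrite ltnNge; apply/negP/h.
have := @leq_card _ _ (fun i => Ordinal (tB i)); rewrite !card_ord ltnn => /(_ _)/negP[] //.
by move=> i k /(congr1 val)/ti/val_inj.
Qed.

(** An interval cuts at most two of the successive vectors; on the whole vectors between them [g] is
    not restricted. *)
Lemma restr_sum_le g (S : nat -> nat) (x : nat -> {poly R}) C be a b p q :
  {homo S : m n / (m <= n)%N} -> (forall k, supp (x k) (S k) (S k.+1)) ->
  (forall p q, (p <= q)%N -> `|ap g (\sum_(p <= k < q) x k)| <= be) ->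
  (forall k, `|ap (restr a b g) (x k)| <= C) -> (p <= q)%N ->
  `|ap (restr a b g) (\sum_(p <= k < q) x k)| <= be + 2 * C.
Proof.
move=> Sm sx gbe gC pq; set f := restr a b g.
have C0 : 0 <= C := le_trans (normr_ge0 _) (gC 0%N).
have be0 : 0 <= be := le_trans (normr_ge0 _) (gbe 0%N 0%N (leqnn _)).
have [r [/andP[pr rq] hl hr]] := cut_index a Sm pq.
have f0 k : (p <= k < r)%N -> ap f (x k) = 0.
  move=> kpr; apply: ap_eq0 => n /sx nk; rewrite /f /restr; case: ifP => //.
  by have := hl k kpr; lia.
have z1 : ap f (\sum_(p <= k < r) x k) = 0.
  by rewrite ap_sum big_nat big1 // => k /f0.
have [rE|rq'] := eqVneq r q; first by rewrite -rE z1 normr0; lra.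
have {rq} rq : (r < q)%N by rewrite ltn_neqAle rq'.
rewrite (big_cat_nat pr (ltnW rq)) /= apD z1 add0r big_ltn // apD.
apply: (le_trans (ler_normD _ _)).
have [t [/andP[rt tq] tl tr]] := cut_index b Sm rq.
have z2 t' : (t < t')%N -> ap f (\sum_(t' <= k < q) x k) = 0.
  move=> tt; rewrite ap_sum big_nat big1 // => k /andP[tk kq].
  apply: ap_eq0 => n /sx nk; rewrite /f /restr; case: ifP => //.
  by have := tr k; lia.
have z3 : ap f (\sum_(r.+1 <= k < t) x k) = ap g (\sum_(r.+1 <= k < t) x k).
  rewrite !ap_sum; apply: eq_big_nat => k /andP[rk kt].
  apply: ap_restr => n /sx nk.
  by have := tl k; have := hr k; lia.
have b1 := gC r; have b2 := gbe r.+1 t rt.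
have [tE|tq'] := eqVneq t q; first by rewrite -tE z3; rewrite -/f in b1; lra.
have {tq} tq : (t < q)%N by rewrite ltn_neqAle tq'.
rewrite (big_cat_nat rt (ltnW tq)) /= apD z3 big_ltn // apD z2 // addr0.
have b3 := gC t; rewrite -/f in b1 b3.
by have := ler_normD (ap g (\sum_(r.+1 <= k < t) x k)) (ap f (x t)); lra.
Qed.

Lemma sign_sum_le p q : (p <= q)%N -> `|\sum_(p <= k < q) (-1) ^+ k| <= 1 :> R.
Proof.
move=> pq; suff -> : \sum_(p <= k < q) (-1) ^+ k = (odd (q - p))%:R * (-1) ^+ p :> R.
  by rewrite normrM normr_sign mulr1; case: odd; rewrite ?normr1 ?normr0.
rewrite -(subnKC pq) addKn; elim: (q - p)%N => [|d IH].
  by rewrite addn0 big_geq // mul0r.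
rewrite addnS big_nat_recr ?leq_addr //= IH exprD -(signr_odd _ d).
by case: (odd d) => /=; rewrite ?expr0 ?expr1; ring.
Qed.

Definition part (Z W : {poly R} -> Prop) k := if odd k then W else Z.

(** The next weight is known only after [phi k] has been fixed. The free index of the exact pair is
    therefore used to push this weight beyond the previous one and beyond the length of [y k]. *)
Lemma dependent_seq Z W j0 (eps : R) : subsp Z -> subsp W -> small_vec Z -> small_vec W ->
  0 < eps ->
  exists (S : nat -> nat) (y : nat -> {poly R}) (phi : nat -> nat -> R),
  let tau k := sigma j0 (mkseq phi k) in
  [/\ {homo S : m n / (m <= n)%N}, forall k, supp (y k) (S k) (S k.+1),
      forall k, fsupp (phi k) (S k) (S k.+1), forall k, (tau k < tau k.+1)%N &
  [/\ forall k, (size (y k) + j0 + 2 <= tau k.+1)%N, forall k, part Z W k (y k), forall k, nb (y k) 16,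
      forall k g, ground g -> `|ap g (y k)| <= eps &
      (forall k, KK (Some (tau k)) (phi k) /\ ap (phi k) (y k) = 1) /\
      forall k i f, i != tau k -> KK (Some i) f -> `|ap f (y k)| <= 16 * mu (minn i (tau k))]].
Proof.
move=> Zs Ws Zv Wv eps0.
pose good (s : seq (nat -> R)) := forall i, (i < size s)%N -> inK (nth (fun=> 0) s i).
pose step (st : nat * (nat * seq (nat -> R))) (o : nat * ({poly R} * (nat -> R))) :=
  let: (k, (a, s)) := st in let: (b, (y, f)) := o in
  good s -> [/\ (a <= b)%N, supp y a b, fsupp f a b, (sigma j0 s < sigma j0 (rcons s f))%N &
   [/\ (size y + j0 + 2 <= sigma j0 (rcons s f))%N, part Z W k y, nb y 16,
     forall g, ground g -> `|ap g y| <= eps &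
     (KK (Some (sigma j0 s)) f /\ ap f y = 1) /\
     forall i f, i != sigma j0 s -> KK (Some i) f -> `|ap f y| <= 16 * mu (minn i (sigma j0 s))]].
have /choice[G hG] : forall st, exists o, step st o.
  case=> k [a s]; have [gs|ngs] := pselect (good s); last by exists (0%N, (0, fun=> 0)).
  have Ps : subsp (part Z W k) by rewrite /part; case: odd.
  have Pv : small_vec (part Z W k) by rewrite /part; case: odd.
  have [b [y [phi [ab sy Zy [y16 hphi phi_inj gy wy]]]]] := exact_pair a Ps Pv eps0
    (sigma_even j0 s) (leq_ltn_trans (leq0n j0) (sigma_gt j0 s)).
  have phiK p : inK (phi p) by case: (hphi p) => /KK_inK.
  have [p hp] : exists p, (maxn (sigma j0 s).+1 (size y + j0 + 2) <= sigma j0 (rcons s (phi p)))%N.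
    apply: (@inj_unbounded (fun p => sigma j0 (rcons s (phi p)))) => p p'.
    have rE p0 : rcons s (phi p0) = mkseq (nth (fun=> 0) (rcons s (phi p0))) (size s).+1.
      by rewrite -(size_rcons s (phi p0)) mkseq_nth.
    have rK p0 i : (i < (size s).+1)%N -> inK (nth (fun=> 0) (rcons s (phi p0)) i).
      rewrite nth_rcons ltnS leq_eqVlt => /orP[/eqP->|il]; first by rewrite ltnn eqxx.
      by rewrite il; exact: gs.
    rewrite (rE p) (rE p') => /(sigma_inj (rK p) (rK p')); rewrite -!rE.
    by move=> /rcons_inj[/phi_inj].
  exists ((b + p).+1, (y, phi p)) => _.
  have [h1 h2 h3] := hphi p; split => //; first by lia.
  - by apply: suppW sy => //; lia.
  - by lia.
  - by split => //; lia.
pose nxt (st : nat * (nat * seq (nat -> R))) :=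
  let: (b, (y, f)) := G st in (st.1.+1, (b, rcons st.2.2 f)).
pose st k := iter k nxt (0%N, (0%N, [::])).
pose S k := (st k).2.1; pose y k := (G (st k)).2.1; pose phi k := (G (st k)).2.2.
have stE k : st k = (k, (S k, mkseq phi k)).
  rewrite /S; elim: k => [|k IH] //; rewrite /st iterS -/(st k) /nxt.
  case E : (G (st k)) => [b [z f]] /=; rewrite {1}IH /= {1}IH /= mkseqS; congr (_, (_, rcons _ _)).
  by rewrite /phi E.
have SE k : S k.+1 = (G (st k)).1.
  by rewrite {1}/S /st iterS -/(st k) /nxt; case: (G (st k)) => [b [z f]].
have gd k : good (mkseq phi k).
  elim: k => [|k IH] i; rewrite size_mkseq // ltnS leq_eqVlt => /orP[/eqP->|ik].
    rewrite nth_mkseq //; have := hG (st k); rewrite /step /phi {1}stE.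
    case: (G (st k)) => [b [z f]] /(_ IH)[_ _ _ _ [_ _ _ _ [[/KK_inK]]]] //.
  by have := IH i; rewrite size_mkseq !nth_mkseq //; [apply | exact: ltnW].
have key k : [/\ (S k <= S k.+1)%N, supp (y k) (S k) (S k.+1), fsupp (phi k) (S k) (S k.+1),
  (sigma j0 (mkseq phi k) < sigma j0 (mkseq phi k.+1))%N &
   [/\ (size (y k) + j0 + 2 <= sigma j0 (mkseq phi k.+1))%N, part Z W k (y k), nb (y k) 16,
     forall g, ground g -> `|ap g (y k)| <= eps &
     (KK (Some (sigma j0 (mkseq phi k))) (phi k) /\ ap (phi k) (y k) = 1) /\
     forall i f, i != sigma j0 (mkseq phi k) -> KK (Some i) f ->
       `|ap f (y k)| <= 16 * mu (minn i (sigma j0 (mkseq phi k)))]].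
  have := hG (st k); rewrite mkseqS SE /y /phi /step {1}stE.
  by case: (G (st k)) => [b [z f]] /(_ (gd k)).
exists S, y, phi; split; try by move=> k; case: (key k).
  by apply: homo_leq => //; [exact: leq_trans | move=> k; case: (key k)].
split; try by move=> k; case: (key k) => _ _ _ _ [].
by split=> k; case: (key k) => _ _ _ _ [_ _ _ _ [h1 h2]]; [exact: h1 | exact: h2].
Qed.

Lemma mu_inv j : mu j * j%:R <= 1.
Proof.
rewrite /mu exprVn mulrC ler_pdivrMr ?exprn_gt0 // mul1r -natrX ler_nat.
by apply: leq_trans (ltnW (e_gt j)) (ltnW (ltn_expl _ _)).
Qed.

(** Terms of a dependent sequence are taken alternately from [Z] and [W]. Its special functional
    adds all of them up to 1, whereas on the difference the same functional meets alternating signs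
    and any other one meets wrong weights. *)
Theorem hi_blocks Z W (eps : R) : subsp Z -> subsp W -> small_vec Z -> small_vec W -> 0 < eps ->
  exists z w, [/\ Z z, W w, exists2 f, inK f & ap f (z + w) = 1 & nb (z - w) eps].
Proof.
move=> Zs Ws Zv Wv eps0.
(* The final bound on the difference is [96 * mu j0]: the constant 32 for the signed vectors, times
   3 for the main term and twice the error. *)
have [j0 [oj0 mj0]] : exists j0, odd j0 /\ 96 * mu j0 <= eps.
  pose k := Num.bound (96 / eps); exists (2 * k).+1; rewrite oddS oddM; split => //.
  have k1 : 96 / eps < k%:R by apply: archi_boundP; rewrite divr_ge0 // ltW.
  rewrite ltr_pdivrMr // in k1.
  have h1 := mu_inv (2 * k).+1; have h2 : (k%:R : R) <= (2 * k).+1%:R by rewrite ler_nat; clear; lia.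
  have h3 := mu_gt0 (2 * k).+1.
  have h4 := ler_wpM2l (ltW h3) h2; have h5 := ler_wpM2r (ltW h3) (ltW k1).
  have h6 : mu (2 * k).+1 * k%:R <= 1 := le_trans h4 h1.
  have := ler_wpM2r (ltW eps0) h6; move: h5; lra.
have j0_gt0 : (0 < j0)%N by case: (j0) oj0.
(* At this depth the gain is [mu j0 ^ 2]: one factor is lost in the normalization, the other makes
   the difference small. *)
pose RR := (2 * e j0)%N.
have muRR : half ^+ RR = mu j0 ^+ 2 by rewrite /RR mulnC exprM.
have hRR : 0 < half ^+ RR by exact: halfX_gt0.
have [S [y [phi [Sm sy sphi taulti [szy Zy y16 gy [hphi wy]]]]]] :=
  dependent_seq j0 Zs Ws Zv Wv hRR.
pose tau k := sigma j0 (mkseq phi k).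
have taum : {homo tau : m n / (m <= n)%N}.
  by apply: homo_leq => //; [exact: leq_trans | move=> k; exact: ltnW (taulti k)].
have tauk k : (k <= tau k)%N by elim: k => // k IH; exact: leq_ltn_trans IH (taulti k).
have phiK k : inK (phi k) by case: (hphi k) => /KK_inK.
have m0 := mu_gt0 j0; have m1 := mu_le1 j0; have ms := mu_sq j0.
pose x k := (-1) ^+ k *: y k.
have sx k : supp (x k) (S k) (S k.+1) by exact: suppZ.
have apx f k : `|ap f (x k)| = `|ap f (y k)| by rewrite apZ normrM normr_sign mul1r.
have mtau k i : (j0 < i)%N -> mu (minn i (tau k)) <= mu j0.+1.
  by move=> ij; apply: mu_anti; have := sigma_gt j0 (mkseq phi k); rewrite -/(tau k); lia.
have small i f k : (j0 < i)%N -> i != tau k -> KK (Some i) f -> `|ap f (x k)| <= 16 * mu j0.+1.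
  move=> ij ik fi; rewrite apx; apply: (le_trans (wy k i f ik fi)).
  by rewrite ler_wpM2l // mtau.
have ap_phi_x l k a b : l != k -> ap (restr a b (phi l)) (x k) = 0.
  move=> lk; apply: ap_eq0 => n /sx nk; rewrite /restr; case: ifP => // _.
  apply: contrapT => /eqP /sphi nl; case: (ltngtP l k) => [h|h|h]; last by rewrite h eqxx in lk.
    by have := Sm _ _ h; clear - nk nl; lia.
  by have := Sm _ _ h; clear - nk nl; lia.
pose n := nn j0.
have special f : KK (Some j0) f -> forall p q, (p <= q)%N ->
    `|ap f (\sum_(p <= k < q) x k)| <= 32 * (half ^+ RR * (q - p)%:R + 2).
  case/KK_inv => d [c [F [a [b [dj bl FK Fs ->]]]]] p q pq.
  set X := \sum_(p <= k < q) x k; set u := (q - p)%:R; have u0 : 0 <= u by rewrite ler0n.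
  have FK' l : (l < d)%N -> inK (F l) by move=> ld; have [w ?] := FK l ld; exists w.
  (* [t] is the first place where the special functional leaves the dependent sequence. Before it
     the alternating signs cancel; after it the weights cannot match. *)
  have [t [td teq tne]] : exists t, [/\ (t <= d)%N, forall l, (l < t)%N -> F l = phi l &
      (t < d)%N -> F t <> phi t].
    pose P l := (d <= l)%N || `[< F l <> phi l >].
    have ex : exists l, P l by exists d; rewrite /P leqnn.
    case: (ex_minnP ex) => t Pt tmin; exists t; split.
    - by apply: tmin; rewrite /P leqnn.
    - move=> l lt; apply: contrapT => h; have := tmin l; rewrite /P (asboolT h) orbT.
      by move/(_ isT); rewrite leqNgt lt.
    - by move=> td; case/orP: Pt => [|/asboolP//]; rewrite leqNgt td.
  have nodeX : ap (node j0 d F a b) X = mu j0 * \sum_(l < d) ap (restr a b (F l)) X.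
    rewrite -(ap_suml d (fun l => restr a b (F l))) -ap_scalel; apply: eq_ap => m _; rewrite /node /restr.
    by case: ifP => // _; rewrite big1 ?mulr0.
  have E1 : `|\sum_(0 <= l < t) ap (restr a b (F l)) X| <= 33.
    rewrite (_ : \sum_(0 <= l < t) _ = ap (restr a b (fun m => \sum_(l < t) phi l m)) X); last first.
      rewrite big_mkord -(ap_suml t (fun l => restr a b (F l))); apply: eq_ap => m _; rewrite /restr.
      case: ifP => _; last by rewrite big1.
      by apply: eq_bigr => l _; rewrite teq.
    (* 1 bounds the alternating sum over whole vectors, and 16 each the vectors cut at [a] and at
       [b]. *)
    have -> : 33 = 1 + 2 * 16 :> R by ring.
    have gx k a' b' : ap (restr a' b' (fun m => \sum_(l < t) phi l m)) (x k) =
        if (k < t)%N then ap (restr a' b' (phi k)) (x k) else 0.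
      rewrite (_ : ap _ _ = \sum_(l < t) ap (restr a' b' (phi l)) (x k)); last first.
        by rewrite -(ap_suml t (fun l => restr a' b' (phi l))); apply: eq_ap => m _; rewrite /restr; case: ifP; rewrite // big1.
      case: ltnP => kt; last first.
        by rewrite big1 // => l _; apply: ap_phi_x; rewrite ltn_eqF // (leq_trans _ kt).
      by rewrite (bigD1 (Ordinal kt)) //= big1 ?addr0 // => l lk; exact: ap_phi_x.
    apply: (restr_sum_le Sm sx _ _ pq); last first.
      move=> k; rewrite gx; case: ifP => _; rewrite ?normr0 //.
      by rewrite apx; apply: y16; exact: inK_restr.
    move=> p' q' pq'; rewrite ap_sum.
    have gk k : ap (fun m => \sum_(l < t) phi l m) (x k) = if (k < t)%N then (-1) ^+ k else 0.
      rewrite -(@ap_restr _ (S k) (S k.+1)) // gx; case: ifP => // _.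
      by rewrite ap_restr // apZ (hphi k).2 mulr1.
    under eq_bigr do rewrite gk.
    have [tp|pt] := leqP t p'.
      by rewrite big_nat big1 ?normr0 // => k /andP[pk _]; rewrite ltnNge (leq_trans tp pk).
    have -> : \sum_(p' <= k < q') (if (k < t)%N then (-1) ^+ k else 0) =
              \sum_(p' <= k < minn q' t) (-1) ^+ k :> R.
      have [qt|tq] := leqP q' t.
        apply: eq_big_nat => k /andP[_ kq].
        by rewrite (leq_trans kq qt).
      rewrite (big_cat_nat (ltnW pt) (ltnW tq)) /=.
      rewrite [X in _ + X](_ : _ = 0) ?addr0; last first.
        by rewrite big_nat big1 // => k /andP[tk _]; rewrite ltnNge tk.
      by apply: eq_big_nat => k /andP[_ ->].
    by apply: sign_sum_le; rewrite leq_min pq' ltnW.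
  have E2 l : (t <= l < d)%N -> `|ap (restr a b (F l)) X| <= 16 * mu j0.+1 * u + (if l == t then 16 else 0).
    move=> /andP[tl ld]; pose i := sigma j0 (mkseq F l).
    have Fi : KK (Some i) (restr a b (F l)) by apply: KK_restr; exact: Fs.
    have ij0 : (j0 < i)%N by exact: sigma_gt.
    (* Equal weights mean equal histories. A history longer than [t] contains the deviation, so only
       the term [t] can share a weight with the sequence, namely with [phi t]. *)
    have itau k : i = tau k -> (l = k /\ l = t).
      move=> ik; have E := @sigma_inj j0 F phi l k _ _ ik.
      have {}E : mkseq F l = mkseq phi k.
        by apply: E => m ml; [apply: FK'; exact: ltn_trans ld | exact: phiK].
      have lk : l = k by rewrite -(size_mkseq F l) E size_mkseq.
      split => //; apply/eqP; rewrite eq_sym; apply: contrapT => /negP tl'.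
      have {tl'} tl' : (t < l)%N by rewrite ltn_neqAle tl'.
      case: (tne _); first exact: ltn_trans ld.
      by rewrite -(nth_mkseq (fun=> 0) F tl') E nth_mkseq // -lk.
    case: eqP => [lt|lt].
      apply: (@one_exception (restr a b (F l)) x 16 (16 * mu j0.+1) l p q) => //.
      - by rewrite mulr_ge0 // ltW ?mu_gt0.
      - by rewrite apx; apply: y16; exact: KK_inK Fi.
      - by move=> k kl; apply: small Fi => //; apply: contraNneq kl => /itau[->].
    rewrite addr0; apply: ap_sum_le => // k _; apply: small Fi => //.
    by apply/eqP => /itau[_].
  have E3 : `|\sum_(t <= l < d) ap (restr a b (F l)) X| <= n%:R * (16 * mu j0.+1 * u) + 16.
    apply: (le_trans (ler_norm_sum _ _ _)).
    apply: (le_trans (ler_sum_nat E2)); rewrite big_split /= sumr_const_nat.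
    apply: lerD.
      rewrite -[leLHS]mulr_natl; apply: ler_wpM2r.
        by rewrite !mulr_ge0 // ltW ?mu_gt0.
      by rewrite ler_nat; apply: leq_trans dj; exact: leq_subr.
    have [h|h] := ltnP t d; last by rewrite big_geq.
    rewrite big_ltn // eqxx big_nat big1 ?addr0 // => l /andP[tl _].
    by rewrite gtn_eqF.
  rewrite nodeX normrM gtr0_norm // -(big_mkord xpredT (fun l => ap (restr a b (F l)) X)).
  rewrite (big_cat_nat (leq0n t) td) /=.
  have := ler_normD (\sum_(0 <= l < t) ap (restr a b (F l)) X) (\sum_(t <= l < d) ap (restr a b (F l)) X).
  move=> E4; have E5 := le_trans E4 (lerD E1 E3).
  apply: (le_trans (ler_wpM2l (ltW m0) E5)); rewrite muRR.
  have mn : mu j0.+1 * n%:R <= mu j0 ^+ 2 by exact: mu_nn.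
  have mnv := ler_wpM2r u0 mn.
  have hv : mu j0 * (mu j0.+1 * n%:R * u) <= mu j0 ^+ 2 * u.
    by apply: le_trans mnv; rewrite ler_piMl // !mulr_ge0 ?ler0n // (ltW (mu_gt0 _)).
  have : 0 <= mu j0 ^+ 2 * u by rewrite mulr_ge0 // exprn_ge0 // ltW.
  by lra.
have n0 : 0 < n%:R :> R by rewrite ltr0n; apply: leq_ltn_trans (nn_gt j0).
pose lam := (mu j0 * n%:R)^-1; have lam0 : 0 < lam by rewrite invr_gt0 mulr_gt0.
pose part_sum (b : bool) := lam *: \sum_(0 <= k < n | odd k == b) y k.
have Zpart : Z (part_sum false) /\ W (part_sum true).
  case: (Zs) (Ws) => _ _ ZZ [_ _ WZ].
  split; [apply: ZZ | apply: WZ]; apply: subsp_sum => // k /eqP ok;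
    by have := Zy k; rewrite /part ok.
have zw : part_sum false + part_sum true = lam *: \sum_(0 <= k < n) y k.
  rewrite /part_sum -scalerDr [in RHS](bigID (fun k => odd k)) /= addrC.
  by congr (_ *: (_ + _)); apply: eq_bigl => k; case: odd.
have zmw : part_sum false - part_sum true = lam *: \sum_(0 <= k < n) x k.
  rewrite /part_sum -scalerBr [in RHS](bigID (fun k => ~~ odd k)) /= -sumrN; congr (_ *: (_ + _)).
    by apply: eq_big => k; [case: odd | rewrite /x -signr_odd => /eqP ->; rewrite expr0 scale1r].
  by apply: eq_big => k; [case: odd | rewrite /x -signr_odd => /eqP ->; rewrite expr1 scaleN1r].
case: Zpart => Zp Wp; exists (part_sum false), (part_sum true); split => //.
  exists (node j0 n phi (S 0%N) (S n)).
    exists (Some j0); apply: node_of_KK; exists n, S, phi, (S 0%N), (S n); split => //.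
    - by move=> l _; split; [exact: Sm | exact: sphi].
    - by move=> l _; case: (phiK l) => w ?; exists w.
    - by move=> _ l _; case: (hphi l).
  rewrite zw apZ.
  rewrite (_ : ap _ _ = mu j0 * ap (fun m => \sum_(l < n) phi l m) (\sum_(0 <= k < n) y k)); last first.
    rewrite -ap_scalel; apply: eq_ap => m /(_ : supp _ (S 0%N) (S n)) hm.
    rewrite /node /restr hm //; apply: supp_sum => k; rewrite mem_index_iota => /andP[_ kn].
    by apply: suppW (sy k); apply: Sm.
  rewrite ap_sum big_mkord (eq_bigr (fun=> 1)).
    by rewrite sumr_const card_ord /lam mulVf // gt_eqF // mulr_gt0.
  by move=> k _; rewrite (diag_ap Sm sy sphi (ltn_ord k)) (hphi k).2.
move=> f fK; rewrite zmw apZ normrM gtr0_norm // mulrC ler_pdivrMr ?mulr_gt0 //.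
pose N := nn j0.-1.
have x16 g : inK g -> forall k, `|ap g (x k)| <= 32.
  by move=> gK k; rewrite apx; apply: (le_trans (y16 k g gK)); lra.
have bigC i g : (j0 <= i)%N -> KK (Some i) g -> forall p q, (p <= q)%N ->
    `|ap g (\sum_(p <= k < q) x k)| <= 32 * (half ^+ RR * (q - p)%:R + 2).
  rewrite leq_eqVlt => /orP[/eqP <-|ij gi p q pq]; first exact: special.
  have := @ris_sum i g tau x 16 (16 * mu j0.+1) p q taum tauk.
  move/(_ _ _ _ pq)/le_trans; apply.
  - by move=> k; rewrite apx; apply: y16; exact: KK_inK gi.
  - by move=> k ik; apply: small gi => //; rewrite ltn_eqF.
  - move=> k ik; rewrite apx; apply: (ap_tail _ gi (y16 k) (leqnn _)).
    exact: leq_trans (szy k) ik.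
  - rewrite muRR; set u := (q - p)%:R; have u0 : 0 <= u by rewrite ler0n.
    have := ler_wpM2r u0 ms; have : 0 <= mu j0 ^+ 2 * u by rewrite mulr_ge0 // exprn_ge0 // ltW.
    lra.
have N0 : (0 < N)%N by apply: leq_ltn_trans (nn_gt _).
have := @main_est j0 RR N 32 S x Sm sx _ N0 _ x16 _ bigC f fK RR 0%N n (leqnn _) (leq0n _).
rewrite subn0 muRR => est.
have NX : N%:R ^+ RR <= n%:R * mu j0 ^+ 2.
  apply: le_trans (_ : N%:R ^+ (2 * e j0 + 2) <= _).
    by apply: ler_weXn2l; [rewrite ler1n | rewrite /RR leq_addr].
  apply: (le_trans (nn_pred_big j0_gt0)); apply: ler_wpM2r.
    by rewrite exprn_ge0 // ltW.
  by rewrite ler_nat leq_pred.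
apply: le_trans (_ : 96 * (n%:R * mu j0 ^+ 2) <= _); last first.
  rewrite expr2 [leLHS](_ : _ = (96 * mu j0) * (mu j0 * n%:R)); last by ring.
  by rewrite ler_wpM2r // mulr_ge0 ?ler0n // ltW.
apply: le_trans (est _ _ _) _.
- by rewrite ler0n.
- by move=> i ij; rewrite (leq_ltn_trans _ (e_gt i)) //= nn_mono // -ltnS prednK.
- move=> g gg k; rewrite apx; apply: (le_trans (gy k g gg)).
  by move: hRR; lra.
- move: NX; lra.
Qed.
End Norming.

(** * Block subspaces of well-founded trees *)

(* The basis vector of a node has the index [pickle] assigns to the node. *)
Definition nd n : seq nat := odflt [::] (unpickle n).

Definition cmp n m := prefix (nd n) (nd m) || prefix (nd m) (nd n).

Lemma cmp_refl : reflexive cmp.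
Proof. by move=> n; rewrite /cmp prefix_refl. Qed.

Section Trees.
Variable R : realType.
Variables (e nn : nat -> nat) (sigma : nat -> seq (nat -> R) -> nat).
Implicit Types (f g : nat -> R) (F : nat -> nat -> R) (x y u : {poly R}).
Local Notation mu := (mu R e).
Local Notation half := (half R).
Local Notation ground := (@ground R cmp).
Local Notation inK := (@inK R cmp e nn sigma).
Local Notation nb := (@nb R cmp e nn sigma).
Local Notation small_vec := (@small_vec R cmp e nn sigma).
Local Notation succ := (@succ R cmp e nn sigma).
Hypothesis e_gt : forall j, (j < e j)%N.
Hypothesis e_mono : {homo e : i j / (i <= j)%N}.
Hypothesis nn_gt : forall j, (j < nn j)%N.
Hypothesis nn_mono : {homo nn : i j / (i <= j)%N}.
Hypothesis mu_nn : forall j, mu j.+1 * (nn j)%:R <= mu j ^+ 2.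
Hypothesis nn_big : forall j,
  (nn j)%:R ^+ (2 * e j.+1 + 2) <= (nn j.+1).-1%:R * mu j.+1 ^+ 2 :> R.
Local Notation nn_pred_big := (nn_pred_big nn_big).
Local Notation mu_inv := (mu_inv R e_gt).
Local Notation succ_KK := (@succ_KK R cmp e nn sigma).

Lemma ap_le_norm f x : inK f -> `|ap f x| <= \sum_(i < size x) `|x`_i|.
Proof.
move=> fK; apply: (le_trans (ler_norm_sum _ _ _)); apply: ler_sum => i _.
by rewrite normrM ler_piMl // (inK_le1 _ fK).
Qed.

Lemma dual_inK n : inK (dual R n).
Proof. exact: KK_inK (ground_KK _ _ _ (dual_ground R cmp_refl n)). Qed.

Lemma norm_exists u : exists2 C, nb u C & forall D, nb u D -> C <= D.
Proof.
pose A := [set r | exists2 f, inK f & r = `|ap f u|]%classic.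
have An : (A !=set0)%classic by exists `|ap (dual R 0) u|, (dual R 0) => //; exact: dual_inK.
have As : has_sup A.
  by split => //; exists (\sum_(i < size u) `|u`_i|) => _ [f fK ->]; exact: ap_le_norm.
exists (sup A) => [f fK|D uD]; first by apply: ub_le_sup; [exact: As.2 | exists f].
by apply: ge_sup => // _ [f fK ->]; exact: uD.
Qed.

(** The supremum over the functionals need not be attained, hence the value [half] in place of 1. *)
Lemma normalize u : u != 0 -> exists a, nb (a *: u) 1 /\ exists2 f, inK f & half <= ap f (a *: u).
Proof.
move=> u0; have [C uC Cmin] := norm_exists u.
have un : u`_(size u).-1 != 0 by rewrite -/(lead_coef u) lead_coef_eq0.
have C0 : 0 < C.
  by apply: lt_le_trans (nb_coef cmp_refl (size u).-1 uC); rewrite normr_gt0.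
have [f fK hf] : exists2 f, inK f & half * C < `|ap f u|.
  apply: contrapT => h; have /Cmin : nb u (half * C).
    by move=> f fK; rewrite leNgt; apply/negP => hf; apply: h; exists f.
  by rewrite /half; lra.
exists (Num.sg (ap f u) / C); split.
  move=> g gK; rewrite apZ normrM normrM [X in _ * X * _]gtr0_norm ?invr_gt0 //.
  apply: (@le_trans _ _ (1 / C * `|ap g u|)).
    by rewrite !ler_wpM2r ?invr_ge0 ?(ltW C0) // normr_sg; case: eqP.
  by rewrite mul1r mulrC ler_pdivrMr // mul1r uC.
exists f => //; rewrite apZ mulrAC -normrEsg ler_pdivlMr //; exact: ltW.
Qed.

Definition bspan (u : nat -> {poly R}) x := exists a N,
  (forall k, (N <= k)%N -> a k = 0) /\ x = \sum_(0 <= k < N) a k *: u k.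

Lemma bspan_widen (u : nat -> {poly R}) (a : nat -> R) N N' :
  (forall k, (N <= k)%N -> a k = 0) -> (N <= N')%N ->
  \sum_(0 <= k < N) a k *: u k = \sum_(0 <= k < N') a k *: u k.
Proof.
move=> aN NN; rewrite [RHS](big_cat_nat (leq0n N) NN) /= [X in _ + X](_ : _ = 0) ?addr0 //.
by rewrite big_nat big1 // => k /andP[Nk _]; rewrite aN // scale0r.
Qed.

Lemma bspan_subsp (u : nat -> {poly R}) : subsp (bspan u).
Proof.
split.
- by exists (fun=> 0), 0%N; split => //; rewrite big_nil.
- move=> x y [a [N [aN ->]]] [b [N' [bN ->]]]; exists (fun k => a k + b k), (maxn N N'); split.
    by move=> k; rewrite geq_max => /andP[? ?]; rewrite aN ?bN ?addr0.
  rewrite (bspan_widen u aN (leq_maxl N N')) (bspan_widen u bN (leq_maxr N N')).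
  by rewrite -big_split; apply: eq_bigr => k _; rewrite scalerDl.
- move=> c x [a [N [aN ->]]]; exists (fun k => c * a k), N; split.
    by move=> k /aN ->; rewrite mulr0.
  by rewrite scaler_sumr; apply: eq_bigr => k _; rewrite scalerA.
Qed.

Lemma bspan_nth (u : nat -> {poly R}) k : bspan u (u k).
Proof.
exists (fun i => (i == k)%:R), k.+1; split; first by move=> i ki; rewrite gtn_eqF.
rewrite big_nat_recr //= eqxx scale1r big_nat big1 ?add0r // => i /andP[_ ik].
by rewrite ltn_eqF // scale0r.
Qed.

(** A functional that is at least 1/2 on [u k], restricted to the interval of [u k], ignores the
    other blocks; this bounds the coefficient by twice the norm. *)
Lemma bspan_coef (S : nat -> nat) (u : nat -> {poly R}) (a : nat -> R) N k C :
  {homo S : m n / (m <= n)%N} -> (forall k, supp (u k) (S k) (S k.+1)) ->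
  (exists2 f, inK f & half <= ap f (u k)) -> (k < N)%N ->
  nb (\sum_(0 <= k < N) a k *: u k) C -> `|a k| <= 2 * C.
Proof.
move=> Sm su [f fK hf] kN /(_ _ (inK_restr (S k) (S k.+1) fK)).
rewrite ap_sum (bigD1_seq k) //=; last first.
- exact: iota_uniq.
- by rewrite mem_index_iota kN.
rewrite apZ ap_restr ?(su k) // big1_seq ?addr0; last first.
  move=> l /andP[lk _]; rewrite apZ ap_eq0 ?mulr0 // => n /su nl; rewrite /restr.
  case: ifP => // nk; case: (ltngtP l k) lk => // h _.
    by have := Sm _ _ h; move: nk nl; clear; lia.
  by have := Sm _ _ h; move: nk nl; clear; lia.
rewrite normrM => h; have hf2 : half <= `|ap f (u k)| by apply: (le_trans hf); exact: ler_norm.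
have := le_trans (ler_wpM2l (normr_ge0 (a k)) hf2) h; rewrite /half; lra.
Qed.

Lemma blocks_grow (S : nat -> nat) (u : nat -> {poly R}) : S 0%N = 0%N ->
  (forall k, supp (u k) (S k) (S k.+1)) -> (forall k, exists2 f, inK f & half <= ap f (u k)) ->
  forall k, u k != 0 /\ (k <= S k)%N.
Proof.
move=> S0 su hu; have u_neq0 k : u k != 0.
  apply/eqP => uk; have [f _] := hu k; rewrite uk ap0.
  by have := half_gt0 R; lra.
have Slt k : (S k < S k.+1)%N.
  have lk : (u k)`_(size (u k)).-1 != 0 by rewrite -/(lead_coef (u k)) lead_coef_eq0.
  by have := su k _ lk; clear; lia.
by move=> k; split => //; elim: k => // k IH; apply: leq_ltn_trans (Slt k).
Qed.

Lemma geo_le N : \sum_(k < N) half ^+ k.+1 <= 1.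
Proof.
suff -> : \sum_(k < N) half ^+ k.+1 = 1 - half ^+ N.
  by rewrite gerBl exprn_ge0 // /half; lra.
elim: N => [|N IH]; first by rewrite big_ord0 expr0 subrr.
by rewrite big_ord_recr /= IH exprS /half; field.
Qed.

Variable T : seq nat -> Prop.
Hypothesis T_rcons : forall s i, T (rcons s i) -> T s.
Hypothesis T_wf : ~ exists b, forall n, T (mkseq b n).

Definition inT x := forall n, x`_n != 0 -> exists2 s, T s & n = pickle s.
(** The combinatorial substitute for an infinite-dimensional block subspace of the tree. *)
Definition tailful (Z : {poly R} -> Prop) :=
  [/\ subsp Z, forall M, exists u, [/\ Z u, low u M & u != 0] & forall u, Z u -> inT u].

Definition gsub s g := ground g /\ forall n, g n != 0 -> prefix s (nd n).
Definition small_at (G : (nat -> R) -> Prop) (Z : {poly R} -> Prop) (eps : R) :=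
  forall u, Z u -> nb u 1 -> forall g, G g -> `|ap g u| <= eps.
(** Smallness passes to subspaces, so finitely many families of functionals can be treated one after
    the other. *)
Definition smallable (G : (nat -> R) -> Prop) := forall Z (eps : R), tailful Z -> 0 < eps ->
  exists Z1, [/\ tailful Z1, forall u, Z1 u -> Z u & small_at G Z1 eps].

Lemma T_prefix s s' : prefix s s' -> T s' -> T s.
Proof.
move=> /prefixP[t ->]; elim/last_ind: t => [|t i IH]; first by rewrite cats0.
by rewrite -rcons_cat => /T_rcons.
Qed.

Lemma smallable_finite (G : nat -> (nat -> R) -> Prop) I :
  (forall i, smallable (G i)) -> smallable (fun g => exists2 i, (i < I)%N & G i g).
Proof.
move=> Gs; elim: I => [|I IH] Z eps Zt e0; first by exists Z; split => // u _ _ g [].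
have [Z1 [Z1t Z1Z h1]] := IH Z eps Zt e0; have [Z2 [Z2t Z21 h2]] := Gs I Z1 eps Z1t e0.
exists Z2; split => //; first by move=> u /Z21/Z1Z.
move=> u uZ u1 g [i]; rewrite ltnS leq_eqVlt => /orP[/eqP ->|iI] Gg; first exact: h2 Gg.
by apply: h1 => //; [exact: Z21 | exists i].
Qed.

(* Gliding hump: sum up the smallness of a fast sequence of blocks. *)
Lemma refine (G : (nat -> R) -> Prop) :
  (forall Z M (eps : R), tailful Z -> 0 < eps -> exists u, [/\ Z u, low u M, nb u 1,
     exists2 f, inK f & half <= ap f u & forall g, G g -> `|ap g u| <= eps]) ->
  smallable G.
Proof.
move=> hG Z eps Zt e0; have [Zs _ ZT] := Zt.
have [|S [u [S0 Sm su hu]]] := @pick_seq R (fun M b u => [/\ Z u, nb u 1,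
    exists2 f, inK f & half <= ap f u & forall g, G g -> `|ap g u| <= eps * half ^+ M.+2]) 0%N.
  move=> M; have em : 0 < eps * half ^+ M.+2 by rewrite mulr_gt0 // halfX_gt0.
  have [u [Zu lu u1 hf gu]] := hG Z M _ Zt em.
  exists (maxn M (size u)), u; rewrite leq_maxl; split => //.
  by apply: suppW (low_supp lu) => //; exact: leq_maxr.
have uf k : exists2 f, inK f & half <= ap f (u k) by case: (hu k).
have grow := blocks_grow S0 su uf.
have Z1Z x : bspan u x -> Z x.
  move=> [a [N [_ ->]]]; apply: subsp_sum => // k _; case: Zs => _ _; apply.
  by case: (hu k).
exists (bspan u); split => //.
- split; [exact: bspan_subsp| |by move=> x /Z1Z/ZT].
  move=> M; have [uM Sk] := grow M; exists (u M); split => //; first exact: bspan_nth.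
  by apply: lowW Sk (supp_low (su M)).
move=> x [a [N [aN xE]]] x1 g Gg; rewrite xE in x1.
rewrite xE ap_sum; apply: (le_trans (ler_norm_sum _ _ _)).
apply: le_trans (_ : eps * \sum_(k < N) half ^+ k.+1 <= _); last first.
  by rewrite ler_piMr ?geo_le // ltW.
rewrite big_mkord mulr_sumr; apply: ler_sum => k _; rewrite apZ normrM.
have [_ _ _ /(_ g Gg) gk] := hu k; have ak := bspan_coef Sm su (uf k) (ltn_ord k) x1.
apply: (le_trans (ler_pM _ _ ak gk)) => //.
have -> : 2 * 1 * (eps * half ^+ (S k).+2) = eps * half ^+ (S k).+1.
  by rewrite (exprS _ (S k).+1) /half; field.
rewrite ler_wpM2l ?(ltW e0) //; apply: ler_wiXn2l; [rewrite /half; lra|rewrite /half; lra|].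
by rewrite ltnS; case: (grow k).
Qed.

(** Each block meets finitely many children of [s], and all later blocks are chosen small on these.
    A functional living below one child sees at most one block in full and the remaining sum up to
    [eps]. *)
Lemma block_sums s : (forall i, smallable (gsub (rcons s i))) ->
  forall L Z M (eps : R), tailful Z -> 0 < eps -> exists u b, [/\ (M <= b)%N, supp u M b, Z u, nb u L%:R &
    (exists2 h, succ L M b h & half * L%:R <= ap h u) /\
    forall i g, gsub (rcons s i) g -> `|ap g u| <= 1 + eps].
Proof.
move=> hs; elim=> [|L IH] Z M eps Zt e0; have [Zs Zl ZT] := Zt.
  exists 0, M; split => //.
  - by move=> n; rewrite coef0 eqxx.
  - by case: Zs.
  - by move=> f _; rewrite ap0 normr0.
  - split; last by move=> i g _; rewrite ap0 normr0; lra.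
    exists (fun=> 0); last by rewrite ap0 mulr0.
    exists (fun=> M), (fun _ => fun=> 0); split => //.
    by apply: funext => n; rewrite big_ord0.
have [v [Zv lv v0]] := Zl M; have [a [nz [f fK hf]]] := normalize v0.
set z := a *: v in nz hf.
have Zz : Z z by case: Zs => _ _; apply.
pose b0 := maxn M (size v).
have sz : supp z M b0.
  by apply: suppZ; apply: suppW (low_supp lv) => //; exact: leq_maxr.
(* For a node strictly below [s], the entry at position [size s] names the child it passes through;
   [I] exceeds all those met by [z]. *)
pose I := \max_(n < size z) (nth 0%N (nd n) (size s)).+1.
have z0 i g : (I <= i)%N -> gsub (rcons s i) g -> ap g z = 0.
  move=> Ii [_ hg]; apply: ap_eq0 => n zn; apply: contrapT => /eqP /hg /prefixP[t nE].
  have nz' : (n < size z)%N by rewrite ltnNge; apply: contraNN zn => /(nth_default 0) ->.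
  have := @leq_bigmax _ (fun n : 'I_(size z) => (nth 0%N (nd n) (size s)).+1) (Ordinal nz').
  rewrite -/I /= nE cat_rcons nth_cat ltnn subnn /= => h.
  by have := leq_trans h Ii; rewrite ltnn.
have eL : 0 < eps / L.+1%:R by rewrite divr_gt0.
have [Z1 [Z1t Z1Z h1]] := smallable_finite I hs Zt eL.
have [u [b [b0b su Zu nu [[h sh hu] gu]]]] := IH Z1 b0 eps Z1t e0.
have ZDz : Z (z + u) by case: Zs => _ ZD _; apply: ZD => //; exact: Z1Z.
exists (z + u), b; split => //.
- by apply: leq_trans b0b; exact: leq_maxl.
- apply: suppD; first by apply: suppW sz.
  by apply: suppW su => //; exact: leq_maxl.
- move=> g gK; rewrite apD -addn1 natrD addrC.
  by apply: (le_trans (ler_normD _ _)); apply: lerD; [exact: nu | exact: nz].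
split.
  exists (fun n => restr M b0 f n + h n).
    rewrite -add1n; apply: succD sh => //; first exact: leq_maxl.
    apply: succ1; [exact: inK_restr | | exact: leq_maxl].
    by move=> n; rewrite /restr; case: ifP; rewrite ?eqxx.
  rewrite (_ : ap _ _ = ap (restr M b0 f) z + ap h u).
    by rewrite ap_restr // -addn1 natrD mulrDr mulr1; lra.
  rewrite apD; congr (_ + _); apply: eq_ap => n.
    move=> /sz nb0; case: (eqVneq (h n) 0) => [->|/(succ_fsupp sh) nb1]; first by rewrite addr0.
    by move: nb0 nb1; clear; lia.
  by move=> /su nb1; rewrite /restr; case: ifP; [move: nb1; clear; lia | rewrite add0r].
move=> i g hg; rewrite apD; have [iI|Ii] := ltnP i I; last by rewrite (z0 i) // add0r; exact: gu hg.
apply: (le_trans (ler_normD _ _)); apply: lerD.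
  by apply: nz; apply: KK_inK (ground_KK _ _ _ hg.1).
have L0 : 0 < L.+1%:R :> R by [].
have : `|ap g (L.+1%:R^-1 *: u)| <= eps / L.+1%:R.
  apply: h1; last by exists i.
    by case: Z1t => -[_ _ ZZ] _ _; exact: ZZ.
  apply: nbW (nbZ _ nu); rewrite gtr0_norm ?invr_gt0 // mulrC ler_pdivrMr // mul1r.
  by rewrite ler_nat.
by rewrite apZ normrM gtr0_norm ?invr_gt0 // mulrC ler_pM2r ?invr_gt0.
Qed.

(** A chain strictly below [s] runs through a single child, so its value on a sum of [L] blocks is
    at most 2. An even index [j] with [nn j = L] gives that sum norm at least [mu j * L / 2], and
    normalizing makes the value of order [mu j]. *)
Lemma smallable_step s : (forall i, smallable (gsub (rcons s i))) -> smallable (gsub s).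
Proof.
move=> hs; apply: refine => Z M eps Zt e0.
pose j := (2 * (Num.bound (4 / eps)).+1)%N; pose L := nn j.
(* Starting past the index of [s] keeps [s] itself out of the support, so every node met below [s]
   has a next entry. *)
have [Zs _ ZT] := Zt; pose M' := maxn M (pickle s).+1.
have [u [b [Mb su Zu nu [[h sh hu] gu]]]] := block_sums hs L M' Zt ltr01.
have L0 : 0 < L%:R :> R by rewrite ltr0n; apply: leq_ltn_trans (nn_gt j).
have u0 : u != 0.
  apply/eqP => uE; move: hu; rewrite uE ap0; have := half_gt0 R => h0.
  by have := mulr_gt0 h0 L0; lra.
have [a [na fa]] := normalize u0; exists (a *: u); split => //.
- by case: Zs => _ _; apply.
- by apply: supp_low; apply: suppZ; apply: suppW su => //; exact: leq_maxl.
move=> g [gg gs].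
have gu2 : `|ap g u| <= 2.
  have [[n [un gn]]|none] := pselect (exists n, u`_n != 0 /\ g n != 0); last first.
    rewrite ap_eq0 ?normr0 // => n un; apply: contrapT => /eqP gn; apply: none; by exists n.
  have ext m : u`_m != 0 -> g m != 0 -> exists i t, nd m = rcons s i ++ t.
    move=> um gm; have [s' _ mE] := ZT _ Zu m um.
    have sm : (pickle s < m)%N by have := su m um; rewrite /M'; clear; lia.
    have /prefixP[[|i t] nE] := gs m gm; last by exists i, t; rewrite cat_rcons.
    by move: sm; rewrite mE; move: nE; rewrite /nd mE pickleK /= cats0 => ->; rewrite ltnn.
  have [i [t nE]] := ext n un gn.
  pose g' m := if prefix (rcons s i) (nd m) then g m else 0.
  have gg' : gsub (rcons s i) g'.
    case: gg => g1 [B g2] g3; split; last by move=> m; rewrite /g'; case: ifP; rewrite ?eqxx.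
    split.
    - by move=> m; rewrite /g'; case: ifP => _; [exact: g1 | exact: Or31].
    - by exists B => m /g2; rewrite /g' => ->; case: ifP.
    - move=> m m'; rewrite /g'; case: ifP => _; rewrite ?eqxx //; case: ifP => _; rewrite ?eqxx //.
      exact: g3.
  rewrite (_ : ap g u = ap g' u).
    by have := gu i g' gg'; lra.
  apply: eq_ap => m um; rewrite /g'; case: ifP => // hm.
  apply: contrapT => /eqP gm; have [i' [t' mE]] := ext m um gm.
  have ii : i' = i.
    case: gg => _ _ /(_ n m gn gm); rewrite /cmp nE mE => /orP[] /prefixP[r] /eqP.
      by rewrite !cat_rcons -catA eqseq_cat // => /andP[_ /eqP[]].
    by rewrite !cat_rcons -catA eqseq_cat // => /andP[_ /eqP[]].
  by move: hm; rewrite mE ii prefix_prefix.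
have mj := mu_gt0 R e j.
have := na _ (KK_inK (succ_KK _ (leqnn _) sh)); rewrite /j oddM -/j => /(_ isT).
rewrite apZ ap_scalel normrM => h1.
have h2 : `|a| * (mu j * (half * L%:R)) <= 1.
  apply: le_trans h1; rewrite ler_wpM2l // normrM (gtr0_norm mj) ler_wpM2l ?(ltW mj) //.
  by apply: (le_trans hu); exact: ler_norm.
have h3 : 1 <= L%:R * mu j ^+ 2.
  apply: le_trans (_ : L.-1%:R * mu j ^+ 2 <= _).
    apply: le_trans (nn_pred_big (_ : 0 < j)%N) => //.
    by rewrite exprn_ege1 // ler1n; apply: leq_ltn_trans (nn_gt _).
  by apply: ler_wpM2r; [rewrite exprn_ge0 // ltW | rewrite ler_nat leq_pred].
have h4 : `|a| <= 2 * mu j.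
  have := ler_wpM2l (normr_ge0 a) h3; rewrite mulr1 => h5; apply: (le_trans h5).
  have := ler_wpM2r (ltW mj) h2; rewrite /half expr2; lra.
have h5 : 4 * mu j <= eps.
  have h6 : 4 / eps <= j%:R.
    apply: ltW; apply: lt_le_trans (archi_boundP _) _; first by rewrite divr_ge0 // ltW.
    by rewrite ler_nat /j; clear; lia.
  rewrite ler_pdivrMr // in h6.
  have := ler_wpM2r (ltW mj) h6; have := ler_wpM2l (ltW e0) (mu_inv j); lra.
rewrite apZ normrM; have := ler_pM (normr_ge0 _) (normr_ge0 _) h4 gu2; lra.
Qed.

(** If the functionals below the root could not be made small, the failure would pass from node to
    child forever. The sequence so traced leaves [T] at some node, and below that node vectors of
    [Z] have no coordinates, so smallness is trivial there. *)
Theorem tree_small Z : tailful Z -> small_vec Z.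
Proof.
move=> Zt; have sm : smallable (gsub [::]).
  apply: contrapT => nsm.
  have /choice[nx hnx] : forall s, exists i, ~ smallable (gsub s) -> ~ smallable (gsub (rcons s i)).
    move=> s; have [h|/existsNP[i hi]] := pselect (forall i, smallable (gsub (rcons s i))).
      by exists 0%N => /(_ (smallable_step h)).
    by exists i.
  pose st k := iter k (fun s => rcons s (nx s)) [::].
  apply: T_wf; exists (fun k => nx (st k)) => n.
  have -> : mkseq (fun k => nx (st k)) n = st n.
    by elim: n => // n IH; rewrite mkseqS IH.
  have : ~ smallable (gsub (st n)) by elim: n => // n IH; exact: hnx.
  move=> h; apply: contrapT => nT; apply: h => Z' eps [Z's Z'l Z'T] e0.
  exists Z'; split => // u Zu _ g [_ gs]; rewrite ap_eq0 ?normr0 ?(ltW e0) // => m um.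
  have [s' Ts' mE] := Z'T _ Zu m um; apply: contrapT => /eqP /gs.
  by rewrite /nd mE pickleK /= => /T_prefix/(_ Ts').
move=> M eps e0; have [Z1 [[Z1s Z1l _] Z1Z h1]] := sm Z eps Zt e0.
have [u [Zu lu u0]] := Z1l M; have [a [na fa]] := normalize u0.
have Za : Z1 (a *: u) by case: Z1s => _ _; apply.
exists (a *: u); split => //; first exact: Z1Z.
  by move=> n nM; rewrite coefZ lu ?mulr0.
by move=> g gg; apply: h1 => //; split => // n _; rewrite prefix0s.
Qed.
End Trees.

(** * Embedding in C(Delta) *)

Definition agree (T : Type) (N : nat) (s t : nat -> T) := forall i, (i < N)%N -> s i = t i.

Lemma agreeW T N N' (s t : nat -> T) : (N <= N')%N -> agree N' s t -> agree N s t.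
Proof. by move=> NN h i iN; apply: h; exact: leq_trans NN. Qed.

Lemma agree_sym T N (s t : nat -> T) : agree N s t -> agree N t s.
Proof. by move=> h i /h. Qed.

Lemma agree_trans T N (s t u : nat -> T) : agree N s t -> agree N t u -> agree N s u.
Proof. by move=> h h' i iN; rewrite h // h'. Qed.

(** Read off from the growth conditions: [e' = 2 * e + n + 1] gives the first because [n <= 2 ^ n],
    and [n'] is one more than the number that turns the second into an equality. *)
Fixpoint params j : nat * nat := if j is j'.+1 then
  let: (e, n) := params j' in let e' := (2 * e + n).+1 in
  (e', (2 ^ (2 * e') * n ^ (2 * e' + 2)).+1)%N else (1, 1)%N.
Definition pe j := (params j).1.
Definition pn j := (params j).2.

Lemma peS j : pe j.+1 = (2 * pe j + pn j).+1.
Proof. by rewrite /pe /pn /=; case: (params j). Qed.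

Lemma pnS j : pn j.+1 = (2 ^ (2 * pe j.+1) * pn j ^ (2 * pe j.+1 + 2)).+1.
Proof. by rewrite peS /pe /pn /=; case: (params j). Qed.

Lemma pe_gt j : (j < pe j)%N.
Proof. by elim: j => // j IH; rewrite peS; lia. Qed.

Lemma pn_lt j : (0 < pn j)%N && (pn j < pn j.+1)%N.
Proof.
have n0 : (0 < pn j)%N by case: j => // j; rewrite pnS.
rewrite n0 pnS ltnS -[leqLHS]mul1n; apply: leq_mul; first by rewrite expn_gt0.
by rewrite -[leqLHS]expn1; apply: leq_pexp2l => //; lia.
Qed.

Lemma pn_gt j : (j < pn j)%N.
Proof. by elim: j => // j IH; case/andP: (pn_lt j) => _; apply: leq_trans. Qed.

Lemma pe_mono : {homo pe : i j / (i <= j)%N}.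
Proof. by apply: homo_leq => //; [exact: leq_trans | move=> j; rewrite peS; lia]. Qed.

Lemma pn_mono : {homo pn : i j / (i <= j)%N}.
Proof.
by apply: homo_leq => //; [exact: leq_trans | move=> j; case/andP: (pn_lt j) => _ /ltnW].
Qed.

Section Coding.
Variable R : realType.
Local Notation mu := (mu R pe).
Local Notation half := (half R).

Lemma pmu_nn j : mu j.+1 * (pn j)%:R <= mu j ^+ 2.
Proof.
have h0 : 0 < half := half_gt0 R.
have -> : mu j.+1 = mu j ^+ 2 * (half ^+ pn j * half).
  by rewrite /mu peS -exprSr -exprM -exprD mulnC addnS.
rewrite -mulrA ler_piMr ?exprn_ge0 ?(ltW (mu_gt0 _ _ _)) // mulrAC.
have : half ^+ pn j * (pn j)%:R <= 1.
  by rewrite /half exprVn mulrC ler_pdivrMr ?exprn_gt0 // mul1r -natrX ler_nat ltnW // ltn_expl.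
by rewrite /half; lra.
Qed.

Lemma pnn_big j :
  (pn j)%:R ^+ (2 * pe j.+1 + 2) <= (pn j.+1).-1%:R * mu j.+1 ^+ 2 :> R.
Proof.
rewrite pnS /= natrM !natrX /mu -exprM [(pe j.+1 * 2)%N]mulnC.
by rewrite mulrAC -exprMn divff // expr1n mul1r.
Qed.

(* All norming functionals have coefficients 0 or a signed power of 1/2. *)
Definition valof (o : option (bool * nat)) : R := if o is Some (b, k) then (-1) ^+ b * half ^+ k else 0.

Definition dy (f : nat -> R) := exists s, f = fun n => valof (nth None s n).

Definition code (f : nat -> R) : nat :=
  if pselect (dy f) is left h then pickle (projT1 (cid h)) else 0%N.

Lemma code_inj f g : dy f -> dy g -> code f = code g -> f = g.
Proof.
move=> df dg; rewrite /code; case: pselect => // h1; case: pselect => // h2.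
case: (cid h1) => s /= ->; case: (cid h2) => s' /= -> ss.
by have /(_ _ _ ss) -> := pcan_inj (@pickleK (seq (option (bool * nat)))).
Qed.

(** The factor 2 makes the weight even, the summand [j] makes it exceed [j], and [pickle] keeps the
    history recoverable. *)
Definition csigma j (s : seq (nat -> R)) := (2 * (j + pickle (map code s)).+1)%N.

Local Notation inK := (@inK R cmp pe pn csigma).

(** Supports of the terms of a node are disjoint: at each coordinate a node multiplies one earlier
    value by a power of 1/2 and never adds. *)
Lemma inK_valof f n : inK f -> exists o, f n = valof o.
Proof.
move=> fK; elim/inK_ind: f / fK => [f [/(_ n) + _ _]|j d c F a b _ bl _ IH _].
  case=> ->; [by exists None | exists (Some (false, 0%N)) | exists (Some (true, 0%N))];
    by rewrite /= expr0 mulr1.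
rewrite /node /restr; case: ifP => _; last by exists None.
have [->|[l /IH[v fv] ->]] := blocks_sum_eq n bl; first by exists None; rewrite mulr0.
rewrite fv; case: v {fv} => [[s k]|]; last by exists None; rewrite mulr0.
by exists (Some (s, pe j + k)%N); rewrite /= exprD mulrCA.
Qed.

Lemma inK_dy f : inK f -> dy f.
Proof.
move=> fK; have [M fM] := inK_fin fK.
have /choice[v hv] : forall n, exists o, f n = valof o by move=> n; exact: inK_valof.
exists (mkseq v M); apply: funext => n; have [nM|Mn] := ltnP n M.
  by rewrite nth_mkseq // hv.
by rewrite nth_default ?size_mkseq // fM.
Qed.

Lemma csigma_even j s : ~~ odd (csigma j s). Proof. by rewrite /csigma oddM. Qed.

Lemma csigma_gt j s : (j < csigma j s)%N. Proof. by rewrite /csigma; lia. Qed.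

Lemma csigma_inj j (F G : nat -> nat -> R) k l :
  (forall i, (i < k)%N -> inK (F i)) -> (forall i, (i < l)%N -> inK (G i)) ->
  csigma j (mkseq F k) = csigma j (mkseq G l) -> mkseq F k = mkseq G l.
Proof.
move=> FK GK h.
have {}h : map code (mkseq F k) = map code (mkseq G l).
  by apply: (pcan_inj pickleK); move: h; rewrite /csigma; lia.
have kl : k = l by have := congr1 size h; rewrite !size_map !size_iota.
subst l; apply: (@eq_from_nth _ (fun=> 0)); rewrite !size_mkseq // => i ik.
rewrite !nth_mkseq //; apply: code_inj; [exact: inK_dy (FK i ik)| exact: inK_dy (GK i ik)|].
have := congr1 (fun s => nth 0%N s i) h.
by rewrite !(nth_map (fun=> 0)) ?size_mkseq // !nth_mkseq.
Qed.

(* Bit [(n, 0)] of a point of the Cantor set is a sign, the bits [(n, k+1)] are a unary exponent. *)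
Definition bit (t : nat -> bool) (n k : nat) := t (pickle (n, k)).

Definition dec (t : nat -> bool) n : R :=
  if pselect (exists k, bit t n k.+1) is left h then (-1) ^+ bit t n 0 * half ^+ (ex_minn h) else 0.

Definition is_code (t : nat -> bool) (f : nat -> R) := inK f /\ forall n, dec t n = f n.

Lemma code_exists f : inK f -> exists t, is_code t f.
Proof.
move=> fK; have /choice[v hv] : forall n, exists o, f n = valof o by move=> n; exact: inK_valof.
pose t i := if unpickle i is Some (n, k) then
  if v n is Some (b, l) then if k is k'.+1 then k' == l else b else false else false.
have tE n k : bit t n k = if v n is Some (b, l) then if k is k'.+1 then k' == l else b else false.
  by rewrite /bit /t pickleK.
exists t; split => // n; rewrite hv /dec; case: pselect => h.
  case: (ex_minnP h) => k + _; rewrite !tE; case: (v n) => [[b l]|//] /eqP ->; by [].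
case vn : (v n) => [[b l]|//]; case: h; exists l; by rewrite tE vn.
Qed.

(** Either both points show the same first exponent bit, hence the same value, or neither shows one
    below [k] and both values are at most [2 ^ -k]. *)
Lemma dec_agree n k (t t' : nat -> bool) : (forall l, (l <= k)%N -> bit t n l = bit t' n l) ->
  `|dec t n - dec t' n| <= half ^+ k * 2.
Proof.
move=> h; have h0 := half_gt0 R.
have le l : (k <= l)%N -> forall b : bool, `|(-1) ^+ b * half ^+ l| <= half ^+ k.
  move=> kl b; rewrite normrM normr_sign mul1r gtr0_norm ?exprn_gt0 //.
  by apply: ler_wiXn2l => //; rewrite /half; lra.
have big t0 : (forall l, (l < k)%N -> ~~ bit t0 n l.+1) -> `|dec t0 n| <= half ^+ k.
  move=> ht; rewrite /dec; case: pselect => [ex|_]; last by rewrite normr0 exprn_ge0 // ltW.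
  apply: le; case: (ex_minnP ex) => l bl _; rewrite leqNgt; apply/negP => /ht; by rewrite bl.
have [[l lk bl]|no] := pselect (exists2 l, (l < k)%N & bit t n l.+1); last first.
  have no1 l : (l < k)%N -> ~~ bit t n l.+1 by move=> lk; apply/negP => bl; apply: no; exists l.
  apply: (le_trans (ler_normB _ _)); rewrite mulr_natr mulr2n; apply: lerD; apply: big => // l lk.
  by rewrite -h // no1.
suff -> : dec t n = dec t' n by rewrite subrr normr0 mulr_ge0 // exprn_ge0 // ltW.
rewrite /dec h //; case: pselect => [ex|nex]; last by case: nex; exists l.
case: pselect => [ex'|nex]; last by case: nex; exists l; rewrite -h.
congr (_ * half ^+ _); case: (ex_minnP ex) => m bm mm; case: (ex_minnP ex') => m' bm' mm'.
have ml := mm l bl; have ml' : (m' <= l)%N by apply: mm'; rewrite -h.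
apply/eqP; rewrite eqn_leq mm ?mm' // ?h // -?h //; exact: leq_ltn_trans lk.
Qed.

Definition extendible (w : seq bool) := exists t f, is_code t f /\ forall i, (i < size w)%N -> t i = nth false w i.

(* Greedy retraction onto the closed set of codes: copy a bit if the prefix still extends to a code. *)
Fixpoint retr (t : nat -> bool) n : seq bool := if n is n'.+1 then
  let w := retr t n' in rcons w (if `[< extendible (rcons w (t n')) >] then t n' else ~~ t n') else [::].

Lemma size_retr t n : size (retr t n) = n.
Proof. by elim: n => //= n IH; rewrite size_rcons IH. Qed.

(** A prefix of a code is continued to one by at least one of the two bits, so the greedy choice
    never gets stuck. *)
Lemma retr_ext t n : extendible (retr t n).
Proof.
elim: n => [|n /= [c [f [cf hc]]]].
  have [c cf] := code_exists (dual_inK pe pn csigma 0); exists c, (dual R 0); split => //.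
case: asboolP => // nx; exists c, f; split => // i; rewrite size_rcons ltnS leq_eqVlt => /orP[/eqP iE|il].
  have [cE|cE] := eqVneq (c i) (t n); last first.
    rewrite iE nth_rcons ltnn eqxx; move: cE; rewrite iE; by case: (c _) (t n) => -[].
  case: nx; exists c, f; split => // j; rewrite size_rcons ltnS leq_eqVlt => /orP[/eqP jE|jl].
    by rewrite jE nth_rcons ltnn eqxx -iE.
  by rewrite nth_rcons jl hc.
by rewrite nth_rcons il hc.
Qed.

Definition ret t : nat -> bool := fun n => nth false (retr t n.+1) n.

Lemma nth_retr t n i : (i < n)%N -> nth false (retr t n) i = ret t i.
Proof.
elim: n => // n IH; rewrite ltnS leq_eqVlt => /orP[/eqP ->//|il] /=.
by rewrite nth_rcons size_retr il IH.
Qed.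

Lemma ret_id t f : is_code t f -> ret t = t.
Proof.
move=> tf; suff h n : retr t n = mkseq t n.
  by apply: funext => n; rewrite /ret h nth_mkseq.
elim: n => // n IH; rewrite /= IH mkseqS; congr rcons; case: asboolP => // -[].
exists t, f; split => // i; rewrite -mkseqS size_mkseq => il; by rewrite nth_mkseq.
Qed.

Lemma retr_agree n t t' : agree n t t' -> retr t n = retr t' n.
Proof.
elim: n => // n IH h /=; rewrite IH; last by apply: agreeW h.
by rewrite (h n).
Qed.

Definition phi n (t : nat -> bool) : R := dec (ret t) n.

Lemma phi_point f : inK f -> exists t, forall n, phi n t = f n.
Proof. by move=> /code_exists[t tf]; exists t => n; rewrite /phi (ret_id tf); case: tf. Qed.

Lemma halfX_small (eps : R) : 0 < eps -> exists k, half ^+ k * 2 <= eps.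
Proof.
move=> e0; exists (Num.bound (2 / eps)).
have h1 : 2 / eps <= 2 ^+ Num.bound (2 / eps).
  apply: ltW; apply: lt_le_trans (archi_boundP _) _; first by rewrite divr_ge0 // ltW.
  by rewrite -natrX ler_nat ltnW // ltn_expl.
rewrite ler_pdivrMr // in h1; rewrite /half exprVn mulrC ler_pdivrMr ?exprn_gt0 //.
by rewrite mulrC.
Qed.

Lemma phi_ucont n (eps : R) : 0 < eps -> exists N, forall t t', agree N t t' -> `|phi n t - phi n t'| <= eps.
Proof.
move=> /halfX_small[k hk]; exists (\max_(l < k.+1) pickle (n, val l)).+1 => t t' tt.
apply: le_trans hk; apply: dec_agree => l lk; rewrite /bit /ret.
have li : (l < k.+1)%N by [].
have := leq_bigmax (F := fun l : 'I_k.+1 => pickle (n, val l)) (Ordinal li) => h.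
by rewrite (@retr_agree (pickle (n, l)).+1 t t') //; apply: agreeW tt.
Qed.

(** The retraction may end in a limit of codes instead of a code; on finitely many coordinates it is
    still approximated by a norming functional, so such points do not increase the norm. *)
Lemma phi_near t N (eps : R) : 0 < eps ->
  exists2 f, inK f & forall n, (n < N)%N -> `|phi n t - f n| <= eps.
Proof.
move=> /halfX_small[k hk].
pose M := (\max_(n < N) \max_(l < k.+1) pickle (val n, val l)).+1.
have [c [f [[fK cf] hc]]] := retr_ext t M; exists f => // n nN.
rewrite -cf; apply: le_trans hk; apply: dec_agree => l lk; rewrite /bit.
have li : (l < k.+1)%N by [].
have h1 := leq_bigmax (F := fun l : 'I_k.+1 => pickle (n, val l)) (Ordinal li).
have h2 := leq_bigmax (F := fun n : 'I_N => \max_(l < k.+1) pickle (val n, val l)) (Ordinal nN).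
have h3 : (pickle (n, l) < M)%N by rewrite /M ltnS; exact: leq_trans h1 h2.
by rewrite hc ?size_retr // nth_retr.
Qed.
End Coding.

Import numFieldNormedType.Exports.
Local Open Scope classical_set_scope.
Local Notation R := Rdefinitions.R.

(** * Continuity on the Cantor space in terms of cylinders *)

Definition cyl (N : nat) (t : cantor_space) : set cantor_space :=
  [set t' | agree N (t : nat -> bool) t'].

Lemma nbhs_cyl N t : nbhs t (cyl N t).
Proof.
elim: N => [|N IH].
  have -> : cyl 0 t = setT by apply/seteqP; split => // t' _ i.
  exact: filterT.
have h : nbhs t [set t' : cantor_space | (t' : nat -> bool) N = (t : nat -> bool) N].
  apply: (@proj_continuous nat (fun=> bool) N t [set b | b = (t : nat -> bool) N]).
  exact: (@discrete_set1 bool).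
apply: filterS (filterI IH h) => t' [h1 h2] i; rewrite ltnS leq_eqVlt => /orP[/eqP ->//|].
exact: h1.
Qed.

Lemma cyl_base t (U : set cantor_space) : nbhs t U -> exists N, cyl N t `<=` U.
Proof.
pose F := filter_from [set: nat] (fun N => cyl N t).
have FF : Filter F.
  apply: filter_from_filter; first by exists 0%N.
  move=> i j _ _; exists (maxn i j) => // t' h; split.
    by apply: agreeW h; exact: leq_maxl.
  by apply: agreeW h; exact: leq_maxr.
suff h : F --> t by move=> /h[N _ NU]; exists N.
apply/cvg_sup => i; apply/cvg_image => //.
  apply/seteqP; split => // b _; exists (fun=> b) => //.
move=> U0 /= hU; have {}hU : U0 ((t : nat -> bool) i) by exact: nbhs_singleton.
exists ((fun t' : nat -> bool => t' i) @^-1` U0).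
  exists i.+1 => // t' ht /=; have := ht i (ltnSn i); move=> <- //.
apply/seteqP; split => [b [t' h <-] //|b hb]; by exists (fun=> b).
Qed.

(** Compactness makes continuity uniform; from here on it is used only in this form. *)
Lemma in_CDeltaP (f : CDelta) : in_CDelta f <-> forall eps : R, 0 < eps ->
  exists N, forall t t' : cantor_space, agree N (t : nat -> bool) t' -> `|f t - f t'| <= eps.
Proof.
split => [fc eps e0|h t]; last first.
  apply/(@cvgrPdist_le R R^o cantor_space (nbhs t) _ f (f t)) => eps e0; have [N hN] := h eps e0.
  by apply: filterS (nbhs_cyl N t) => t'; exact: hN.
have loc (t : cantor_space) : exists N, forall t' : cantor_space, agree N (t : nat -> bool) t' -> `|f t - f t'| <= eps / 2.
  have /(@cvgrPdist_le R R^o cantor_space (nbhs t) _ f (f t))/(_ (eps / 2)) := fc t.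
  by move=> /(_ (divr_gt0 e0 (ltr0Sn _ 1)))/cyl_base.
have cc := cantor_space_compact; rewrite compact_near_coveringP in cc.
have := cc nat \oo (fun N t => forall t' : cantor_space, agree N (t : nat -> bool) t' -> `|f t - f t'| <= eps) _ _.
move=> [|N _ hN].
  move=> t _; have [N hN] := loc t.
  exists (cyl N t, [set n | (N <= n)%N]); first by split; [exact: nbhs_cyl | exists N].
  move=> [t1 n] /= [h1 Nn] t2 h2.
  have -> : f t1 - f t2 = (f t - f t2) - (f t - f t1) by ring.
  apply: (le_trans (ler_normB _ _)); rewrite [leRHS](splitr eps); apply: lerD; apply: hN => //.
  by apply: agree_trans h1 (agreeW Nn h2).
by exists N => t t'; exact: (hN N (leqnn N) t I).
Qed.

(** * Closed subspaces of C(Delta) *)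

Section Subspaces.
Implicit Types (f g h u v w y z : CDelta) (X Y Z W : set CDelta) (c : nat -> R).

Definition nbf f (C : R) := forall t, `|f t| <= C.
Definition dist_le f g (C : R) := forall t, `|f t - g t| <= C.

Lemma dist_sym f g C : dist_le f g C -> dist_le g f C.
Proof. by move=> h t; rewrite distrC. Qed.

Lemma dist_trans f g h C D : dist_le f g C -> dist_le g h D -> dist_le f h (C + D).
Proof.
move=> h1 h2 t; have -> : f t - h t = (f t - g t) + (g t - h t) by ring.
by apply: (le_trans (ler_normD _ _)); apply: lerD.
Qed.

Lemma nbf_dist f g C D : nbf f C -> dist_le f g D -> nbf g (C + D).
Proof.
move=> h1 h2 t; have -> : g t = f t - (f t - g t) by ring.
by apply: (le_trans (ler_normB _ _)); apply: lerD.
Qed.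

Lemma nbfW f C D : C <= D -> nbf f C -> nbf f D.
Proof. by move=> CD h t; apply: le_trans CD. Qed.

Lemma nbf_ge0 f C : nbf f C -> 0 <= C.
Proof. by move=> h; apply: le_trans (h point). Qed.

Lemma nbf_lim f C : (forall e : R, 0 < e -> nbf f (C + e)) -> nbf f C.
Proof. by move=> h t; apply/ler_addgt0Pr => e e0; apply: h. Qed.

Lemma in_CDelta_lim f : (forall e : R, 0 < e -> exists2 g, in_CDelta g & dist_le f g e) -> in_CDelta f.
Proof.
move=> h; apply/in_CDeltaP => e e0; have e4 : 0 < e / 4 by rewrite divr_gt0.
have [g /in_CDeltaP/(_ _ e4)[N hN] fg] := h _ e4; exists N => t t' tt.
have -> : f t - f t' = (f t - g t) + (g t - g t') - (f t' - g t') by ring.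
apply: (le_trans (ler_normB _ _)); have := ler_normD (f t - g t) (g t - g t').
have := fg t; have := fg t'; have := hN t t' tt; lra.
Qed.

Lemma in_CDelta_comb f g (a b : R) : in_CDelta f -> in_CDelta g -> in_CDelta (fun t => a * f t + b * g t).
Proof.
move=> /in_CDeltaP fc /in_CDeltaP gc; apply/in_CDeltaP => e e0.
have K0 : 0 < `|a| + `|b| + 1 by rewrite ltr_wpDl // addr_ge0.
have d0 : 0 < e / (`|a| + `|b| + 1) by rewrite divr_gt0.
have [N hN] := fc _ d0; have [N' hN'] := gc _ d0; exists (maxn N N') => t t' tt.
have h1 := hN t t' (agreeW (leq_maxl _ _) tt); have h2 := hN' t t' (agreeW (leq_maxr _ _) tt).
have -> : a * f t + b * g t - (a * f t' + b * g t') = a * (f t - f t') + b * (g t - g t') by ring.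
apply: (le_trans (ler_normD _ _)); rewrite !normrM.
have h3 := ler_wpM2l (normr_ge0 a) h1; have h4 := ler_wpM2l (normr_ge0 b) h2.
apply: (le_trans (lerD h3 h4)); rewrite -mulrDl mulrCA ler_piMr ?(ltW e0) //.
by rewrite ler_pdivrMr // mul1r; lra.
Qed.

Lemma in_CDelta_cst (a : R) : in_CDelta (fun=> a).
Proof.
by apply/in_CDeltaP => e e0; exists 0%N => t t' _; rewrite subrr normr0 ltW.
Qed.

Lemma in_CDelta_bounded f : in_CDelta f -> exists C, nbf f C.
Proof.
move=> /in_CDeltaP/(_ 1 ltr01)[N hN].
pose ext (b : N.-tuple bool) : cantor_space := fun i => nth false b i.
exists (1 + \sum_(b : N.-tuple bool) `|f (ext b)|) => t.
pose b : N.-tuple bool := [tuple (t : nat -> bool) i | i < N].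
have tb : `|f t - f (ext b)| <= 1.
  apply: hN => i iN; rewrite /ext (_ : i = Ordinal iN) //.
  by rewrite -tnth_nth tnth_mktuple.
have -> : f t = (f t - f (ext b)) + f (ext b) by ring.
apply: (le_trans (ler_normD _ _)); apply: lerD => //.
by rewrite (bigD1 b) //= lerDl sumr_ge0.
Qed.

(* The limit is the supremum of the lower bounds [f k t - a k]. *)
Lemma cauchy_lim (f : nat -> CDelta) (a : nat -> R) :
  (forall k, in_CDelta (f k)) -> (forall e : R, 0 < e -> exists k, a k <= e) ->
  (forall k l, dist_le (f k) (f l) (a k + a l)) ->
  exists2 g, in_CDelta g & forall k, dist_le (f k) g (a k).
Proof.
move=> fc a0 fa.
pose A t := [set f k t - a k | k in [set: nat]].
have ub t l : ubound (A t) (f l t + a l).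
  by move=> _ [k _ <-]; have := fa k l t; rewrite ler_norml => /andP[]; lra.
have As t : has_sup (A t).
  by split; [exists (f 0%N t - a 0%N); exists 0%N | exists (f 0%N t + a 0%N)].
have h k : dist_le (f k) (fun t => sup (A t)) (a k).
  move=> t; have h1 : f k t - a k <= sup (A t) by apply: ub_le_sup; [exact: (As t).2 | exists k].
  have h2 : sup (A t) <= f k t + a k by apply: ge_sup (ub t k); exact: (As t).1.
  by rewrite ler_norml; apply/andP; split; lra.
exists (fun t => sup (A t)) => //; apply: in_CDelta_lim => e /a0[k ke].
by exists (f k) => // t; apply: le_trans ke; rewrite distrC; exact: h.
Qed.

Section ClosedSubspace.
Variable X : set CDelta.
Hypothesis Xc : closed_subspace X.
Lemma cs_in f : X f -> in_CDelta f. Proof. by case: Xc => h _ _ _ _ /h. Qed.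

Lemma cs0 : X (fun=> 0). Proof. by case: Xc. Qed.

Lemma csD f g : X f -> X g -> X (fun t => f t + g t). Proof. by case: Xc => _ _ h _ _; exact: h. Qed.

Lemma csZ (a : R) f : X f -> X (fun t => a * f t). Proof. by case: Xc => _ _ _ h _; exact: h. Qed.

Lemma csN f : X f -> X (fun t => - f t).
Proof. by move=> Xf; rewrite (_ : (fun t => _) = (fun t => -1 * f t)); [exact: csZ | apply: funext => t; rewrite mulN1r]. Qed.

Lemma csB f g : X f -> X g -> X (fun t => f t - g t). Proof. by move=> Xf /csN; exact: csD. Qed.

Lemma cs_sum (f : nat -> CDelta) n : (forall i, X (f i)) -> X (fun t => \sum_(i < n) f i t).
Proof.
move=> Xf; elim: n => [|n IH].
  by rewrite (_ : (fun t => _) = (fun=> 0)); [exact: cs0 | apply: funext => t; rewrite big_ord0].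
rewrite (_ : (fun t => _) = (fun t => \sum_(i < n) f i t + f n t)); first exact: csD.
by apply: funext => t; rewrite big_ord_recr.
Qed.

Lemma cs_lim f : (forall e : R, 0 < e -> exists2 g, X g & dist_le f g e) -> X f.
Proof.
move=> h; case: (Xc) => Xin _ _ _; apply => //.
by apply: in_CDelta_lim => e /h[g /Xin ? ?]; exists g.
Qed.
End ClosedSubspace.

Definition lcomb n c (f : nat -> CDelta) : CDelta := fun t => \sum_(i < n) c i * f i t.

Lemma cs_lcomb X n c (f : nat -> CDelta) : closed_subspace X -> (forall i, X (f i)) -> X (lcomb n c f).
Proof. by move=> Xc Xf; apply: (@cs_sum X Xc (fun i t => c i * f i t)) => i; apply: csZ. Qed.

Lemma lcomb_widen n n' c (f : nat -> CDelta) : (n <= n')%N ->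
  lcomb n c f = lcomb n' (fun i => if (i < n)%N then c i else 0) f.
Proof.
move=> nn; apply: funext => t; rewrite /lcomb (big_ord_widen n' (fun i => c i * f i t) nn).
by rewrite big_mkcond /=; apply: eq_bigr => i _; case: ifP; rewrite ?mul0r.
Qed.

Lemma lcombD n n' c c' (f : nat -> CDelta) : exists m d, (fun t => lcomb n c f t + lcomb n' c' f t) = lcomb m d f.
Proof.
exists (maxn n n'), (fun i => (if (i < n)%N then c i else 0) + (if (i < n')%N then c' i else 0)).
rewrite (lcomb_widen _ _ (leq_maxl n n')) (lcomb_widen c' _ (leq_maxr n n')).
apply: funext => t; rewrite /lcomb -big_split /=.
by apply: eq_bigr => i _; rewrite mulrDl.
Qed.

Lemma lcombZ n (a : R) c (f : nat -> CDelta) : (fun t => a * lcomb n c f t) = lcomb n (fun i => a * c i) f.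
Proof.
by apply: funext => t; rewrite /lcomb mulr_sumr; apply: eq_bigr => i _; rewrite mulrA.
Qed.

Lemma lcomb_nth n k (f : nat -> CDelta) : (k < n)%N -> lcomb n (fun i => (i == k)%:R) f = f k.
Proof.
move=> kn; apply: funext => t; rewrite /lcomb (bigD1 (Ordinal kn)) //= eqxx mul1r big1 ?addr0 //.
by move=> i /eqP ik; case: eqP => [h|]; rewrite ?mul0r //; case: ik; apply: val_inj.
Qed.

Definition clspan (f : nat -> CDelta) : set CDelta :=
  [set g | forall e : R, 0 < e -> exists n c, dist_le g (lcomb n c f) e].

Lemma in_CDelta_lcomb n c (f : nat -> CDelta) : (forall i, in_CDelta (f i)) -> in_CDelta (lcomb n c f).
Proof.
move=> fc; rewrite /lcomb; elim: n => [|n IH].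
  rewrite (_ : (fun t => _) = (fun=> 0)); first exact: in_CDelta_cst.
  by apply: funext => t; rewrite big_ord0.
rewrite (_ : (fun t => _) = (fun t => 1 * (\sum_(i < n) c i * f i t) + c n * f n t)).
  exact: in_CDelta_comb.
by apply: funext => t; rewrite big_ord_recr mul1r.
Qed.

Lemma clspan_lcomb n c (f : nat -> CDelta) : clspan f (lcomb n c f).
Proof. by move=> e e0; exists n, c => t; rewrite subrr normr0 ltW. Qed.

Lemma clspan_nth (f : nat -> CDelta) i : clspan f (f i).
Proof. by rewrite -(lcomb_nth f (ltnSn i)); exact: clspan_lcomb. Qed.

Lemma clspan_closed (f : nat -> CDelta) : (forall i, in_CDelta (f i)) -> closed_subspace (clspan f).
Proof.
move=> fc; split.
- move=> g hg; apply: in_CDelta_lim => e /hg[n [c h]]; exists (lcomb n c f) => //.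
  exact: in_CDelta_lcomb.
- by move=> e e0; exists 0%N, (fun=> 0) => t; rewrite /lcomb big_ord0 subrr normr0 ltW.
- move=> g h hg hh e e0; have e2 : 0 < e / 2 by rewrite divr_gt0.
  have [n [c h1]] := hg _ e2; have [n' [c' h2]] := hh _ e2.
  have [m [d mE]] := lcombD n n' c c' f; exists m, d; rewrite -mE => t.
  rewrite opprD addrACA (splitr e); apply: (le_trans (ler_normD _ _)); exact: lerD.
- move=> a g hg e e0; have e2 : 0 < e / (`|a| + 1) by rewrite divr_gt0 // ltr_wpDl.
  have [n [c h1]] := hg _ e2; exists n, (fun i => a * c i); rewrite -lcombZ => t.
  rewrite -mulrBr normrM; apply: (le_trans (ler_wpM2l (normr_ge0 a) (h1 t))).
  by rewrite mulrCA ler_piMr ?(ltW e0) // ler_pdivrMr ?mul1r ?ltr_wpDl //; lra.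
- move=> g _ hg e e0; have e2 : 0 < e / 2 by rewrite divr_gt0.
  have [h /(_ _ e2)[n [c h1]] h2] := hg _ e2; exists n, c.
  by rewrite (splitr e); apply: dist_trans h1.
Qed.

Lemma clspan_sub X (f : nat -> CDelta) : closed_subspace X -> (forall i, X (f i)) -> clspan f `<=` X.
Proof.
move=> Xc Xf g hg; apply: (cs_lim Xc) => e /hg[n [c h]]; exists (lcomb n c f) => //.
exact: cs_lcomb.
Qed.

(** [K] bounds the norm of the projection of [Z + W] onto [Z] along [W]. *)
Definition proj_bound Z W (K : R) :=
  forall z w C, Z z -> W w -> nbf (fun t => z t + w t) C -> nbf z (K * C).

Definition sumset Z W : set CDelta := [set y | exists z w, [/\ Z z, W w & y = fun t => z t + w t]].

Definition hpow (k : nat) : R := 2^-1 ^+ k.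

Lemma hpow_gt0 k : 0 < hpow k. Proof. by rewrite exprn_gt0. Qed.

Lemma hpowS k : hpow k = hpow k.+1 + hpow k.+1.
Proof. by rewrite /hpow exprS; lra. Qed.

Lemma hpow_small (e : R) : 0 < e -> exists k, hpow k <= e.
Proof.
move=> e0; exists (Num.bound e^-1); rewrite /hpow exprVn -[leRHS]invrK lef_pV2 ?posrE ?invr_gt0 //.
  apply: ltW; apply: lt_le_trans (archi_boundP _) _; first by rewrite invr_ge0 ltW.
  by rewrite -natrX ler_nat; apply: ltnW; exact: ltn_expl.
Qed.

(** The bound makes the components of a Cauchy sequence of sums Cauchy themselves, so their limits
    give the components of the limit. *)
Lemma sumset_direct Z W K : closed_subspace Z -> closed_subspace W -> 0 <= K -> proj_bound Z W K ->
  closed_subspace (sumset Z W) /\ direct_sum (sumset Z W) Z W.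
Proof.
move=> Zc Wc K0 hK; split; last first.
  split; first by move=> z Zz; exists z, (fun=> 0); split => //; [exact: cs0 | apply: funext => t; rewrite addr0].
  split; first by move=> w Ww; exists (fun=> 0), w; split => //; [exact: cs0 | apply: funext => t; rewrite add0r].
  split; last by move=> y [z [w [? ? ?]]]; exists z, w.
  apply/seteqP; split => [f [Zf Wf]|_ ->]; last by split; exact: cs0.
  apply: funext => t; have := hK f (fun t => - f t) 0 Zf (csN Wc Wf) _ t.
  rewrite mulr0 normr_le0 => h; apply/eqP; apply: h => s; by rewrite subrr normr0.
split.
- move=> _ [z [w [Zz Ww ->]]].
  rewrite (_ : (fun t => _) = (fun t => 1 * z t + 1 * w t)); last by apply: funext => t; ring.
  by apply: in_CDelta_comb; [exact: cs_in Zz | exact: cs_in Ww].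
- by exists (fun=> 0), (fun=> 0); split; [exact: cs0|exact: cs0|apply: funext => t; rewrite addr0].
- move=> _ _ [z [w [Zz Ww ->]]] [z' [w' [Zz' Ww' ->]]].
  exists (fun t => z t + z' t), (fun t => w t + w' t); split; [exact: csD|exact: csD|].
  by apply: funext => t; ring.
- move=> a _ [z [w [Zz Ww ->]]]; exists (fun t => a * z t), (fun t => a * w t).
  by split; [exact: csZ|exact: csZ|apply: funext => t; ring].
move=> y yc hy.
have /choice[z /choice[w zw]] : forall k, exists z w, [/\ Z z, W w & dist_le y (fun t => z t + w t) (hpow k)].
  by move=> k; have [_ [z [w [Zz Ww ->]]] h] := hy _ (hpow_gt0 k); exists z, w.
pose a k := K * hpow k.
have za k l : dist_le (z k) (z l) (a k + a l).
  have [Zk Wk hk] := zw k; have [Zl Wl hl] := zw l; rewrite /a -mulrDr.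
  apply: (hK (fun t => z k t - z l t) (fun t => w k t - w l t)); [exact: csB|exact: csB|].
  move=> t; have := dist_trans (dist_sym hk) hl t; rewrite /= => h.
  by have -> : z k t - z l t + (w k t - w l t) = z k t + w k t - (z l t + w l t) by ring.
have a_small (e : R) : 0 < e -> exists k, a k <= e /\ hpow k <= e.
  move=> e0; have K1 : 0 < K + 1 by rewrite ltr_wpDl.
  have [k hk] := hpow_small (divr_gt0 e0 K1); exists k; rewrite ler_pdivlMr // in hk.
  by have h0 := hpow_gt0 k; have := mulr_ge0 K0 (ltW h0); rewrite /a; split; lra.
have [|||z0 z0c hz] := @cauchy_lim z a.
- by move=> k; case: (zw k) => /(cs_in Zc).
- by move=> e /a_small[k [? _]]; exists k.
- exact: za.
have Zz0 : Z z0.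
  apply: (cs_lim Zc) => e /a_small[k [ke _]]; exists (z k); first by case: (zw k).
  by move=> t; apply: le_trans ke; rewrite distrC; exact: hz.
have Ww0 : W (fun t => y t - z0 t).
  apply: (cs_lim Wc) => e e0; have [k [k1 k2]] := a_small _ (divr_gt0 e0 (ltr0Sn _ 1)).
  have [_ Wk hk] := zw k; exists (w k) => // t.
  have -> : y t - z0 t - w k t = (y t - (z k t + w k t)) + (z k t - z0 t) by ring.
  by apply: (le_trans (ler_normD _ _)); have := hk t; have := hz k t; lra.
by exists z0, (fun t => y t - z0 t); split => //; apply: funext => t; ring.
Qed.

Lemma clspan_proj_bound (z w : nat -> CDelta) K : 0 <= K ->
  (forall n c n' c' C, nbf (fun t => lcomb n c z t + lcomb n' c' w t) C -> nbf (lcomb n c z) (K * C)) ->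
  proj_bound (clspan z) (clspan w) K.
Proof.
move=> K0 hK g h C hg hh ghC; apply: nbf_lim => e e0.
have d0 : 0 < e / (2 * K + 1) by rewrite divr_gt0 //; lra.
have [n [c h1]] := hg _ d0; have [n' [c' h2]] := hh _ d0; set d := e / _ in d0 h1 h2.
have : nbf (fun t => lcomb n c z t + lcomb n' c' w t) (C + (d + d)).
  apply: (nbf_dist ghC) => t; rewrite opprD addrACA.
  by apply: (le_trans (ler_normD _ _)); apply: lerD.
move=> /hK/nbf_dist/(_ (dist_sym h1)); apply: nbfW.
have -> : e = d * (2 * K + 1) by rewrite /d divfK // gt_eqF //; lra.
lra.
Qed.

Definition free_seq (z : nat -> CDelta) := forall n c, z n <> lcomb n c z.

Lemma kernel_vector n (A : nat -> nat -> R) : exists u : nat -> R,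
  (exists2 i, (i <= n)%N & u i != 0) /\ forall j, (j < n)%N -> \sum_(i < n.+1) u i * A i j = 0.
Proof.
pose M : 'M[R]_(n.+1, n) := \matrix_(i, j) A i j.
have : kermx M != 0.
  rewrite -mxrank_eq0 mxrank_ker subn_eq0 -ltnNge; exact: leq_ltn_trans (rank_leq_col M) (ltnSn n).
case/rowV0Pn => v /sub_kermxP vM v0.
have [i vi] : exists i, v 0 i != 0.
  apply: contrapT => /forallNP h; move/eqP: v0; apply; apply/rowP => i; rewrite mxE.
  by apply: contrapT => /eqP; exact: h.
exists (fun k => v 0 (inord k)); split.
  by exists (val i); [have := ltn_ord i | rewrite inord_val].
move=> j jn; have /rowP/(_ (Ordinal jn)) := vM; rewrite !mxE => h; rewrite -[RHS]h.
by apply: eq_bigr => k _; rewrite mxE inord_val.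
Qed.

Lemma free_lcomb (z : nat -> CDelta) n (u : nat -> R) : free_seq z ->
  (exists2 i, (i < n)%N & u i != 0) -> lcomb n u z <> fun=> 0.
Proof.
move=> zf; elim: n => [|n IH] [i il ui] E; first by [].
have [un|un] := eqVneq (u n) 0.
  apply: IH.
    exists i => //; rewrite ltn_neqAle -ltnS il andbT; apply: contraNneq ui => ->; exact/eqP.
  by rewrite -E; apply: funext => t; rewrite /lcomb big_ord_recr /= un mul0r addr0.
apply: (zf n (fun i => - (u i / u n))); apply: funext => t; have := congr1 (fun f => f t) E.
rewrite /lcomb big_ord_recr /= => h; apply: (mulfI un).
rewrite mulr_sumr (eq_bigr (fun i : 'I_n => - (u i * z i t))); last first.
  by move=> k _; rewrite mulrA mulrN mulrCA divff // mulr1 mulNr.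
rewrite sumrN; lra.
Qed.

Lemma free_infinite (z : nat -> CDelta) Z : free_seq z -> (forall i, Z (z i)) -> infinite_dim Z.
Proof.
move=> zf Zz [n [v [_ hv]]].
have /choice[A hA] : forall i, exists a : nat -> R, z i = fun t => \sum_(j < n) a j * v j t.
  move=> i; have [a aE] := hv _ (Zz i); exists (fun j => if insub j is Some k then a k else 0).
  by rewrite aE; apply: funext => t; apply: eq_bigr => j _; rewrite valK.
have [u [[i il ui] hu]] := kernel_vector n A.
apply: (@free_lcomb z n.+1 u zf); first by exists i.
apply: funext => t; rewrite /lcomb.
under eq_bigr => k _ do rewrite hA mulr_sumr.
rewrite exchange_big /= big1 // => j _.
under eq_bigr => k _ do rewrite mulrA.
by rewrite -mulr_suml hu ?mul0r.
Qed.

Definition fspan (s : seq CDelta) : set CDelta :=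
  [set g | exists c : nat -> R, g = lcomb (size s) c (nth (fun=> 0) s)].

Lemma line_closed v : in_CDelta v -> closed_subspace [set g | exists a : R, g = fun t => a * v t].
Proof.
move=> vc; split.
- move=> _ [a ->]; rewrite (_ : (fun t => _) = (fun t => a * v t + 0 * v t)); first exact: in_CDelta_comb.
  by apply: funext => t; ring.
- by exists 0; apply: funext => t; rewrite mul0r.
- by move=> _ _ [a ->] [b ->]; exists (a + b); apply: funext => t; rewrite mulrDl.
- by move=> b _ [a ->]; exists (b * a); apply: funext => t; rewrite mulrA.
move=> y _ hy; have [C vC] := in_CDelta_bounded vc.
have [[t0 vt]|v0] := pselect (exists t0, v t0 != 0); last first.
  exists 0; apply: funext => t; rewrite mul0r; apply/eqP; rewrite -normr_le0.
  apply/ler_addgt0Pr => e e0; rewrite add0r; have [_ [a ->] /(_ t)] := hy e e0.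
  suff -> : v t = 0 by rewrite mulr0 subr0.
  by apply: contrapT => /eqP vt; apply: v0; exists t.
have C0 := nbf_ge0 vC; have vt0 : 0 < `|v t0| by rewrite normr_gt0.
exists (y t0 / v t0); apply: funext => t; apply/eqP; rewrite -subr_eq0 -normr_le0.
have K0 : 0 < 1 + C / `|v t0| by rewrite ltr_pwDl // divr_ge0 // ltW.
apply/ler_addgt0Pr => e e0; rewrite add0r; have [_ [a ->] h] := hy _ (divr_gt0 e0 K0).
set d := e / _ in h; have -> : e = d + d * (C / `|v t0|) by rewrite -[X in X + _]mulr1 -mulrDr divfK // gt_eqF.
have -> : y t - y t0 / v t0 * v t = (y t - a * v t) - (y t0 - a * v t0) / v t0 * v t by field.
apply: (le_trans (ler_normB _ _)); apply: lerD; first exact: h.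
rewrite !normrM normfV -mulrA; have d0 := le_trans (normr_ge0 _) (h t0).
apply: (@le_trans _ _ (d * (`|v t0|^-1 * `|v t|))).
  by apply: ler_wpM2r (h t0); rewrite mulr_ge0 // invr_ge0.
by apply: ler_wpM2l => //; rewrite mulrC; apply: ler_wpM2r; rewrite ?invr_ge0.
Qed.

Lemma closed_dist X v : closed_subspace X -> ~ X v ->
  exists2 d : R, 0 < d & forall g, X g -> exists t, d < `|v t - g t|.
Proof.
move=> Xc Xv; apply: contrapT => h; apply: Xv; apply: (cs_lim Xc) => e e0.
apply: contrapT => h'; apply: h; exists e => // g Xg; apply: contrapT => /forallNP ht.
by apply: h'; exists g => // t; rewrite leNgt; apply/negP.
Qed.

(** Induction on the generators: a new vector bounded by [C] at distance [d] from a closed subspace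
    gives a projection onto its line bounded by [C / d], so [sumset_direct] applies. *)
Lemma fspan_closed s : (forall i, in_CDelta (nth (fun=> 0) s i)) -> closed_subspace (fspan s).
Proof.
elim: s => [_|v s IH hs].
  have -> : fspan [::] = [set g | exists a : R, g = fun t => a * 0].
    apply/seteqP; split => g [a ->]; [exists 0 | exists (fun=> 0)]; apply: funext => t;
      by rewrite /lcomb big_ord0 mulr0.
  exact: (@line_closed (fun=> 0) (@in_CDelta_cst 0)).
have {}IH : closed_subspace (fspan s) by apply: IH => i; exact: (hs i.+1).
have vc : in_CDelta v := hs 0%N.
have consE : fspan (v :: s) = sumset [set g | exists a : R, g = fun t => a * v t] (fspan s).
  apply/seteqP; split => [g [c ->]|_ [_ [_ [[a ->] [c ->] ->]]]].
    exists (fun t => c 0%N * v t), (lcomb (size s) (fun i => c i.+1) (nth (fun=> 0) s)); split.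
    + by exists (c 0%N).
    + by eexists.
    + by apply: funext => t; rewrite /lcomb big_ord_recl.
  exists (fun i => if i is i'.+1 then c i' else a).
  by apply: funext => t; rewrite /lcomb [RHS]big_ord_recl.
have [vs|vs] := pselect (fspan s v).
  rewrite consE (_ : sumset _ _ = fspan s) //; apply/seteqP; split => [_ [_ [w [[a ->] ws ->]]]|w ws].
    by apply: (csD IH) => //; exact: csZ.
  exists (fun t => 0 * v t), w; split => //; [by exists 0 | by apply: funext => t; rewrite mul0r add0r].
have [d d0 hd] := closed_dist IH vs; have [C vC] := in_CDelta_bounded vc.
have C0 := nbf_ge0 vC.
have Cd : 0 <= C / d by rewrite divr_ge0 // ltW.
rewrite consE; apply: (sumset_direct (line_closed vc) IH Cd _).1.
move=> _ w D [a ->] ws hD; have D0 := nbf_ge0 hD.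
have [->|a0] := eqVneq a 0; first by move=> t; rewrite mul0r normr0 mulr_ge0.
have [t ht] := hd (fun t => - a^-1 * w t) (csZ IH _ ws).
have ad : `|a| * d <= D.
  apply: le_trans (hD t); have -> : a * v t + w t = a * (v t - - a^-1 * w t) by field.
  by rewrite normrM ler_wpM2l // ltW.
move=> t'; rewrite normrM; apply: (le_trans (ler_wpM2l (normr_ge0 a) (vC t'))).
have -> : C / d * D = D / d * C by ring.
by apply: ler_wpM2r => //; rewrite ler_pdivlMr.
Qed.

(* Far-apart vectors: these inequalities are closed conditions, unlike linear independence. *)
Definition sep_seq (z : nat -> CDelta) := forall n c, exists t, 1 <= `|z n t - lcomb n c z t|.

Lemma sep_free (z : nat -> CDelta) : sep_seq z -> free_seq z.
Proof. by move=> zs n c E; have [t] := zs n c; rewrite E subrr normr0 ler10. Qed.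

(** Finite spans are closed, so a vector outside has positive distance from them and can be scaled
    to distance at least 1. *)
Lemma infinite_sep Z : closed_subspace Z -> infinite_dim Z ->
  exists z : nat -> CDelta, (forall i, Z (z i)) /\ sep_seq z.
Proof.
move=> Zc Zi.
have step (s : seq CDelta) : exists z, (forall i, Z (nth (fun=> 0) s i)) ->
    Z z /\ forall c, exists t, 1 <= `|z t - lcomb (size s) c (nth (fun=> 0) s) t|.
  have [hs|hs] := pselect (forall i, Z (nth (fun=> 0) s i)); last by exists (fun=> 0).
  have sc : closed_subspace (fspan s) by apply: fspan_closed => i; exact: cs_in (hs i).
  have [v [Zv vs]] : exists v, Z v /\ ~ fspan s v.
    apply: contrapT => h; apply: Zi; exists (size s), (fun i => nth (fun=> 0) s i); split => //.
    move=> f Zf; have [c ->] : fspan s f by apply: contrapT => nf; apply: h; exists f.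
    by exists (fun i => c i).
  have [d d0 hd] := closed_dist sc vs; exists (fun t => d^-1 * v t) => _; split; first exact: csZ.
  move=> c; have [t ht] := hd _ (csZ sc d (ex_intro _ c erefl)); exists t.
  have -> : d^-1 * v t - lcomb (size s) c (nth (fun=> 0) s) t =
     d^-1 * (v t - d * lcomb (size s) c (nth (fun=> 0) s) t) by field; rewrite gt_eqF.
  by rewrite normrM gtr0_norm ?invr_gt0 // mulrC ler_pdivlMr // mul1r ltW.
have [nx hnx] := choice step.
pose st n := iter n (fun s => rcons s (nx s)) [::].
pose z n := nx (st n).
have stE n : st n = mkseq z n by elim: n => // n IH; rewrite mkseqS -IH.
have stZ n i : Z (nth (fun=> 0) (st n) i).
  elim: n i => [|n IH] i; first by rewrite nth_nil; exact: cs0.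
  rewrite /= nth_rcons; case: ltnP => _ //; case: eqP => _; last exact: cs0.
  by case: (hnx (st n) IH).
exists z; split; first by move=> i; case: (hnx (st i) (stZ i)).
move=> n c; have [_ /(_ c)[t ht]] := hnx (st n) (stZ n); exists t.
have sz : size (st n) = n by rewrite stE size_mkseq.
suff E : lcomb (size (st n)) c (nth (fun=> 0) (st n)) t = lcomb n c z t by rewrite -E.
by rewrite sz; apply: eq_bigr => i _; rewrite stE nth_mkseq.
Qed.

Lemma vanishing_vector Z n (p : nat -> cantor_space) : closed_subspace Z -> infinite_dim Z ->
  exists z, [/\ Z z, z <> fun=> 0 & forall i, (i < n)%N -> z (p i) = 0].
Proof.
move=> Zc /(infinite_sep Zc)[z [Zz /sep_free zf]].
have [u [[i il ui] hu]] := kernel_vector n (fun i j => z i (p j)).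
exists (lcomb n.+1 u z); split; [exact: cs_lcomb | | exact: hu].
by apply: free_lcomb => //; exists i.
Qed.

Lemma not_HI_seq X (z w : nat -> CDelta) K : closed_subspace X ->
  (forall i, X (z i)) -> (forall i, X (w i)) -> free_seq z -> free_seq w -> 0 <= K ->
  (forall n c n' c' C, nbf (fun t => lcomb n c z t + lcomb n' c' w t) C -> nbf (lcomb n c z) (K * C)) ->
  ~ hereditarily_indecomposable X.
Proof.
move=> Xc Xz Xw zf wf K0 hK [_]; apply.
have zc i : in_CDelta (z i) := cs_in Xc (Xz i).
have wc i : in_CDelta (w i) := cs_in Xc (Xw i).
have [Yc Yd] := sumset_direct (clspan_closed zc) (clspan_closed wc) K0 (clspan_proj_bound K0 hK).
exists (sumset (clspan z) (clspan w)), (clspan z), (clspan w); split => //.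
- move=> _ [g [h [/(clspan_sub Xc Xz) ? /(clspan_sub Xc Xw) ? ->]]]; exact: csD.
- exact: clspan_closed.
- exact: clspan_closed.
- split => //; [exact: (free_infinite zf (clspan_nth z))|exact: (free_infinite wf (clspan_nth w))].
Qed.

(** * Open mapping argument: a closed direct sum has bounded projections *)

Section OpenMapping.
Variables Y Z W : set CDelta.
Hypotheses (Yc : closed_subspace Y) (Zc : closed_subspace Z) (Wc : closed_subspace W).
Hypothesis dsum : direct_sum Y Z W.

Definition zball n : set CDelta := [set y | exists z w, [/\ Z z, W w, nbf z n%:R & y = fun t => z t + w t]].

Lemma zball_cover y : Y y -> exists n, zball n y.
Proof.
case: dsum => _ [_ [_ h]] /h[z [w [Zz [Ww ->]]]].
have [C zC] := in_CDelta_bounded (cs_in Zc Zz).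
exists (Num.bound C), z, w; split => //; apply: nbfW (zC).
by apply: ltW; apply: archi_boundP; exact: nbf_ge0 zC.
Qed.

(* Baire category by nested balls. *)
Lemma zball_somewhere_dense : exists n y0 (r : R), [/\ 0 < r, Y y0 &
  forall y, Y y -> dist_le y y0 r -> forall e : R, 0 < e -> exists2 y', zball n y' & dist_le y y' e].
Proof.
apply: contrapT => nd.
have step (n : nat) (p : CDelta * R) : exists q : CDelta * R, Y p.1 -> 0 < p.2 ->
    [/\ Y q.1, 0 < q.2, dist_le q.1 p.1 (p.2 / 2), q.2 <= p.2 / 2 &
        forall y, dist_le y q.1 q.2 -> ~ zball n y].
  have [[Yp r0]|np] := pselect (Y p.1 /\ 0 < p.2); last by exists p => ? ?; case: np.
  apply: contrapT => nq; apply: nd; exists n, p.1, (p.2 / 2); split => //; first by rewrite divr_gt0.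
  move=> y Yy yp e e0; apply: contrapT => ny.
  apply: nq; exists (y, Num.min e (p.2 / 2)) => _ _ /=; split => //.
  - by rewrite lt_min e0 divr_gt0.
  - by rewrite ge_min lexx orbT.
  - move=> y' yy' By'; apply: ny; exists y' => // t; rewrite distrC; apply: (le_trans (yy' t)).
    by rewrite ge_min lexx.
have /choice[nx hnx] : forall np : nat * (CDelta * R), exists q : CDelta * R, Y np.2.1 -> 0 < np.2.2 ->
    [/\ Y q.1, 0 < q.2, dist_le q.1 np.2.1 (np.2.2 / 2), q.2 <= np.2.2 / 2 &
        forall y, dist_le y q.1 q.2 -> ~ zball np.1 y].
  by case=> n p; exact: step.
pose p := fix p n := if n is n'.+1 then nx (n', p n') else ((fun=> 0, 1) : CDelta * R).
have good n : Y (p n).1 /\ 0 < (p n).2.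
  elim: n => [|n [h1 h2]]; first by split; [exact: cs0 | exact: ltr01].
  by case: (hnx (n, p n) h1 h2).
have hp n : [/\ dist_le (p n.+1).1 (p n).1 ((p n).2 / 2), (p n.+1).2 <= (p n).2 / 2 &
    forall y, dist_le y (p n.+1).1 (p n.+1).2 -> ~ zball n y].
  by have [h1 h2] := good n; case: (hnx (n, p n) h1 h2).
have rk n : (p n).2 <= hpow n.
  elim: n => [|n IH]; first by rewrite /hpow expr0.
  by have [_ h _] := hp n; have := hpowS n; lra.
have nested k l : dist_le (p (k + l)%N).1 (p k).1 ((p k).2 - (p (k + l)%N).2).
  elim: l => [|l IH]; first by move=> t; rewrite addn0 !subrr normr0.
  rewrite addnS; have [h1 h2 _] := hp (k + l)%N.
  move=> t; have := dist_trans h1 IH t; move/le_trans; apply; lra.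
have pos n : 0 < (p n).2 by case: (good n).
have near k l : dist_le (p k).1 (p l).1 ((p k).2 + (p l).2).
  have [kl|lk] := leqP k l; move=> t.
    rewrite distrC -(subnKC kl); apply: (le_trans (nested k (l - k)%N t)).
    by have := pos (k + (l - k))%N; lra.
  rewrite -(subnKC (ltnW lk)); apply: (le_trans (nested l (k - l)%N t)).
  by have := pos (l + (k - l))%N; lra.
have [|||y yc hy] := @cauchy_lim (fun k => (p k).1) (fun k => (p k).2).
- by move=> k; apply: (cs_in Yc); case: (good k).
- by move=> e /hpow_small[k ke]; exists k; apply: le_trans ke; exact: rk.
- exact: near.
have Yy : Y y.
  apply: (cs_lim Yc) => e /hpow_small[k ke]; exists (p k).1; first by case: (good k).
  by move=> t; rewrite distrC; apply: (le_trans (hy k t)); apply: le_trans ke; exact: rk.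
have [n By] := zball_cover Yy; have [_ _] := hp n; apply; last exact: By.
exact: dist_sym (hy n.+1).
Qed.

(** Approximating both [y0 + a * y] and [y0] and subtracting moves the ball where [zball n] is dense
    to the origin. This doubles [n] and the error [r / 4]; scaling back by [a = r / C] gives
    [M = 2 * n / r] and the error [C / 2]. *)
Lemma approx_split : exists2 M : R, 0 <= M & forall y (C : R), Y y -> 0 < C -> nbf y C ->
  exists z w, [/\ Z z, W w, nbf z (M * C) & dist_le y (fun t => z t + w t) (C / 2)].
Proof.
have [n [y0 [r [r0 Yy0 hr]]]] := zball_somewhere_dense.
exists (2 * n%:R / r); first by rewrite divr_ge0 ?mulr_ge0 ?ler0n // ltW.
move=> y C Yy C0 yC; pose a := r / C; have a0 : 0 < a by rewrite divr_gt0.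
have e0 : 0 < r / 4 by rewrite divr_gt0.
have Y1 : Y (fun t => y0 t + a * y t) by apply: (csD Yc) => //; exact: csZ.
have d1 : dist_le (fun t => y0 t + a * y t) y0 r.
  move=> t; have -> : y0 t + a * y t - y0 t = a * y t by ring.
  rewrite normrM gtr0_norm // /a mulrAC ler_pdivrMr // ler_wpM2l ?(ltW r0) //; exact: yC.
have d0 : dist_le y0 y0 r by move=> t; rewrite subrr normr0 ltW.
have [_ [z1 [w1 [Zz1 Ww1 z1n ->]]] h1] := hr _ Y1 d1 _ e0.
have [_ [z2 [w2 [Zz2 Ww2 z2n ->]]] h2] := hr _ Yy0 d0 _ e0.
exists (fun t => a^-1 * (z1 t - z2 t)), (fun t => a^-1 * (w1 t - w2 t)); split.
- by apply: csZ => //; exact: csB.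
- by apply: csZ => //; exact: csB.
- move=> t; rewrite normrM gtr0_norm ?invr_gt0 // /a invf_div.
  have -> : 2 * n%:R / r * C = C / r * (n%:R + n%:R) by ring.
  apply: ler_wpM2l; first by rewrite divr_ge0 // ltW.
  by apply: (le_trans (ler_normB _ _)); apply: lerD.
- move=> t; have -> : y t - (a^-1 * (z1 t - z2 t) + a^-1 * (w1 t - w2 t)) =
    a^-1 * ((y0 t + a * y t - (z1 t + w1 t)) - (y0 t - (z2 t + w2 t))).
    by field; rewrite gt_eqF.
  rewrite normrM gtr0_norm ?invr_gt0 // mulrC ler_pdivrMr //.
  have -> : C / 2 * a = r / 4 + r / 4 by rewrite /a; field; rewrite gt_eqF.
  by apply: (le_trans (ler_normB _ _)); apply: lerD.
Qed.

(** Splitting the remainder again and again halves the error, and the pieces form geometric series,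
    whence the factor 2. Their sums are an exact splitting, equal to the given one because [Z] and
    [W] meet only in 0. *)
Theorem direct_sum_bound : exists2 K, 0 <= K & proj_bound Z W K.
Proof.
have [M M0 hM] := approx_split; case: dsum => ZY [WY [ZW0 _]].
exists (2 * M); first by rewrite mulr_ge0.
move=> z w C Zz Ww hC.
suff pos_case D : 0 < D -> nbf (fun t => z t + w t) D -> nbf z (2 * M * D).
  have C0 := nbf_ge0 hC; apply: nbf_lim => e e0.
  have M1 : 0 < 2 * M + 1 by lra.
  have d0 : 0 < e / (2 * M + 1) by rewrite divr_gt0.
  have := pos_case (C + e / (2 * M + 1)) _ _; move=> /(_ _ _)/nbfW; apply.
  - rewrite mulrDr lerD2l mulrCA ler_piMr ?(ltW e0) // ler_pdivrMr // mul1r; lra.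
  - by rewrite ltr_wpDl.
  - by apply: nbfW hC; lra.
move=> {hC} D0 hD; set y := fun t => z t + w t in hD.
have Yy : Y y by apply: (csD Yc); [exact: ZY | exact: WY].
have step (p : CDelta * R) : exists q : CDelta * CDelta, Y p.1 -> 0 < p.2 -> nbf p.1 p.2 ->
    [/\ Z q.1, W q.2, nbf q.1 (M * p.2) & dist_le p.1 (fun t => q.1 t + q.2 t) (p.2 / 2)].
  have [[[Yp p0] np]|n] := pselect ((Y p.1 /\ 0 < p.2) /\ nbf p.1 p.2).
    by have [z' [w' h]] := hM _ _ Yp p0 np; exists (z', w').
  by exists (fun=> 0, fun=> 0) => ? ? ?; case: n.
have /choice[nx hnx] := step.
pose ys := fix ys n := if n is n'.+1 then
  fun t => ys n' t - ((nx (ys n', D * hpow n')).1 t + (nx (ys n', D * hpow n')).2 t) else y.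
pose zs n := (nx (ys n, D * hpow n)).1; pose ws n := (nx (ys n, D * hpow n)).2.
have D1 n : 0 < D * hpow n by rewrite mulr_gt0 // hpow_gt0.
have good n : Y (ys n) /\ nbf (ys n) (D * hpow n).
  elim: n => [|n [h1 h2]]; first by rewrite /hpow expr0 mulr1.
  have [Z1 W1 _ h3] := hnx (ys n, D * hpow n) h1 (D1 n) h2; split.
    by apply: (csB Yc) => //; apply: (csD Yc); [exact: ZY | exact: WY].
  by move=> t; apply: (le_trans (h3 t)) => /=; rewrite (hpowS n); lra.
have hz n : [/\ Z (zs n), W (ws n) & nbf (zs n) (M * (D * hpow n))].
  by have [h1 h2] := good n; case: (hnx (ys n, D * hpow n) h1 (D1 n) h2).
pose zsum n : CDelta := fun t => \sum_(i < n) zs i t.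
have Zsum n : Z (zsum n) by apply: (@cs_sum Z Zc zs) => i; case: (hz i).
have ysE n t : ys n t = y t - zsum n t - \sum_(i < n) ws i t.
  elim: n => [|n IH]; first by rewrite /zsum !big_ord0 /=; ring.
  by rewrite /= -/(zs n) -/(ws n) IH /zsum !big_ord_recr /=; ring.
pose a n := 2 * M * D * hpow n.
have tail k l : dist_le (zsum (k + l)%N) (zsum k) (a k - a (k + l)%N).
  elim: l => [|l IH] t; first by rewrite addn0 !subrr normr0.
  rewrite addnS; have -> : zsum (k + l).+1 t - zsum k t = (zsum (k + l)%N t - zsum k t) + zs (k + l)%N t.
    by rewrite /zsum big_ord_recr /=; ring.
  apply: (le_trans (ler_normD _ _)); have := IH t; have [_ _ /(_ t)] := hz (k + l)%N.
  by rewrite /a (hpowS (k + l)); lra.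
have a_ge0 n : 0 <= a n by rewrite /a -!mulrA !mulr_ge0 // ltW // hpow_gt0.
have near k l : dist_le (zsum k) (zsum l) (a k + a l).
  have [kl|lk] := leqP k l; move=> t.
    rewrite distrC -(subnKC kl); apply: (le_trans (tail k (l - k)%N t)).
    by have := a_ge0 (k + (l - k))%N; lra.
  rewrite -(subnKC (ltnW lk)); apply: (le_trans (tail l (k - l)%N t)).
  by have := a_ge0 (l + (k - l))%N; lra.
have small (e : R) : 0 < e -> exists k, a k + D * hpow k <= e.
  move=> e0; have B0 : 0 < 2 * M * D + D by rewrite ltr_wpDl // mulr_ge0 ?mulr_ge0 // ltW.
  have [k hk] := hpow_small (divr_gt0 e0 B0); exists k; rewrite ler_pdivlMr // in hk.
  by rewrite /a; lra.
have [|||z0 z0c hz0] := @cauchy_lim zsum a.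
- by move=> k; exact: cs_in (Zsum k).
- by move=> e /small[k hk]; exists k; have := D1 k; lra.
- exact: near.
have Zz0 : Z z0.
  apply: (cs_lim Zc) => e /small[k hk]; exists (zsum k) => // t.
  by rewrite distrC; apply: (le_trans (hz0 k t)); have := D1 k; lra.
have Ww0 : W (fun t => y t - z0 t).
  apply: (cs_lim Wc) => e /small[k hk]; exists (fun t => \sum_(i < k) ws i t).
    by apply: (@cs_sum W Wc ws) => i; case: (hz i).
  move=> t; have -> : y t - z0 t - \sum_(i < k) ws i t = ys k t + (zsum k t - z0 t).
    by rewrite ysE; ring.
  apply: (le_trans (ler_normD _ _)); apply: le_trans hk; rewrite addrC; apply: lerD; first exact: hz0.
  by case: (good k) => _; apply.
have zz0 : (fun t => z t - z0 t) = fun=> 0.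
  have : (Z `&` W) (fun t => z t - z0 t).
    split; first exact: csB.
    rewrite (_ : (fun t => _) = (fun t => (y t - z0 t) - w t)); last by apply: funext => t; rewrite /y; ring.
    exact: csB.
  by rewrite ZW0.
move=> t; have -> : z t = - (zsum 0%N t - z0 t).
  have := congr1 (fun f => f t) zz0; rewrite /zsum big_ord0 /=; lra.
rewrite normrN; apply: (le_trans (hz0 0%N t)); rewrite /a /hpow expr0 mulr1; exact: lexx.
Qed.
End OpenMapping.

Lemma not_HI_bound X : closed_subspace X -> infinite_dim X -> ~ hereditarily_indecomposable X ->
  exists (z w : nat -> CDelta) K, [/\ forall i, X (z i), forall i, X (w i), sep_seq z, sep_seq w &
    0 <= K /\ proj_bound (clspan z) (clspan w) K].
Proof.
move=> Xc Xi nHI.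
have [Y [Z [W [Yc YX Zc Wc [Zi Wi dsum]]]]] : exists Y Z W : set CDelta,
      [/\ closed_subspace Y, Y `<=` X, closed_subspace Z, closed_subspace W &
          [/\ infinite_dim Z, infinite_dim W & direct_sum Y Z W]].
  by apply: contrapT => h; apply: nHI.
have [K K0 hK] := direct_sum_bound Yc Zc Wc dsum.
have [z [Zz sz]] := infinite_sep Zc Zi; have [w [Ww sw]] := infinite_sep Wc Wi.
have [ZY [WY _]] := dsum.
exists z, w, K; split => //; [by move=> i; apply/YX/ZY | by move=> i; apply/YX/WY|split => //].
by move=> g h C /(clspan_sub Zc Zz) Zg /(clspan_sub Wc Ww) Wh; exact: hK.
Qed.

End Subspaces.

(** * The space of a tree *)

Definition RR : realType := RbaseSymbolsImpl_R__canonical__reals_Real.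

Notation kinK := (@inK RR cmp pe pn (@csigma RR)).
Notation knb := (@nb RR cmp pe pn (@csigma RR)).
Notation khalf := (half RR).

Definition phiC n : CDelta := fun t => phi RR n t.

Lemma phiC_in n : in_CDelta (phiC n).
Proof. by apply/in_CDeltaP => eps /(@phi_ucont RR n). Qed.

Definition emb (x : {poly RR}) : CDelta := fun t => ap (fun n => phi RR n t) x.

Lemma embB x y t : emb (x - y) t = emb x t - emb y t.
Proof. exact: apB. Qed.

Lemma embZ a x t : emb (a *: x) t = a * emb x t.
Proof. exact: apZ. Qed.

Lemma emb_sum (N : nat) (x : nat -> {poly RR}) t :
  emb (\sum_(0 <= k < N) x k) t = \sum_(0 <= k < N) emb (x k) t.
Proof. exact: ap_sum. Qed.

Lemma emb_point f : kinK f -> exists t, forall x, emb x t = ap f x.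
Proof.
by move=> /phi_point[t tf]; exists t => x; apply: eq_ap => n _; exact: tf.
Qed.

(** The embedding is isometric: evaluations are approximated by norming functionals, and every
    norming functional is an evaluation. *)
Lemma nb_emb x (C : R) : knb x C <-> nbf (emb x) C.
Proof.
split=> [xC t|xC f /emb_point[t ht]]; last by rewrite -ht; exact: xC.
apply/ler_addgt0Pr => e e0.
pose s : RR := \sum_(i < size x) `|x`_i|.
have s0 : 0 <= s by rewrite sumr_ge0.
have s1 : 0 < s + 1 by rewrite ltr_wpDl.
have [f fK hf] := @phi_near RR t (size x) (e / (s + 1)) (divr_gt0 e0 s1).
have h1 : `|emb x t - ap f x| <= e.
  rewrite /emb /ap -sumrB; apply: (le_trans (ler_norm_sum _ _ _)).
  apply: le_trans (_ : \sum_(i < size x) (e / (s + 1)) * `|x`_i| <= _).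
    by apply: ler_sum => i _; rewrite -mulrBl normrM ler_wpM2r // hf.
  rewrite -mulr_sumr -/s mulrAC ler_pdivrMr // ler_wpM2l ?(ltW e0) //; lra.
have -> : emb x t = ap f x + (emb x t - ap f x) by rewrite addrC subrK.
by apply: (le_trans (ler_normD _ _)); apply: lerD => //; exact: xC.
Qed.

Lemma lcomb_emb n (c : nat -> RR) : lcomb n c phiC = emb (\poly_(i < n) c i).
Proof.
apply: funext => t; rewrite /emb (@ap_widen _ _ _ n) ?size_poly //.
by apply: eq_bigr => i _; rewrite coef_poly ltn_ord mulrC.
Qed.

Lemma ap_Xn (f : nat -> RR) n : ap f 'X^n = f n.
Proof.
rewrite (@ap_widen _ _ _ n.+1) ?size_polyXn // (bigD1 ord_max) //= coefXn eqxx mulr1.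
rewrite big1 ?addr0 // => l ln; rewrite coefXn; case: eqP => [h|]; rewrite ?mulr0 //.
by move/eqP: ln; case; apply: val_inj.
Qed.

Lemma emb_Xn n : emb 'X^n = phiC n.
Proof. by apply: funext => t; exact: ap_Xn. Qed.

Section TreeSpace.
Variable T : set (seq nat).

Definition node_in n := `[< exists2 s, T s & n = pickle s >].
(** Nodes outside the tree keep their index and are sent to 0, so one indexing serves all trees and
    measurability reduces to membership of single nodes. *)
Definition psi n : CDelta := if node_in n then phiC n else fun=> 0.
Definition tree_space := clspan psi.

Lemma psi_in n : in_CDelta (psi n).
Proof. by rewrite /psi; case: ifP => _; [exact: phiC_in | exact: in_CDelta_cst]. Qed.

Lemma tree_space_closed : closed_subspace tree_space.
Proof. exact: clspan_closed psi_in. Qed.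

Lemma tree_space_node s : T s -> tree_space (phiC (pickle s)).
Proof.
move=> Ts; have -> : phiC (pickle s) = psi (pickle s); last exact: clspan_nth.
by rewrite /psi /node_in asboolT //; exists s.
Qed.

Lemma tree_space_approx g (e : R) : tree_space g -> 0 < e ->
  exists x, inT T x /\ dist_le g (emb x) e.
Proof.
move=> hg /hg[n [c h]]; pose d i : RR := if node_in i then c i else 0.
have E : lcomb n c psi = lcomb n d phiC.
  apply: funext => t; apply: eq_bigr => i _; rewrite /psi /d.
  by case: ifP => _; rewrite ?mulr0 ?mul0r.
exists (\poly_(i < n) d i); rewrite -lcomb_emb -E; split => // i.
by rewrite coef_poly; case: ifP; rewrite ?eqxx // /d; case: ifP; rewrite ?eqxx // => /asboolP.
Qed.

Lemma coord_point : exists p : nat -> cantor_space, forall n x, emb x (p n) = x`_n.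
Proof.
have /choice[p hp] : forall n, exists t : cantor_space, forall x, emb x t = x`_n.
  move=> n; have [t ht] := emb_point (dual_inK pe pn (@csigma RR) n).
  by exists t => x; rewrite ht ap_dual.
by exists p.
Qed.

Lemma phi_free (k : nat -> nat) : injective k -> free_seq (fun i => phiC (k i)).
Proof.
move=> ki n c E; have [p hp] := coord_point.
have pE i j : phiC i (p j) = (i == j)%:R.
  by rewrite -emb_Xn hp coefXn eq_sym.
have := congr1 (fun f => f (p (k n))) E; rewrite /lcomb pE eqxx big1 => [/eqP|i _].
  by rewrite oner_eq0.
by rewrite pE (inj_eq ki) ltn_eqF ?mulr0.
Qed.

Lemma block_approx Z M (dl : R) : closed_subspace Z -> Z `<=` tree_space -> infinite_dim Z -> 0 < dl ->
  exists u z, [/\ inT T u, low u M, knb u 1, exists2 f, kinK f & khalf <= ap f u &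
    Z z /\ dist_le z (emb u) dl].
Proof.
move=> Zc ZT Zi d0; have [p hp] := coord_point.
have [z1 [Zz1 z1n z1p]] := vanishing_vector M p Zc Zi.
have [t0 zt0] : exists t0, z1 t0 != 0.
  by apply: contrapT => /forallNP h; apply: z1n; apply: funext => t; apply: contrapT => /eqP; exact: h.
pose z t := (z1 t0)^-1 * z1 t; have Zz : Z z by exact: csZ.
have zt : z t0 = 1 by rewrite /z mulVf.
have zp n : (n < M)%N -> z (p n) = 0 by move=> nM; rewrite /z z1p ?mulr0.
(* The [M] dropped coordinates and the approximation cost [M.+1 * ep] together. The bound 1/2 keeps
   the result away from 0, so normalizing costs a factor at most 2, for which [dl / 2] leaves
   room. *)
pose ep : R := Num.min (dl / 2) (1 / 2) / M.+1%:R.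
have M1 : 0 < M.+1%:R :> R by rewrite ltr0n.
have ep0 : 0 < ep by rewrite divr_gt0 // lt_min !divr_gt0.
have [x [xT hx]] := tree_space_approx (ZT _ Zz) ep0.
pose x1 : {poly RR} := \poly_(i < M) x`_i.
have x1b : nbf (emb x1) (M%:R * ep).
  apply/nb_emb => f fK; rewrite (@ap_widen _ _ _ M) ?size_poly //.
  apply: (le_trans (ler_norm_sum _ _ _)).
  apply: le_trans (_ : \sum_(i < M) ep <= _); last by rewrite sumr_const card_ord mulr_natl.
  apply: ler_sum => i _; rewrite coef_poly ltn_ord normrM.
  have h1 : `|x`_i| <= ep by have := hx (p i); rewrite hp zp // sub0r normrN.
  apply: le_trans h1; rewrite ler_piMl //; exact: inK_le1 fK.
pose x' := x - x1.
have x'T : inT T x'.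
  move=> n; rewrite coefB coef_poly; case: ifP => _; first by rewrite subrr eqxx.
  by rewrite subr0; exact: xT.
have x'l : low x' M by move=> n nM; rewrite coefB coef_poly nM subrr.
have zx' : dist_le z (emb x') (M.+1%:R * ep).
  move=> t; rewrite embB; have -> : z t - (emb x t - emb x1 t) = (z t - emb x t) + emb x1 t by ring.
  apply: (le_trans (ler_normD _ _)); rewrite -natr1 mulrDl mul1r addrC; apply: lerD; first exact: x1b.
  exact: hx.
have epE : M.+1%:R * ep = Num.min (dl / 2) (1 / 2) by rewrite /ep mulrC divfK // gt_eqF.
have e1 : M.+1%:R * ep <= dl / 2 by rewrite epE ge_min lexx.
have e2 : M.+1%:R * ep <= 1 / 2 by rewrite epE ge_min lexx orbT.
have x't : 1 / 2 <= `|emb x' t0|.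
  have := zx' t0; rewrite zt => h; have := ler_norm (1 - emb x' t0); have := ler_norm (emb x' t0); lra.
have x'0 : x' != 0.
  apply/eqP => xE; move: x't; rewrite xE /emb ap0 normr0; lra.
have [a [an af]] := @normalize RR pe pn (@csigma RR) x' x'0.
have a2 : `|a| <= 2.
  have /nb_emb/(_ t0) := an; rewrite embZ normrM => h.
  have := ler_wpM2l (normr_ge0 a) x't; lra.
exists (a *: x'), (fun t => a * z t); split => //.
- move=> n; rewrite coefZ => h; apply: x'T; apply: contraNneq h => ->; by rewrite mulr0.
- by move=> n nM; rewrite coefZ x'l ?mulr0.
split; first exact: csZ.
move=> t; rewrite embZ -mulrBr normrM.
apply: (le_trans (ler_pM (normr_ge0 _) (normr_ge0 _) a2 (zx' t))); lra.
Qed.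

Hypothesis T_rcons : forall s i, T (rcons s i) -> T s.
Hypothesis T_wf : ~ exists b, forall n, T (mkseq b n).

(** The errors on the blocks decrease geometrically and coefficients are at most twice the norm, so
    the error on a combination is proportional to its norm. *)
Lemma block_subspace Z (dl : R) : closed_subspace Z -> Z `<=` tree_space -> infinite_dim Z -> 0 < dl ->
  exists Z' : {poly RR} -> Prop, [/\ subsp Z', @small_vec RR cmp pe pn (@csigma RR) Z' &
    forall x C, Z' x -> knb x C -> exists2 z, Z z & dist_le z (emb x) (C * dl)].
Proof.
move=> Zc ZT Zi d0.
have [|S [u [S0 Sm su hu]]] := @pick_seq RR (fun M b u => [/\ inT T u, knb u 1,
    exists2 f, kinK f & khalf <= ap f u & exists2 z, Z z & dist_le z (emb u) (dl * khalf ^+ M.+2)]) 0%N.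
  move=> M; have em : 0 < dl * khalf ^+ M.+2 by rewrite mulr_gt0 // halfX_gt0.
  have [u [z [uT ul u1 uf [Zz zu]]]] := block_approx M Zc ZT Zi em.
  exists (maxn M (size u)), u; rewrite leq_maxl; split => //; last by split => //; exists z.
  by apply: suppW (low_supp ul) => //; exact: leq_maxr.
have uf k : exists2 f, kinK f & khalf <= ap f (u k) by case: (hu k).
have grow := blocks_grow S0 su uf.
have tl : @tailful RR T (bspan u).
  split; [exact: bspan_subsp| |].
    move=> M; have [uM Sk] := grow M; exists (u M); split => //; first exact: bspan_nth.
    by apply: lowW Sk (supp_low (su M)).
  move=> x [a [N [_ ->]]] n; rewrite coef_sum => hn.
  have [k kN] : exists k, (a k *: u k)`_n != 0.
    apply: contrapT => /forallNP h; move/eqP: hn; apply; rewrite big1 // => k _.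
    by apply: contrapT => /eqP; exact: h.
  move: kN; rewrite coefZ => kn; case: (hu k) => uT _ _ _; apply: uT.
  by apply: contraNneq kn => ->; rewrite mulr0.
exists (bspan u); split; first exact: bspan_subsp.
  exact: (@tree_small RR pe pn (@csigma RR) pe_gt pn_gt (pnn_big RR) T T_rcons T_wf _ tl).
move=> x C [a [N [_ ->]]] xC.
have /choice[z hz] : forall k, exists z, Z z /\ dist_le z (emb (u k)) (dl * khalf ^+ (S k).+2).
  by move=> k; case: (hu k) => _ _ _ [z ? ?]; exists z.
exists (lcomb N a z); first by apply: cs_lcomb => // i; case: (hz i).
have C0 : 0 <= C := nb_ge0 xC.
move=> t; rewrite emb_sum big_mkord /lcomb -sumrB; apply: (le_trans (ler_norm_sum _ _ _)).
apply: le_trans (_ : C * dl * \sum_(k < N) khalf ^+ k.+1 <= _); last first.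
  by rewrite ler_piMr ?geo_le // mulr_ge0 // ltW.
rewrite mulr_sumr; apply: ler_sum => k _; rewrite embZ -mulrBr normrM.
have ak := bspan_coef Sm su (uf k) (ltn_ord k) xC; have [_ /(_ t) zk] := hz k.
apply: (le_trans (ler_pM (normr_ge0 _) (normr_ge0 _) ak zk)).
have -> : 2 * C * (dl * khalf ^+ (S k).+2) = C * dl * khalf ^+ (S k).+1.
  by rewrite (exprS _ (S k).+1) /half; field.
rewrite ler_wpM2l ?mulr_ge0 ?(ltW d0) //; apply: ler_wiXn2l; [rewrite /half; lra|rewrite /half; lra|].
by rewrite ltnS; case: (grow k).
Qed.

(** A bounded projection would control [x] and [y] by [x - y] up to the approximation error, while
    [hi_blocks] makes [x - y] tiny against [x + y]. *)
Theorem tree_space_HI : (forall i, T [:: i]) -> hereditarily_indecomposable tree_space.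
Proof.
move=> Ti; split.
  apply: (@free_infinite (fun i => phiC (pickle [:: i]))); last by move=> i; exact: tree_space_node.
  by apply: phi_free => i j /(pcan_inj pickleK)[].
move=> [Y [Z [W [Yc YX Zc Wc [Zi Wi dsum]]]]].
have [K K0 hK] := direct_sum_bound Yc Zc Wc dsum; case: dsum => ZY [WY _].
have ZX : Z `<=` tree_space by move=> z /ZY/YX.
have WX : W `<=` tree_space by move=> z /WY/YX.
(* With this [dl] and the [eps] below, the larger norm [c] of [x] and [y] satisfies
   [c <= 1/8 + c/2], so [c <= 1/4]; but the functional [f] gives [1 <= 2 * c]. *)
pose dl : R := 1 / (2 * (2 * K + 3)).
have B0 : 0 < 2 * (2 * K + 3) by lra.
have d0 : 0 < dl by rewrite divr_gt0.
have dE : dl * (2 * K + 3) = 1 / 2 by rewrite /dl; field; rewrite gt_eqF //; lra.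
pose eps : R := 1 / (8 * (K + 1)).
have e0 : 0 < eps by rewrite divr_gt0 //; lra.
have eE : eps * (K + 1) = 1 / 8 by rewrite /eps; field; rewrite gt_eqF //; lra.
have [Z' [Z's Z'v Z'Z]] := block_subspace Zc ZX Zi d0.
have [W' [W's W'v W'W]] := block_subspace Wc WX Wi d0.
have [x [y [Zx Wy [f fK fxy] xy]]] := @hi_blocks RR cmp pe pn (@csigma RR) pe_gt pe_mono pn_gt pn_mono
  (pmu_nn RR) (pnn_big RR) cmp_refl (@csigma_even RR) (@csigma_gt RR) (@csigma_inj RR) Z' W' eps Z's W's Z'v W'v e0.
have [cx xc cxm] := @norm_exists RR pe pn (@csigma RR) x.
have [cy yc cym] := @norm_exists RR pe pn (@csigma RR) y.
pose c := Num.max cx cy.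
have xc' : knb x c by apply: nbW xc; rewrite /c le_max lexx.
have yc' : knb y c by apply: nbW yc; rewrite /c le_max lexx orbT.
have [z Zz zx] := Z'Z x c Zx xc'; have [w Ww wy] := W'W y c Wy yc'.
have zw : nbf (fun t => z t - w t) (eps + 2 * (c * dl)).
  move=> t; have -> : z t - w t = (z t - emb x t) - (w t - emb y t) + emb (x - y) t by rewrite embB; ring.
  apply: (le_trans (ler_normD _ _)); have := ler_normB (z t - emb x t) (w t - emb y t).
  have := zx t; have := wy t; have /nb_emb/(_ t) := xy; lra.
have zb : nbf z (K * (eps + 2 * (c * dl))) by apply: (hK z (fun t => - w t)) => //; exact: csN.
have b1 : nbf (emb x) (K * (eps + 2 * (c * dl)) + c * dl) := nbf_dist zb zx.
have b2 : nbf (emb y) ((K + 1) * (eps + 2 * (c * dl)) + c * dl).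
  move=> t; have -> : emb y t = z t - (z t - w t) - (w t - emb y t) by ring.
  apply: (le_trans (ler_normB _ _)); have := ler_normB (z t) (z t - w t).
  have := zb t; have := zw t; have := wy t; lra.
have c0 : 0 <= c := nb_ge0 xc'.
have cd0 : 0 <= c * dl by rewrite mulr_ge0 // ltW.
have b1' : cx <= (K + 1) * (eps + 2 * (c * dl)) + c * dl.
  apply: (le_trans (cxm _ (_ : knb x (K * (eps + 2 * (c * dl)) + c * dl)))); last by lra.
  exact/nb_emb.
have b2' : cy <= (K + 1) * (eps + 2 * (c * dl)) + c * dl by apply: cym; exact/nb_emb.
have cE : c <= (K + 1) * (eps + 2 * (c * dl)) + c * dl by rewrite /c ge_max b1' b2'.
have cE2 : (K + 1) * (eps + 2 * (c * dl)) + c * dl = 1 / 8 + c * (1 / 2) by rewrite -eE -dE; ring.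
have h1 := xc' f fK; have h2 := yc' f fK.
have h3 : 1 <= `|ap f x| + `|ap f y|.
  by have := ler_normD (ap f x) (ap f y); rewrite -apD fxy normr1.
lra.
Qed.
End TreeSpace.

(** The branch is split into even and odd levels. The signs of the coefficients on the even levels
    form a ground functional that vanishes on the odd ones, so the projection onto the even part has
    norm at most 1. *)
Theorem tree_space_not_HI (T : set (seq nat)) (b : nat -> nat) :
  (forall n, T (mkseq b n)) -> ~ hereditarily_indecomposable (tree_space T).
Proof.
move=> Tb; pose nz i := pickle (mkseq b (2 * i)); pose nw i := pickle (mkseq b (2 * i).+1).
have bsize n n' : mkseq b n = mkseq b n' -> n = n' by move=> /(congr1 size); rewrite !size_mkseq.
have nzi : injective nz by move=> i j /(pcan_inj pickleK)/bsize; lia.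
have nwi : injective nw by move=> i j /(pcan_inj pickleK)/bsize; lia.
apply: (@not_HI_seq _ (fun i => phiC (nz i)) (fun i => phiC (nw i)) 1).
- exact: tree_space_closed.
- by move=> i; apply: tree_space_node; exact: Tb.
- by move=> i; apply: tree_space_node; exact: Tb.
- exact: phi_free.
- exact: phi_free.
- exact: ler01.
move=> n c n' c' C hC; rewrite mul1r.
(* [pickle_inv] answers only on indices that [pickle] really assigns, so a nonzero value determines
   the index and not just the node. *)
pose g m : RR := if pickle_inv m is Some s then
  (if (s == mkseq b (size s)) && ~~ odd (size s) && ((size s)./2 < n)%N then Num.sg (c (size s)./2) else 0) else 0.
have gz i : (i < n)%N -> g (nz i) = Num.sg (c i).
  by move=> il; rewrite /g /nz pickleK_inv size_mkseq eqxx mul2n odd_double doubleK il.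
have gw i : g (nw i) = 0.
  by rewrite /g /nw pickleK_inv size_mkseq eqxx /= mul2n odd_double.
have g_nz m : g m != 0 -> exists2 i, (i < n)%N & m = nz i.
  rewrite /g; case E : (pickle_inv m) => [s|]; last by rewrite eqxx.
  case: ifP => [/andP[/andP[/eqP sE so] sn] _|_]; last by rewrite eqxx.
  exists (size s)./2 => //; rewrite /nz.
  have -> : (2 * (size s)./2)%N = size s.
    by rewrite mul2n -[RHS]odd_double_half (negPf so).
  by rewrite -sE; have := @pickle_invK (seq nat) m; rewrite E.
have gK : kinK g.
  apply: KK_inK; apply: ground_KK; split.
  - move=> m; rewrite /g; case: (pickle_inv m) => [s|]; last exact: Or31.
    case: ifP => _; last exact: Or31.
    by case: sgrP => _; [exact: Or31 | exact: Or32 | exact: Or33].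
  - exists (\max_(i < n) nz (val i)).+1 => m hm; apply: contrapT => /eqP /g_nz[i il mE].
    have := leq_bigmax (F := fun i : 'I_n => nz (val i)) (Ordinal il).
    by rewrite leqNgt => /negP; apply; rewrite /= -mE; exact: hm.
  - move=> m m' /g_nz[i _ ->] /g_nz[j _ ->]; rewrite /cmp /nd /nz !pickleK /=.
    have pre k l : (k <= l)%N -> prefix (mkseq b k) (mkseq b l).
      move=> kl; apply/prefixP; exists (map b (iota k (l - k))).
      by rewrite -{1}(subnKC kl) /mkseq iotaD map_cat add0n.
    by have [h|h] := leqP i j; apply/orP; [left|right]; apply: pre; rewrite leq_mul2l //= ltnW.
have [t ht] := phi_point gK.
have zE : lcomb n c (fun i => phiC (nz i)) t = \sum_(i < n) `|c i|.
  by apply: eq_bigr => i _; rewrite /phiC ht gz // normrEsg mulrC.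
have wE : lcomb n' c' (fun i => phiC (nw i)) t = 0.
  by rewrite /lcomb big1 // => i _; rewrite /phiC ht gw mulr0.
have cC : \sum_(i < n) `|c i| <= C.
  by have := hC t; rewrite zE wE addr0; apply: le_trans; exact: ler_norm.
move=> t'; apply: le_trans cC; apply: (le_trans (ler_norm_sum _ _ _)); apply: ler_sum => i _.
rewrite normrM ler_piMr // -emb_Xn; have h : nbf (emb 'X^(nz i)) 1; last exact: h.
by apply/nb_emb => f fK; rewrite ap_Xn; exact: inK_le1 fK.
Qed.

(** * Borel reductions *)

Section SigmaAlgebra.
Variables (T : Type) (S : set (set T)).
Hypothesis HS : sigma_algebra setT S.

Lemma sa0 : S set0. Proof. by case: HS. Qed.

Lemma saC A : S A -> S (~` A).
Proof. by case: HS => _ h _ /h; rewrite setTD. Qed.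

Lemma saT : S setT. Proof. by rewrite -setC0; apply: saC; exact: sa0. Qed.

Lemma sa_bigcup (I : countType) (A : I -> set T) : (forall i, S (A i)) -> S (\bigcup_i A i).
Proof.
move=> hA; case: HS => _ _ hU.
rewrite (_ : \bigcup_i A i = \bigcup_k (if unpickle k is Some i then A i else set0)).
  by apply: hU => k; case: (unpickle k) => [i|]; [exact: hA | exact: sa0].
apply/seteqP; split => [x [i _ xi]|x [k _]]; first by exists (pickle i) => //; rewrite pickleK.
by case: (unpickle k) => [i xi|//]; exists i.
Qed.

Lemma sa_bigcap (I : countType) (A : I -> set T) : (forall i, S (A i)) -> S (\bigcap_i A i).
Proof.
move=> hA; rewrite -[X in S X]setCK setC_bigcap; apply: saC.
by apply: sa_bigcup => i; apply: saC.
Qed.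

Lemma saU A B : S A -> S B -> S (A `|` B).
Proof.
move=> SA SB; rewrite (_ : A `|` B = \bigcup_(b in [set: bool]) (if b then A else B)).
  by apply: sa_bigcup => -[].
apply/seteqP; split => [x [Ax|Bx]|x [[] _ ?]]; by [exists true | exists false | left | right].
Qed.

Lemma saI A B : S A -> S B -> S (A `&` B).
Proof. by move=> SA SB; rewrite -[X in S X]setCK setCI; apply/saC/saU; apply: saC. Qed.

Lemma sa_prop (P : Prop) : S [set x | P].
Proof.
have [p|np] := pselect P.
  by rewrite (_ : [set x | P] = setT); [exact: saT | apply/seteqP; split].
by rewrite (_ : [set x | P] = set0); [exact: sa0 | apply/seteqP; split].
Qed.

Lemma sa_imply A B : S A -> S B -> S [set x | A x -> B x].
Proof.
move=> SA SB; rewrite (_ : [set x | A x -> B x] = (~` A) `|` B).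
  by apply: saU => //; exact: saC.
by apply/seteqP; split => x /=; [move=> h; have [/h|] := pselect (A x); [right|left] | case].
Qed.
End SigmaAlgebra.

Lemma borel_map_generated (T X : Type) (S : set (set T)) (G : set (set X)) (F : T -> X) :
  sigma_algebra setT S -> (forall B, G B -> S (F @^-1` B)) -> borel_map S <<s G >> F.
Proof.
move=> HS h; suff : <<s G >> `<=` [set B | S (F @^-1` B)] by [].
apply: smallest_sub => //; split => [|A /= hA|A /= hA].
- by rewrite /= preimage_set0; exact: sa0 HS.
- by rewrite /= setTD preimage_setC; exact: saC.
- by rewrite /= preimage_bigcup; exact: (@sa_bigcup _ _ HS nat).
Qed.

Definition rlcomb (q : seq rat) (f : nat -> CDelta) : CDelta :=
  lcomb (size q) (fun i => ratr (nth 0 q i)) f.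

Lemma rat_approx (a e : R) : 0 < e -> exists q : rat, `|a - ratr q| <= e.
Proof.
move=> e0; have ae : a - e < a + e by lra.
have [q] := rat_in_itvoo ae; rewrite in_itv /= => /andP[h1 h2]; exists q.
by rewrite ler_norml; apply/andP; split; lra.
Qed.

Lemma rlcomb_approx n c (f : nat -> CDelta) (e : R) : (forall i, in_CDelta (f i)) -> 0 < e ->
  exists q, size q = n /\ dist_le (lcomb n c f) (rlcomb q f) e.
Proof.
move=> fc e0; have /choice[C hC] : forall i, exists C, nbf (f i) C.
  by move=> i; exact: in_CDelta_bounded.
pose B : R := \sum_(i < n) C i + 1.
have C0 i : 0 <= C i := nbf_ge0 (hC i).
have B0 : 0 < B by rewrite ltr_wpDl // sumr_ge0.
have eB : 0 < e / B by rewrite divr_gt0.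
have /choice[q hq] : forall i, exists q : rat, `|c i - ratr q| <= e / B by move=> i; exact: rat_approx.
exists (mkseq q n); rewrite size_mkseq; split => // t.
rewrite /rlcomb /lcomb size_mkseq -sumrB; apply: (le_trans (ler_norm_sum _ _ _)).
apply: le_trans (_ : \sum_(i < n) (e / B) * C i <= _).
  apply: ler_sum => i _; rewrite nth_mkseq // -mulrBl normrM.
  by apply: ler_pM => //; exact: hC.
rewrite -mulr_sumr mulrAC ler_pdivrMr // ler_wpM2l ?(ltW e0) //.
by rewrite /B lerDl.
Qed.

Lemma open_meets_clspan (U : set CDelta) (f : nat -> CDelta) :
  CDelta_open U -> (forall i, in_CDelta (f i)) ->
  (exists2 g, clspan f g & U g) <-> exists q, U (rlcomb q f).
Proof.
move=> [Uc Uo] fc; split=> [[g gf Ug]|[q Uq]]; last by exists (rlcomb q f) => //; exact: clspan_lcomb.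
have [e e0 he] := Uo g Ug; have e2 : 0 < e / 2 by rewrite divr_gt0.
have [n [c h1]] := gf _ e2; have [q [_ h2]] := rlcomb_approx n c fc e2.
exists q; apply: he; first exact: in_CDelta_lcomb.
by move=> t; rewrite (splitr e); exact: (dist_trans h1 h2).
Qed.

Definition mkSB X (h : closed_subspace X) : SB := exist _ X h.

(** Rational combinations are dense in the span, so meeting an open set is a countable union of
    conditions on single combinations. *)
Lemma clspan_borel (Y : Type) (SY : set (set Y)) (f : Y -> nat -> CDelta)
    (fc : forall (y : Y) i, in_CDelta (f y i)) (G : set Y) (X0 : SB) (F : Y -> SB) :
  sigma_algebra setT SY -> SY G ->
  (forall q U, CDelta_open U -> SY [set y : Y | G y /\ U (rlcomb q (f y))]) ->
  (forall y : Y, G y -> proj1_sig (F y) = clspan (f y)) -> (forall y : Y, ~ G y -> F y = X0) ->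
  borel_map SY effros_borel F.
Proof.
move=> HS SG hU FG FnG; apply: borel_map_generated => // _ [U Uo <-].
rewrite (_ : _ @^-1` _ = (\bigcup_q [set y : Y | G y /\ U (rlcomb q (f y))]) `|`
   ((~` G) `&` [set y : Y | exists2 g, proj1_sig X0 g & U g])).
  apply: saU => //; first by apply: sa_bigcup => // q; exact: hU.
  by apply: saI => //; [exact: saC | exact: sa_prop].
apply/seteqP; split => [y /= h|y /= [[q _ /= [Gy Uq]]|[nG h]]].
- have [Gy|nG] := pselect (G y); last by right; split => //; rewrite -(FnG y nG).
  left; move: h; rewrite (FG y Gy) => /(open_meets_clspan Uo (fc y))[q Uq]; by exists q.
- by rewrite (FG y Gy); apply/(open_meets_clspan Uo (fc y)); exists q.
- by rewrite (FnG y nG).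
Qed.

Lemma tree_space_borel (Y : Type) (SY : set (set Y)) (T : Y -> set (seq nat)) :
  sigma_algebra setT SY -> (forall s, SY [set y : Y | T y s]) ->
  borel_map SY effros_borel (fun y : Y => mkSB (@tree_space_closed (T y))).
Proof.
move=> HS hT; pose X0 := mkSB (@tree_space_closed set0).
apply: (@clspan_borel _ _ (fun y : Y => psi (T y)) (fun y : Y => @psi_in (T y)) setT X0) => //; [exact: saT| |by move=> y []].
(* The combination depends on finitely many memberships, recorded in a bit string [b]; once [b] is
   fixed, the condition on [U] does not involve [y]. *)
move=> q U Uo; pose fb (b : seq bool) i : CDelta := if nth false b i then phiC i else fun=> 0.
have node_meas i : SY [set y : Y | node_in (T y) i].
  rewrite (_ : [set y : Y | _] = \bigcup_s ([set y : Y | T y s] `&` [set y : Y | i = pickle s])).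
    by apply: sa_bigcup => // s; apply: saI => //; exact: sa_prop.
  apply/seteqP; split => [y /= /asboolP[s Ts iE]|y [s _ [Ts iE]]]; first by exists s.
  by apply/asboolP; exists s.
rewrite (_ : [set y : Y | _] = \bigcup_b ([set y : Y | U (rlcomb q (fb b))] `&`
   \bigcap_i [set y : Y | (i < size q)%N -> node_in (T y) i = nth false b i])).
  apply: sa_bigcup => // b; apply: saI => //; first exact: sa_prop.
  apply: sa_bigcap => // i; apply: (@sa_imply _ _ HS [set y : Y | (i < size q)%N] [set y : Y | node_in (T y) i = nth false b i]).
    exact: sa_prop.
  case: (nth false b i); first exact: node_meas.
  move: (saC HS (node_meas i)).
  have <- : [set y : Y | node_in (T y) i = false] = ~` [set y : Y | node_in (T y) i].
    by apply/seteqP; split => y /=; [move=> -> | case: node_in].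
  by [].
have key (y : Y) b : (forall i, (i < size q)%N -> node_in (T y) i = nth false b i) ->
    rlcomb q (psi (T y)) = rlcomb q (fb b).
  by move=> h; apply: funext => t; apply: eq_bigr => i _; rewrite /psi h.
apply/seteqP; split => [y /= [_ Uy]|y [b _ /= [Ub hb]]]; last first.
  by split => //; rewrite (key y b) // => i; exact: hb.
exists (mkseq (node_in (T y)) (size q)) => //; split => /=.
  by rewrite -(key y) // => i iq; rewrite nth_mkseq.
by move=> i _ /= iq; rewrite nth_mkseq.
Qed.

(** * Suslin representations and measurable trees *)

Definition row (i : nat) (r : nat -> nat) : nat -> nat := fun l => r (pickle (i, l)).
Definition unrow (P : nat -> nat -> nat) : nat -> nat :=
  fun m => if unpickle m is Some (i, l) then P i l else 0%N.

Lemma row_unrow P i : row i (unrow P) = P i.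
Proof. by apply: funext => l; rewrite /row /unrow pickleK. Qed.

Definition rowmod (i n : nat) := (\max_(l < n) pickle (i, val l)).+1.

Lemma row_agree i n (r r' : nat -> nat) : agree (rowmod i n) r r' -> agree n (row i r) (row i r').
Proof.
move=> h l ln; apply: h; rewrite /rowmod ltnS.
exact: (leq_bigmax (F := fun l : 'I_n => pickle (i, val l)) (Ordinal ln)).
Qed.

(* A Suslin representation: membership is witnessed by a point satisfying countably many
   conditions, the n-th of which reads only n coordinates. *)
Definition local_cond (F : (nat -> nat) -> (nat -> nat) -> nat -> Prop) :=
  forall n p q p' q', agree n p p' -> agree n q q' -> F p q n -> F p' q' n.
Definition suslin (P : set (nat -> nat)) :=
  exists F, local_cond F /\ forall p, P p <-> exists q, forall n, F p q n.

(** Postponing the k-th condition until [m k] coordinates have been read makes any modulus local. *)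
Lemma suslin_mod (P : set (nat -> nat)) (F : (nat -> nat) -> (nat -> nat) -> nat -> Prop) (m : nat -> nat) :
  (forall n p q p' q', agree (m n) p p' -> agree (m n) q q' -> F p q n -> F p' q' n) ->
  (forall p, P p <-> exists q, forall n, F p q n) -> suslin P.
Proof.
move=> Fm FP; exists (fun p q n => forall k, (k <= n)%N -> (m k <= n)%N -> F p q k); split.
  move=> n p q p' q' pp qq h k kn mk.
  by apply: Fm (h k kn mk); [exact: agreeW pp | exact: agreeW qq].
move=> p; split=> [/FP[q h]|[q h]]; first by exists q.
by apply/FP; exists q => n; apply: (h (maxn n (m n))); [exact: leq_maxl | exact: leq_maxr].
Qed.

Lemma suslin_bigcup (P : nat -> set (nat -> nat)) : (forall i, suslin (P i)) -> suslin (\bigcup_i P i).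
Proof.
move=> /choice[F hF].
exists (fun p q n => if n is n'.+1 then F (q 0%N) p (fun l => q l.+1) n' else True); split.
  case=> // n p q p' q' pp qq; rewrite -(qq 0%N) //; apply: (hF _).1.
    by apply: agreeW pp.
  by move=> i il; apply: qq.
move=> p; split=> [[i _ /(hF i).2[q h]]|[q h]].
  by exists (fun l => if l is l'.+1 then q l' else i); case.
exists (q 0%N) => //; apply/(hF _).2; exists (fun l => q l.+1) => n; exact: (h n.+1).
Qed.

Lemma suslin_bigcap (P : nat -> set (nat -> nat)) : (forall i, suslin (P i)) -> suslin (\bigcap_i P i).
Proof.
move=> /choice[F hF].
apply: (@suslin_mod _ (fun p q n => if unpickle n is Some (i, k) then F i p (row i q) k else True)
  (fun n => if unpickle n is Some (i, k) then maxn k (rowmod i k) else 0%N)).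
  move=> n p q p' q'; case: (unpickle n) => [[i k]|//] pp qq; apply: (hF i).1.
    by apply: agreeW pp; exact: leq_maxl.
  by apply: row_agree; apply: agreeW qq; exact: leq_maxr.
move=> p; split=> [h|[q h] i _].
  have /choice[q hq] : forall i, exists q, forall n, F i p q n by move=> i; exact/(hF i).2/h.
  by exists (unrow q) => n; case: (unpickle n) => [[i k]|//]; rewrite row_unrow.
by apply/(hF i).2; exists (row i q) => k; have := h (pickle (i, k)); rewrite pickleK.
Qed.

Lemma suslin_open U : baire_open U -> suslin U /\ suslin (~` U).
Proof.
move=> Uo; pose sub n p := forall y, agree n p y -> U y.
have sub_agree n p p' : agree n p p' -> sub n p -> sub n p'.
  by move=> pp h y py; apply: h; exact: agree_trans pp py.
have subU p : U p <-> exists n, sub n p.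
  split=> [/Uo[n h]|[n h]]; last exact: h.
  by exists n => y py; apply: h => i il; rewrite py.
split.
  exists (fun p q n => (0 < n)%N -> (q 0%N <= n)%N -> sub (q 0%N) p); split.
    move=> n p q p' q' pp qq h n0; rewrite -(qq 0%N) // => qn.
    by apply: sub_agree (h n0 qn); exact: agreeW pp.
  move=> p; rewrite subU; split=> [[n h]|[q h]]; first by exists (fun=> n).
  by exists (q 0%N); apply: (h (q 0%N).+1).
exists (fun p q n => ~ sub n p); split.
  by move=> n p q p' q' /agree_sym pp _ h /(sub_agree _ _ _ pp).
move=> p; rewrite /setC /=; split=> [np|[q h]]; first by exists p => n hn; apply/np/subU; exists n.
by move/subU => [n hn]; exact: (h n hn).
Qed.

(** Sets that are Suslin together with their complements contain the open sets and form a
    sigma-algebra. *)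
Lemma suslin_borel P : baire_borel P -> suslin P /\ suslin (~` P).
Proof.
suff : baire_borel `<=` [set P | suslin P /\ suslin (~` P)] by apply.
apply: smallest_sub.
  split => [|A [h1 h2]|A hA] /=.
  - by apply: suslin_open => x.
  - by rewrite setTD setCK.
  - by rewrite setC_bigcup; split; [apply: suslin_bigcup | apply: suslin_bigcap] => i; case: (hA i).
by move=> U /suslin_open.
Qed.

Lemma sa_baire : sigma_algebra setT baire_borel. Proof. exact: smallest_sigma_algebra. Qed.

(** [y] is in the range iff some [p] gives [g p] the same answers as [y] to all tests [U n]. For
    fixed [y] each answer puts [p] in a Borel set or in its complement, both Suslin. As [y] enters
    only through these tests, membership of a node is measurable in [y]. *)
Lemma suslin_tree (Y : Type) (SY : set (set Y)) (U : nat -> set Y) (g : (nat -> nat) -> Y) :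
  sigma_algebra setT SY -> (forall n, SY (U n)) ->
  (forall y y', (forall n, U n y <-> U n y') -> y = y') -> borel_map baire_borel SY g ->
  exists T : Y -> set (seq nat), [/\ forall y s i, T y (rcons s i) -> T y s,
    forall s, SY [set y | T y s] &
    forall y, (exists b, forall n, T y (mkseq b n)) <-> range g y].
Proof.
move=> HS SU sep gB.
have /choice[F1 hF1] : forall n, suslin (g @^-1` U n) by move=> n; case: (suslin_borel (gB _ (SU n))).
have /choice[F0 hF0] : forall n, suslin (~` (g @^-1` U n)) by move=> n; case: (suslin_borel (gB _ (SU n))).
pose cond y n p q k := (U n y -> F1 n p q k) /\ ((~` U n) y -> F0 n p q k).
(* Row 0 of a branch carries [p] and row [n.+1] the witness for the n-th test; [md n k] entries
   suffice to read the k-th condition of that test. *)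
pose md n k := maxn (rowmod 0 k) (rowmod n.+1 k).
pose ext (s : seq nat) := nth 0%N s.
have cond_agree y n k r r' : agree (md n k) r r' ->
    cond y n (row 0 r) (row n.+1 r) k -> cond y n (row 0 r') (row n.+1 r') k.
  move=> rr; have a1 : agree k (row 0 r) (row 0 r').
    by apply: row_agree; apply: agreeW rr; exact: leq_maxl.
  have a2 : agree k (row n.+1 r) (row n.+1 r').
    by apply: row_agree; apply: agreeW rr; exact: leq_maxr.
  move=> [h1 h0]; split=> [/h1|/h0]; [exact: (hF1 n).1 | exact: (hF0 n).1].
exists (fun y s => forall n k, (md n k <= size s)%N -> cond y n (row 0 (ext s)) (row n.+1 (ext s)) k).
have ext_rcons s i : agree (size s) (ext (rcons s i)) (ext s).
  by move=> l ls; rewrite /ext nth_rcons ls.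
have ext_mkseq b n : agree n (ext (mkseq b n)) b by move=> l ls; rewrite /ext nth_mkseq.
split.
- move=> y s i h n k mk; apply: cond_agree (h n k _); last by rewrite size_rcons leqW.
  exact: agreeW mk (ext_rcons s i).
- move=> s; rewrite (_ : [set y | _] = \bigcap_nk [set y | (md nk.1 nk.2 <= size s)%N ->
     cond y nk.1 (row 0 (ext s)) (row nk.1.+1 (ext s)) nk.2]).
    apply: sa_bigcap => // -[n k] /=.
    apply: (@sa_imply _ _ HS [set y | (md n k <= size s)%N]); first exact: sa_prop.
    apply: (@saI _ _ HS [set y | U n y -> _] [set y | (~` U n) y -> _]).
      by apply: sa_imply => //; exact: sa_prop.
    by apply: sa_imply => //; [exact: saC | exact: sa_prop].
  apply/seteqP; split => [y h [n k] _ /=|y h n k]; [exact: h | exact: (h (n, k) I)].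
- move=> y; split=> [[b hb]|[p _ pE]].
    have hc n k : cond y n (row 0 b) (row n.+1 b) k.
      apply: cond_agree (hb (md n k) n k _); last by rewrite size_mkseq.
      exact: ext_mkseq.
    exists (row 0 b) => //; apply: sep => n; split => [Ug|Uy].
      apply: contrapT => nU; have : (~` (g @^-1` U n)) (row 0 b); last by apply.
      by apply/(hF0 n).2; exists (row n.+1 b) => k; apply: (hc n k).2.
    by have : (g @^-1` U n) (row 0 b); [apply/(hF1 n).2; exists (row n.+1 b) => k; apply: (hc n k).1 | ].
  have /choice[q hq] : forall n, exists q, forall k, cond y n p q k.
    move=> n; have [Uy|nUy] := pselect (U n y).
      have /(hF1 n).2[q h] : (g @^-1` U n) p by rewrite /preimage /= pE.
      by exists q => k; split.
    have /(hF0 n).2[q h] : (~` (g @^-1` U n)) p by rewrite /setC /preimage /= pE.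
    by exists q => k; split.
  pose r := unrow (fun i => if i is n.+1 then q n else p); exists r => m n k mk.
  apply: (@cond_agree y n k r).
    by apply/agree_sym; apply: agreeW (ext_mkseq r m); move: mk; rewrite size_mkseq.
  by rewrite /r !row_unrow.
Qed.

Lemma standard_borel_sa (Y : Type) (SY : set (set Y)) : standard_borel SY -> sigma_algebra setT SY.
Proof. by case=> O [_ ->]; exact: smallest_sigma_algebra. Qed.

Lemma standard_borel_separated (Y : Type) (SY : set (set Y)) : standard_borel SY ->
  exists U : nat -> set Y, (forall n, SY (U n)) /\
    forall y y', (forall n, U n y <-> U n y') -> y = y'.
Proof.
case=> O [[d [[d0 [dE [dC dT]]] OE _ [D [/countable_injP[f finj] Dd]]]] ->].
pose U n := if unpickle n is Some (k, m) then
  [set y | exists x, [/\ D x, f x = k & d x y < m.+1%:R^-1]] else set0.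
exists U; split.
  move=> n; rewrite /U; case: (unpickle n) => [[k m]|]; last exact: sa0 (smallest_sigma_algebra _ _).
  apply: sub_sigma_algebra; rewrite OE => y [x [Dx fx dxy]].
  exists (m.+1%:R^-1 - d x y); first by rewrite subr_gt0.
  move=> y' yy'; exists x; split => //; apply: le_lt_trans (dT x y y') _; rewrite -ltrBrDl; exact: yy'.
move=> y y' h; apply/dE; apply/eqP; rewrite eq_le d0 andbT leNgt; apply/negP => dpos.
have d2 : 0 < d y y' / 2 by rewrite divr_gt0.
have [m hm] : exists m : nat, m.+1%:R^-1 <= d y y' / 2.
  exists (Num.bound (d y y' / 2)^-1); rewrite -[leRHS]invrK lef_pV2 ?posrE ?invr_gt0 //.
  apply: ltW; apply: lt_le_trans (archi_boundP _) _; first by rewrite invr_ge0 ltW.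
  by rewrite ler_nat.
have m0 : 0 < m.+1%:R^-1 :> R by rewrite invr_gt0.
have [x Dx yx] := Dd y _ m0.
have := h (pickle (f x, m)); rewrite /U pickleK => -[hy _].
have [|x' [Dx' fx' x'y']] := hy; first by exists x; split => //; rewrite dC.
have xx : x' = x by apply: finj => //; rewrite inE.
rewrite xx in x'y'; have h1 := le_lt_trans (dT y x y') (ltrD yx x'y').
have h2 : m.+1%:R^-1 + m.+1%:R^-1 <= d y y' by rewrite (splitr (d y y')) lerD.
by have := lt_le_trans h1 h2; rewrite ltxx.
Qed.

(** * Coding of subspaces *)

Definition cut_bits N (t : cantor_space) : N.-tuple bool := [tuple (t : nat -> bool) i | i < N].

Definition step_fun (d : nat * seq rat) : CDelta :=
  fun t => ratr (nth 0 d.2 (enum_rank (cut_bits d.1 t))).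

Definition dense_fun (k : nat) : CDelta := if unpickle k is Some d then step_fun d else fun=> 0.

Lemma dense_fun_in k : in_CDelta (dense_fun k).
Proof.
rewrite /dense_fun; case: (unpickle k) => [[N s]|]; last exact: in_CDelta_cst.
apply/in_CDeltaP => e e0; exists N => t t' tt.
have -> : step_fun (N, s) t = step_fun (N, s) t'; last by rewrite subrr normr0 ltW.
rewrite /step_fun /=; congr (ratr (nth 0 s (enum_rank _))).
by apply: eq_from_tnth => i; rewrite !tnth_mktuple; exact: tt.
Qed.

Lemma dense_funP (f : CDelta) (e : R) : in_CDelta f -> 0 < e -> exists k, dist_le f (dense_fun k) e.
Proof.
move=> /in_CDeltaP fc e0; have e2 : 0 < e / 2 by rewrite divr_gt0.
have [N hN] := fc _ e2.
pose ext (b : N.-tuple bool) : cantor_space := fun i => nth false b i.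
have /choice[v hv] : forall b : N.-tuple bool, exists q : rat, `|f (ext b) - ratr q| <= e / 2.
  by move=> b; exact: rat_approx.
exists (pickle (N, [seq v b | b <- enum {: N.-tuple bool}])) => t.
rewrite /dense_fun pickleK /step_fun /= (nth_map (cut_bits N t)); last first.
  by rewrite -cardT.
rewrite nth_enum_rank.
have -> : f t - ratr (v (cut_bits N t)) = (f t - f (ext (cut_bits N t))) +
    (f (ext (cut_bits N t)) - ratr (v (cut_bits N t))) by ring.
rewrite (splitr e); apply: (le_trans (ler_normD _ _)); apply: lerD => //.
apply: hN => i iN; rewrite /ext (_ : i = Ordinal iN) //.
by rewrite -tnth_nth tnth_mktuple.
Qed.

(* Row [0] of [p] is reserved for numeric parameters. *)
Definition represents (p : nat -> nat) (f : nat -> CDelta) :=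
  forall i, in_CDelta (f i) /\ forall k, dist_le (f i) (dense_fun (row i.+1 p k)) (hpow k).

Definition coded : set (nat -> nat) := [set p | exists f, represents p f].

Definition fam (p : nat -> nat) : nat -> CDelta :=
  if pselect (coded p) is left h then projT1 (cid h) else fun=> fun=> 0.

Lemma famP p : coded p -> represents p (fam p).
Proof. by rewrite /fam; case: pselect => // h _; case: (cid h). Qed.

Lemma fam_in p i : in_CDelta (fam p i).
Proof.
rewrite /fam; case: pselect => [h|_]; last exact: in_CDelta_cst.
by case: (cid h) => f hf; exact: (hf i).1.
Qed.

Lemma represents_inj p f g : represents p f -> represents p g -> f = g.
Proof.
move=> hf hg; apply: funext => i; apply: funext => t; apply/eqP; rewrite -subr_eq0 -normr_le0.
apply/ler_addgt0Pr => e e0; rewrite add0r.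
have [k hk] := hpow_small (divr_gt0 e0 (ltr0Sn R 1)).
have := dist_trans ((hf i).2 k) (dist_sym ((hg i).2 k)) t; lra.
Qed.

Lemma fam_eq p f : represents p f -> fam p = f.
Proof. by move=> pf; apply: (represents_inj _ pf); apply: famP; exists f. Qed.

Lemma code_point (f : nat -> CDelta) a b : (forall i, in_CDelta (f i)) ->
  exists p, [/\ represents p f, row 0 p 0 = a & row 0 p 1 = b].
Proof.
move=> fc; have /choice[v hv] : forall ik : nat * nat, exists m, dist_le (f ik.1) (dense_fun m) (hpow ik.2).
  by move=> [i k]; exact: dense_funP (hpow_gt0 k).
exists (unrow (fun i => if i is i'.+1 then fun k => v (i', k) else fun l => if l == 0%N then a else b)).
rewrite row_unrow; split => // i; split => // k; rewrite row_unrow; exact: (hv (i, k)).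
Qed.

Lemma sa_finite_coords (Q : (nat -> nat) -> Prop) n :
  (forall p p', agree n p p' -> Q p -> Q p') -> baire_borel [set p | Q p].
Proof.
move=> h; apply: sub_sigma_algebra => p Qp; exists n => p' pp; apply: h Qp => i il.
by rewrite pp.
Qed.

(** Existence of limits is replaced by the Cauchy conditions between approximations, which are
    countably many and read finitely many coordinates each. *)
Lemma coded_meas : baire_borel coded.
Proof.
rewrite (_ : coded = \bigcap_ikl [set p | dist_le (dense_fun (row ikl.1.1.+1 p ikl.1.2))
    (dense_fun (row ikl.1.1.+1 p ikl.2)) (hpow ikl.1.2 + hpow ikl.2)]).
  apply: (sa_bigcap sa_baire) => -[[i k] l] /=.
  apply: (@sa_finite_coords _ (rowmod i.+1 (maxn k l).+1)) => p p' /row_agree pp.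
  by rewrite (pp k) ?(pp l) // ltnS ?leq_maxl ?leq_maxr.
apply/seteqP; split => [p [f hf] [[i k] l] _ /=|p h].
  exact: dist_trans (dist_sym ((hf i).2 k)) ((hf i).2 l).
have /choice[f hf] : forall i, exists g, in_CDelta g /\ forall k, dist_le g (dense_fun (row i.+1 p k)) (hpow k).
  move=> i; have [||k l|g gc hg] := @cauchy_lim (fun k => dense_fun (row i.+1 p k)) hpow.
  - by move=> k; exact: dense_fun_in.
  - exact: hpow_small.
  - exact: (h (i, k, l)).
  - by exists g; split => // k; exact: dist_sym (hg k).
by exists f.
Qed.

(** Applied to the k-th approximations such a map reads finitely many coordinates of the code, with
    an error controlled by [L * hpow k]; this makes conditions on its value Borel. *)
Definition lip (Phi : (nat -> CDelta) -> CDelta) := exists n (L : R), 0 <= L /\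
  forall f g (e : R), (forall i, (i < n)%N -> dist_le (f i) (g i) e) -> dist_le (Phi f) (Phi g) (L * e).

Lemma lip_rlcomb q (k : nat -> nat) : lip (fun f => rlcomb q (fun i => f (k i))).
Proof.
exists (\max_(i < size q) k i).+1, (\sum_(i < size q) `|ratr (nth 0 q i)|); split; first exact: sumr_ge0.
move=> f g e fg t; rewrite /rlcomb /lcomb -sumrB mulr_suml.
apply: (le_trans (ler_norm_sum _ _ _)); apply: ler_sum => i _.
rewrite -mulrBr normrM ler_wpM2l //; apply: fg.
by rewrite ltnS; exact: (leq_bigmax (F := fun i : 'I_(size q) => k i)).
Qed.

Lemma lip_nth k : lip (fun f => f k).
Proof. by exists k.+1, 1; split => // f g e fg; rewrite mul1r; exact: fg. Qed.

Lemma lipD Phi Psi : lip Phi -> lip Psi -> lip (fun f t => Phi f t + Psi f t).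
Proof.
move=> [n [L [L0 h]]] [n' [L' [L0' h']]]; exists (maxn n n'), (L + L'); split; first exact: addr_ge0.
move=> f g e fg t; rewrite mulrDl opprD addrACA; apply: (le_trans (ler_normD _ _)); apply: lerD.
  by apply: h => i il; apply: fg; rewrite leq_max il.
by apply: h' => i il; apply: fg; rewrite leq_max il orbT.
Qed.

Lemma lipB Phi Psi : lip Phi -> lip Psi -> lip (fun f t => Phi f t - Psi f t).
Proof.
move=> h1 [n [L [L0 h]]]; apply: (lipD h1); exists n, L; split => // f g e fg t.
by rewrite -opprD normrN; exact: h.
Qed.

Definition approx_fam (p : nat -> nat) k : nat -> CDelta := fun i => dense_fun (row i.+1 p k).

Lemma lip_coords Phi (Q : CDelta -> Prop) k : lip Phi ->
  baire_borel [set p | Q (Phi (approx_fam p k))].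
Proof.
move=> [n [L [_ h]]].
apply: (@sa_finite_coords _ (\max_(i < n) (rowmod i.+1 k.+1))) => p p' pp.
suff -> : Phi (approx_fam p k) = Phi (approx_fam p' k) by [].
apply: funext => t; apply/eqP; rewrite -subr_eq0 -normr_le0 -(mulr0 L); apply: h => i il s.
suff -> : approx_fam p k i = approx_fam p' k i by rewrite subrr normr0.
rewrite /approx_fam; congr dense_fun; have := @row_agree i.+1 k.+1 p p'; apply => //.
by apply: agreeW pp; exact: (leq_bigmax (F := fun i : 'I_n => rowmod i.+1 k.+1) (Ordinal il)).
Qed.

Lemma lip_small (L e : R) : 0 <= L -> 0 < e -> exists k, L * hpow k <= e.
Proof.
move=> L0 e0; have L1 : 0 < L + 1 by rewrite ltr_wpDl.
have [k hk] := hpow_small (divr_gt0 e0 L1); exists k; rewrite ler_pdivlMr // in hk.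
have := hpow_gt0 k; lra.
Qed.

Lemma nbf_meas Phi (C : R) : lip Phi -> baire_borel [set p | coded p /\ nbf (Phi (fam p)) C].
Proof.
move=> lp; have [n [L [L0 h]]] := lp.
have hk p k : coded p -> dist_le (Phi (fam p)) (Phi (approx_fam p k)) (L * hpow k).
  by move=> /famP hp; apply: h => i _; exact: (hp i).2.
rewrite (_ : [set p | _] = coded `&` \bigcap_k [set p | nbf (Phi (approx_fam p k)) (C + L * hpow k)]).
  apply: (saI sa_baire); first exact: coded_meas.
  by apply: (sa_bigcap sa_baire) => k; exact: (lip_coords (fun g => nbf g (C + L * hpow k))).
apply/seteqP; split => [p [cp hC]|p [cp hC]]; split => //.
  by move=> k _; apply: nbf_dist hC (hk p k cp).
apply: nbf_lim => e e0; have [k ke] := lip_small L0 (divr_gt0 e0 (ltr0Sn R 1)).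
apply: nbfW (nbf_dist (hC k I) (dist_sym (hk p k cp))); lra.
Qed.

Lemma open_meas Phi U : lip Phi -> (forall p, in_CDelta (Phi (fam p))) -> CDelta_open U ->
  baire_borel [set p | coded p /\ U (Phi (fam p))].
Proof.
move=> lp Pc [_ Uo]; have [n [L [L0 h]]] := lp.
have hk p k : coded p -> dist_le (Phi (fam p)) (Phi (approx_fam p k)) (L * hpow k).
  by move=> /famP hp; apply: h => i _; exact: (hp i).2.
pose Q k (f : CDelta) := forall g, in_CDelta g -> dist_le f g (L * hpow k) -> U g.
rewrite (_ : [set p | _] = coded `&` \bigcup_k [set p | Q k (Phi (approx_fam p k))]).
  apply: (saI sa_baire); first exact: coded_meas.
  by apply: (sa_bigcup sa_baire) => k; exact: (lip_coords (Q k)).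
apply/seteqP; split => [p [cp Up]|p [cp [k _ hQ]]]; split => //; last first.
  by apply: hQ; [exact: Pc | exact: dist_sym (hk p k cp)].
have [e e0 he] := Uo _ Up; have [k ke] := lip_small L0 (divr_gt0 e0 (ltr0Sn R 1)).
exists k => // g gc hg; apply: he => // t.
by apply: (le_trans (dist_trans (hk p k cp) hg t)); lra.
Qed.

(** Residues 0 and 1 modulo 3 carry the two witnessing sequences. Residue 2 is left for a dense
    sequence, so that the closed span can be the whole given space. *)
Definition zseq (f : nat -> CDelta) i := f (3 * i)%N.
Definition wseq (f : nat -> CDelta) i := f (3 * i).+1.

(** The bound 1/2, against 1 in [sep_seq], leaves room to replace real coefficients by rational
    ones. *)
Definition sep_code (f : nat -> CDelta) := forall nq : nat * seq rat, size nq.2 = nq.1 ->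
  ~ nbf (fun t => f nq.1 t - rlcomb nq.2 f t) (1 / 2).
Definition bound_code (K : R) (f : nat -> CDelta) := forall qqC : seq rat * seq rat * rat,
  nbf (fun t => rlcomb qqC.1.1 (zseq f) t + rlcomb qqC.1.2 (wseq f) t) (ratr qqC.2) ->
  nbf (rlcomb qqC.1.1 (zseq f)) (K * ratr qqC.2).

(** A first parameter 0 marks the finite-dimensional case, the second one then bounding the number
    of generators; a nonzero first parameter is an integer projection constant. *)
Definition good_fin : set (nat -> nat) := [set p | coded p /\
  (row 0 p 0 = 0%N /\ forall i, (row 0 p 1 <= i)%N -> nbf (fam p i) 0)].
Definition good_inf : set (nat -> nat) := [set p | coded p /\
  [/\ row 0 p 0 <> 0%N, sep_code (zseq (fam p)), sep_code (wseq (fam p)) &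
     bound_code (row 0 p 0)%:R (fam p)]].

Lemma sa_coord m (A : nat -> Prop) : baire_borel [set p | A (p m)].
Proof. by apply: (@sa_finite_coords _ m.+1) => p p' pp; rewrite pp. Qed.

Lemma good_fin_meas : baire_borel good_fin.
Proof.
rewrite (_ : good_fin = coded `&` ([set p | row 0 p 0 = 0%N] `&`
   \bigcap_i [set p | (row 0 p 1 <= i)%N -> (coded `&` [set p | nbf (fam p i) 0]) p])).
  apply: (saI sa_baire); first exact: coded_meas.
  apply: (saI sa_baire); first exact: sa_coord (fun a => a = 0%N).
  apply: (sa_bigcap sa_baire) => i.
  apply: (@sa_imply _ _ sa_baire [set p | (row 0 p 1 <= i)%N]); first exact: sa_coord (fun a => (a <= i)%N).
  exact: nbf_meas (lip_nth i).
apply/seteqP; split => [p [cp [h1 h2]]|p [cp [h1 h2]]]; do 2!split => //.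
  by move=> i _ /= hi; split => //; exact: h2.
by move=> i hi; case: (h2 i I hi).
Qed.

Lemma sep_code_meas (k : nat -> nat) : baire_borel [set p | coded p /\ sep_code (fun i => fam p (k i))].
Proof.
rewrite (_ : [set p | _] = coded `&` \bigcap_nq [set p | size nq.2 = nq.1 ->
   (~` [set p | coded p /\ nbf (fun t => fam p (k nq.1) t - rlcomb nq.2 (fun i => fam p (k i)) t) (1 / 2)]) p]).
  apply: (saI sa_baire); first exact: coded_meas.
  apply: (sa_bigcap sa_baire) => -[n q] /=.
  apply: (@sa_imply _ _ sa_baire [set p | size q = n]); first exact: sa_prop sa_baire _.
  apply: (saC sa_baire).
  exact: (nbf_meas _ (lipB (lip_nth (k n)) (lip_rlcomb q k))).
apply/seteqP; split => [p [cp h]|p [cp h]]; split => //.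
  by move=> nq _ /= sz [_]; exact: h.
by move=> nq sz hn; apply: (h nq I sz).
Qed.

Lemma good_inf_meas : baire_borel good_inf.
Proof.
pose B (a : nat) := [set p | coded p /\ bound_code a%:R (fam p)].
have Bm a : baire_borel (B a).
  rewrite (_ : B a = coded `&` \bigcap_qqC [set p |
     (coded p /\ nbf (fun t => rlcomb qqC.1.1 (zseq (fam p)) t + rlcomb qqC.1.2 (wseq (fam p)) t) (ratr qqC.2)) ->
     (coded p /\ nbf (rlcomb qqC.1.1 (zseq (fam p))) (a%:R * ratr qqC.2))]).
    apply: (saI sa_baire); first exact: coded_meas.
    apply: (sa_bigcap sa_baire) => -[[q q'] C] /=; apply: (sa_imply sa_baire).
      exact: (nbf_meas _ (lipD (lip_rlcomb q (fun i => 3 * i)%N) (lip_rlcomb q' (fun i => (3 * i).+1)))).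
    exact: (nbf_meas _ (lip_rlcomb q (fun i => 3 * i)%N)).
  apply/seteqP; split => [p [cp h]|p [cp h]]; split => //.
    by move=> qqC _ /= [_ h1]; split => //; exact: h.
  by move=> qqC h1; case: (h qqC I).
rewrite (_ : good_inf = [set p | coded p /\ sep_code (zseq (fam p))] `&`
   ([set p | coded p /\ sep_code (wseq (fam p))] `&`
    \bigcup_a ([set p | row 0 p 0 = a /\ a <> 0%N] `&` B a))).
  apply: (saI sa_baire); first exact: (sep_code_meas (fun i => 3 * i)%N).
  apply: (saI sa_baire); first exact: (sep_code_meas (fun i => (3 * i).+1)).
  apply: (sa_bigcup sa_baire) => a; apply: (saI sa_baire) => //.
  exact: (sa_coord _ (fun b => b = a /\ a <> 0%N)).
apply/seteqP; split => [p [cp [h1 h2 h3 h4]]|p [[cp h2] [[_ h3] [a _ [[<- h1] [_ h4]]]]]]; last by split.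
by do 2!split => //; exists (row 0 p 0).
Qed.

Lemma sep_code_free (f : nat -> CDelta) : (forall i, in_CDelta (f i)) -> sep_code f -> free_seq f.
Proof.
move=> fc fs n c E; have e0 : 0 < 1 / 2 :> R by rewrite divr_gt0.
have [q [qn hq]] := rlcomb_approx n c fc e0.
by apply: (fs (n, q) qn) => t /=; rewrite E; exact: hq.
Qed.

Lemma bound_code_real (K : R) (f : nat -> CDelta) : (forall i, in_CDelta (f i)) -> 0 <= K -> bound_code K f ->
  forall n c n' c' C, nbf (fun t => lcomb n c (zseq f) t + lcomb n' c' (wseq f) t) C ->
    nbf (lcomb n c (zseq f)) (K * C).
Proof.
move=> fc K0 h n c n' c' C hC; apply: nbf_lim => e e0.
have K1 : 0 < 4 * K + 1 by lra.
have d0 : 0 < e / (4 * K + 1) by rewrite divr_gt0.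
set d := e / (4 * K + 1) in d0.
have dE : e = d * (4 * K + 1) by rewrite /d divfK // gt_eqF.
have [q [_ hq]] := rlcomb_approx n c (fun i => fc (3 * i)%N) d0.
have [q' [_ hq']] := rlcomb_approx n' c' (fun i => fc (3 * i).+1) d0.
have [C' hC'] := rat_approx (C + 3 * d) d0; move: hC'; rewrite ler_norml => /andP[c1 c2].
have h1 : nbf (fun t => rlcomb q (zseq f) t + rlcomb q' (wseq f) t) (ratr C').
  apply: nbfW (nbf_dist hC (_ : dist_le _ _ (d + d))); first by lra.
  by move=> t; rewrite opprD addrACA; apply: (le_trans (ler_normD _ _)); apply: lerD.
have h2 := nbf_dist (h (q, q', C') h1) (dist_sym hq); apply: nbfW h2 => /=.
have h3 : K * ratr C' <= K * (C + 4 * d) by apply: ler_wpM2l => //; lra.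
by rewrite dE; lra.
Qed.

Lemma finite_dim_not_HI X : finite_dim X -> ~ hereditarily_indecomposable X.
Proof. by move=> h [h' _]; exact: h' h. Qed.

Lemma clspan_finite (f : nat -> CDelta) n : (forall i, in_CDelta (f i)) ->
  (forall i, (n <= i)%N -> nbf (f i) 0) -> finite_dim (clspan f).
Proof.
move=> fc f0; pose s := mkseq f n.
have sc : closed_subspace (fspan s).
  apply: fspan_closed => i; have [il|il] := ltnP i n; first by rewrite nth_mkseq.
  by rewrite nth_default ?size_mkseq //; exact: in_CDelta_cst.
have fs i : fspan s (f i).
  have [il|il] := ltnP i n; last first.
    suff -> : f i = fun=> 0 by exact: cs0 sc.
    by apply: funext => t; apply/eqP; rewrite -normr_le0; exact: f0.
  exists (fun k => (k == i)%:R); rewrite lcomb_nth ?size_mkseq //.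
  by rewrite nth_mkseq.
exists n, (fun i => f i); split; first by move=> i; exact: clspan_nth.
move=> g /(clspan_sub sc fs)[c ->]; exists (fun i => c i); apply: funext => t.
by rewrite /lcomb size_mkseq; apply: eq_bigr => i _; rewrite nth_mkseq.
Qed.

Lemma dense_in_subspace X : closed_subspace X -> exists x : nat -> CDelta,
  (forall i, X (x i)) /\ forall g, X g -> forall e : R, 0 < e -> exists i, dist_le g (x i) e.
Proof.
move=> Xc; have /choice[v hv] : forall kj : nat * nat, exists g, X g /\
    ((exists2 h, X h & dist_le h (dense_fun kj.1) (hpow kj.2)) -> dist_le g (dense_fun kj.1) (hpow kj.2)).
  move=> [k j] /=; have [[h Xh hh]|n] := pselect (exists2 h, X h & dist_le h (dense_fun k) (hpow j)).
    by exists h.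
  by exists (fun=> 0); split; [exact: cs0 | move/n].
exists (fun i => if unpickle i is Some kj then v kj else fun=> 0); split.
  by move=> i; case: (unpickle i) => [kj|]; [case: (hv kj) | exact: cs0].
move=> g Xg e e0; have [j hj] := hpow_small (divr_gt0 e0 (ltr0Sn R 1)).
have [k hk] := dense_funP (cs_in Xc Xg) (hpow_gt0 j).
exists (pickle (k, j)); rewrite pickleK; have [_ h] := hv (k, j) => t.
apply: (le_trans (dist_trans hk (dist_sym (h _)) t)); first by exists g.
lra.
Qed.

Definition zero_seq : nat -> CDelta := fun _ _ => 0.

Lemma zero_in i : in_CDelta (zero_seq i). Proof. exact: in_CDelta_cst. Qed.

Lemma SB_ext (X X' : SB) : proj1_sig X = proj1_sig X' -> X = X'.
Proof. by case: X X' => [X h] [X' h'] /= E; subst X'; congr exist; exact: Prop_irrelevance. Qed.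

Theorem HI_coanalytic : coanalytic effros_borel HI.
Proof.
right; pose G := good_fin `|` good_inf.
have Gm : baire_borel G by apply: (saU sa_baire); [exact: good_fin_meas | exact: good_inf_meas].
(* The zero space is not hereditarily indecomposable, so bad codes can be sent there without leaving
   the complement. *)
pose X0 := mkSB (clspan_closed (@zero_in)).
pose F p := if pselect (G p) is left _ then mkSB (clspan_closed (@fam_in p)) else X0.
have FG p : G p -> proj1_sig (F p) = clspan (fam p) by rewrite /F; case: pselect.
have FnG p : ~ G p -> F p = X0 by rewrite /F; case: pselect.
have Gc p : G p -> coded p by case=> [[]|[]].
exists F; split.
  apply: (clspan_borel (@fam_in) sa_baire Gm _ FG FnG) => q U Uo.
  rewrite (_ : [set p | _] = G `&` [set p | coded p /\ U (rlcomb q (fam p))]).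
    apply: (saI sa_baire) => //; apply: (open_meas (lip_rlcomb q id)) => // p.
    exact: in_CDelta_lcomb (@fam_in p).
  by apply/seteqP; split => p /= [Gp h]; [split => //; split => //; exact: Gc | case: h].
apply/seteqP; split => [_ [p _ <-]|X nHI].
  rewrite /HI /setC /=; have [Gp|nG] := pselect (G p); last first.
    rewrite (FnG p nG); apply: finite_dim_not_HI; apply: (@clspan_finite zero_seq 0 (@zero_in)) => i _ t.
    by rewrite normr0.
  rewrite (FG p Gp); case: Gp => [[cp [_ h]]|[cp [a0 h1 h2 h3]]].
    by apply: finite_dim_not_HI; apply: clspan_finite h; exact: fam_in.
  apply: (@not_HI_seq _ (zseq (fam p)) (wseq (fam p)) (row 0 p 0)%:R).
  - exact: clspan_closed (@fam_in p).
  - by move=> i; exact: clspan_nth.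
  - by move=> i; exact: clspan_nth.
  - by apply: sep_code_free h1 => i; exact: fam_in.
  - by apply: sep_code_free h2 => i; exact: fam_in.
  - exact: ler0n.
  - by apply: bound_code_real h3; [exact: fam_in | exact: ler0n].
suff [f [a [b [fc Gf fX]]]] : exists (f : nat -> CDelta) (a b : nat), [/\ forall i, in_CDelta (f i),
    forall p, represents p f -> row 0 p 0 = a -> row 0 p 1 = b -> G p & clspan f = proj1_sig X].
  have [p [pf pa pb]] := code_point a b fc; exists p => //.
  by apply: SB_ext; rewrite (FG p (Gf p pf pa pb)) (fam_eq pf).
have Xc : closed_subspace (proj1_sig X) := proj2_sig X.
have [[n [v [Xv hv]]]|Xi] := pselect (finite_dim (proj1_sig X)).
  pose f i : CDelta := if insub i is Some k then v k else fun=> 0.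
  have Xf i : proj1_sig X (f i) by rewrite /f; case: insubP => [k _ _|_]; [exact: Xv | exact: cs0].
  exists f, 0%N, n; split; first by move=> i; exact: cs_in (Xf i).
    move=> p pf pa pb; left; split; first by exists f.
    rewrite pb (fam_eq pf); split => // i ni t; rewrite /f insubF ?normr0 //.
    by rewrite ltnNge ni.
  apply/seteqP; split; first exact: clspan_sub.
  move=> g /hv[c ->]; rewrite (_ : (fun t => _) = lcomb n (fun i => if insub i is Some k then c k else 0) f).
    exact: clspan_lcomb.
  by apply: funext => t; apply: eq_bigr => i _; rewrite /f valK.
have [z [w [K [Xz Xw sz sw [K0 hK]]]]] := not_HI_bound Xc Xi nHI.
have [x [Xx xd]] := dense_in_subspace Xc.
pose f i : CDelta := if (i %% 3 == 0)%N then z (i %/ 3)%N else if (i %% 3 == 1)%N then w (i %/ 3)%N else x (i %/ 3)%N.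
have fz i : f (3 * i)%N = z i by rewrite /f modnMr mulKn.
have fw i : f (3 * i).+1 = w i.
  have -> : (3 * i).+1 = (i * 3 + 1)%N by lia.
  by rewrite /f modnMDl divnMDl // addn0.
have fx i : f (3 * i).+2 = x i.
  have -> : (3 * i).+2 = (i * 3 + 2)%N by lia.
  by rewrite /f modnMDl divnMDl // addn0.
have zE : zseq f = z by apply: funext.
have wE : wseq f = w by apply: funext.
have Xf i : proj1_sig X (f i) by rewrite /f; case: ifP => _ //; case: ifP.
(* The successor keeps the first parameter nonzero even if [Num.bound K] is 0. *)
exists f, (Num.bound K).+1, 0%N; split; first by move=> i; exact: cs_in (Xf i).
  move=> p pf pa pb; right; split; first by exists f.
  have sep_sc (y : nat -> CDelta) : sep_seq y -> sep_code y.
    move=> ys [n q] /= qn hn; have [t ht] := ys n (fun i => ratr (nth 0 q i)).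
    by have := hn t; rewrite /rlcomb qn => h2; have := le_trans ht h2; lra.
  rewrite pa (fam_eq pf) zE wE; split => //; [exact: sep_sc|exact: sep_sc|].
  move=> [[q q'] C] /=; rewrite zE wE => h.
  apply: nbfW (hK _ _ _ _ _ h); [|exact: clspan_lcomb|exact: clspan_lcomb].
  apply: ler_wpM2r; first exact: nbf_ge0 h.
  apply: ltW; apply: lt_le_trans (archi_boundP K0) _; by rewrite ler_nat.
apply/seteqP; split; first exact: clspan_sub.
move=> g /xd h e /h[i hi]; exists (3 * i).+3, (fun k => (k == (3 * i).+2)%:R).
by rewrite lcomb_nth // fx.
Qed.

Lemma behead_mkseq (b : nat -> nat) n : behead (mkseq b n.+1) = mkseq (b \o succn) n.
Proof. by rewrite /mkseq /= (iotaDl 1 0) -map_comp. Qed.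

Lemma HI_complete (Y : Type) (SY : set (set Y)) (B : set Y) : standard_borel SY ->
  coanalytic SY B -> exists f : Y -> SB, borel_map SY effros_borel f /\ f @^-1` HI = B.
Proof.
move=> SB_Y BA; have HS := standard_borel_sa SB_Y.
have [T [Tp Tm TB]] : exists T : Y -> set (seq nat), [/\ forall y s i, T y (rcons s i) -> T y s,
    forall s, SY [set y | T y s] &
    forall y, (exists b, forall n, T y (mkseq b n)) <-> ~ B y].
  (* If the complement is empty there is no parametrization [g]; the empty tree, which has no
     branch, is used instead. *)
  case: BA => [B0|[g [gB gr]]].
    exists (fun=> set0); split => // [s|y]; first exact: sa_prop.
    by split => [[b /(_ 0%N)]//|nB]; have : set0 y by rewrite -B0.
  have [U [SU sep]] := standard_borel_separated SB_Y.
  have [T [Tp Tm TB]] := suslin_tree HS SU sep gB.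
  by exists T; split => // y; rewrite TB gr.
(* A copy of [T y] is hung below every node of length 1. Existence of a branch is unaffected, and
   every tree now has infinitely many nodes, which makes its space infinite dimensional. *)
pose T' y : set (seq nat) := [set s | (size s <= 1)%N \/ T y (behead s)].
have T'p y s i : T' y (rcons s i) -> T' y s.
  case: s => [|j s]; first by left.
  by case => [|/= /Tp h]; [rewrite size_rcons; left; exact: ltnW | right].
have wf y : (~ exists b, forall n, T' y (mkseq b n)) -> B y.
  move=> h; apply: contrapT => /TB[b hb]; apply: h.
  exists (fun i => if i is j.+1 then b j else 0%N) => -[|n]; first by left.
  by right; rewrite behead_mkseq; exact: hb.
have branch y : B y -> ~ exists b, forall n, T' y (mkseq b n).
  move=> By [b hb]; have /TB : exists b', forall n, T y (mkseq b' n); last exact.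
  (* Nodes of length at most 1 are in [T'] by default and say nothing about [T]; the membership is
     read off at length [n.+2], beyond them, and passed down to the prefix. *)
  exists (b \o succn) => n; apply: (Tp y _ (b n.+1)).
  by have := hb n.+2; rewrite /T' /= size_map size_iota -/(mkseq b n.+2) -mkseqS -behead_mkseq => -[].
exists (fun y => mkSB (@tree_space_closed (T' y))); split.
  apply: tree_space_borel => // s.
  by apply: saU => //; [exact: sa_prop | exact: Tm].
apply/seteqP; split => y /=; rewrite /HI /=.
  move=> h; apply: contrapT => nB; case: (pselect (exists b, forall n, T' y (mkseq b n))).
    by move=> [b hb]; exact: tree_space_not_HI hb h.
  by move=> /wf.
move=> By; apply: tree_space_HI; [exact: T'p | exact: branch | by move=> i; left].
Qed.

Theorem theorem5p13 : complete_coanalytic effros_borel HI.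
Proof.
by split=> [|Y SY SBY B BA]; [exact: HI_coanalytic | exact: HI_complete].
Qed.
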